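(* Let $V$ be a real vector space of dimension $\mathfrak n\ge 1$, $B$ a positive definite symmetric bilinear form on $V$, $L\subset V$ an integral lattice, $G\le \mathrm{SL}_2(\mathbb Z)$ a subgroup of finite index, and $\rho:\widetilde G\ltimes H(L,1)\to \mathrm{GL}(\mathcal W)$ a representation whose kernel has finite index, with $\rho(([0,0],-1))=-\mathrm{id}_{\mathcal W}$, and such that moreover $\rho(([v,0],1))=\rho(([0,v],1))=\mathrm{id}_{\mathcal W}$ for all $v\in L$. Let $k\in\frac12\mathbb Z$ with $k\notin\{0,-1,-2,\dots\}$. Let $\mathfrak B=(e_1,\dots,e_{\mathfrak n})$ be an $\mathbb R$-basis of $V$, let $d=|L^\sharp/L|$, let $\mathcal P_0=\{\mathbf p_1,\dots,\mathbf p_d\}\subset\mathbb Z_{\ge0}^{\mathfrak n}$ have $d$ elements, and write $L^\sharp/L=\{t_1+L,\dots,t_d+L\}$. If the function $$\mathcal F^{\mathfrak B}_{\underline L,\mathcal P_0}(\tau)=\det\Big(\frac{1}{(2\pi i)^{s(\mathbf p_i)}}\,\partial^{\mathbf p_i}\vartheta_{\underline L,t_j}\big|_{z=0}(\tau)\Big)_{1\le i,j\le d}$$ is not identically zero on $\mathbb H$, then the map $\phi\mapsto (D_{k,\mathbf p}\phi)_{\mathbf p\in\widehat{\mathcal P_0}}$ is a $\mathbb C$-linear embedding $$J^!_{k,L}(G,\rho)\hookrightarrow\prod_{\mathbf p\in\widehat{\mathcal P_0}}M^!_{k+s(\mathbf p)}(G,\rho|_{\widetilde G}).$$ Moreover it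 gives embeddings $J^{\mathrm{weak}}_{k,L}(G,\rho)\hookrightarrow\prod_{\mathbf p\in\widehat{\mathcal P_0}}M_{k+s(\mathbf p)}(G,\rho|_{\widetilde G})$, and, provided $\mathbf 0\in\widehat{\mathcal P_0}$, $J_{k,L}(G,\rho)\hookrightarrow M_k(G,\rho|_{\widetilde G})\times\prod_{\mathbf 0\ne\mathbf p\in\widehat{\mathcal P_0}}S_{k+s(\mathbf p)}(G,\rho|_{\widetilde G})$.
   Context: Notation: $e(x)=\exp(2\pi i x)$, $\mathbb H$ is the upper half plane, $q^n=e(n\tau)$. $\mathcal V=V\oplus iV$ is the complexification of $V$; $B$ is extended $\mathbb C$-bilinearly to $\mathcal V$, and $Q(v)=\frac12B(v,v)$. A lattice $L$ is the $\mathbb Z$-span of an $\mathbb R$-basis of $V$; it is integral if $B(L,L)\subseteq\mathbb Z$; $L^\sharp=\{v\in V:B(v,L)\subseteq\mathbb Z\}$. $\mathcal W$ is a finite-dimensional complex vector space. Metaplectic group: $\widetilde{\mathrm{SL}_2(\mathbb Z)}$ is the set of pairs $(\gamma,\varepsilon\sqrt{c\tau+d})$ with $\gamma=\begin{pmatrix}a&b\\c&d\end{pmatrix}\in\mathrm{SL}_2(\mathbb Z)$, $\varepsilon=\pm1$, $\sqrt{\cdot}$ the principal branch, with product $(\gamma_1,\phi_1(\tau))(\gamma_2,\phi_2(\tau))=(\gamma_1\gamma_2,\phi_1(\gamma_2\tau)\phi_2(\tau))$; $\widetilde G$ is the preimage of $G$. Heisenberg group: elements $([v,w],\xi)$ with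 $v,w\in V$, $|\xi|=1$, product $([v_1,w_1],\xi_1)([v_2,w_2],\xi_2)=([v_1+v_2,w_1+w_2],\xi_1\xi_2e^{\pi i(B(v_1,w_2)-B(v_2,w_1))})$; $H(L,1)$ is the subgroup with $v,w\in L$, $\xi=\pm1$. The metaplectic group acts on the right by $[v,w]\gamma=[av+cw,bv+dw]$, and $\widetilde G\ltimes H(L,1)$ is the corresponding semidirect product, whose elements $g=(\gamma,\varepsilon\sqrt{c\tau+d},[v,w],\xi)$ are the products $\gamma h$. For $k\in\frac12\mathbb Z$ and $f:\mathbb H\times\mathcal V\to\mathcal W$, the slash operator is $(f|_{k,B}g)(\tau,z)=(\varepsilon\sqrt{c\tau+d})^{-2k}\,\xi\,e\!\big(-\tfrac{cQ(z+\tau v+w)}{c\tau+d}+\tau Q(v)+B(v,z)+\tfrac12B(v,w)\big)f\big(\tfrac{a\tau+b}{c\tau+d},\tfrac{z+\tau v+w}{c\tau+d}\big)$. Jacobi forms: a holomorphic $\phi:\mathbb H\times\mathcal V\to\mathcal W$ with $\phi|_{k,B}g=\rho(g)\circ\phi$ for all $g\in\widetilde G\ltimes H(L,1)$ has, for every $g\in\widetilde{\mathrm{SL}_2(\mathbb Z)}\ltimes H(L,1)$, a normally convergent expansion $\phi|_{k,B}g=\sum_{n,t}c^g(n,t)q^ne(B(t,z))$ with $n\in\frac1M\mathbb Z$, $t\in\frac1M L^\sharp$ for some positive integer $M$. $J^!_{k,L}(G,\rho)$ (weakly holomorphic) consists of those $\phi$ such that for each $g$ there is $N_0$ with $c^g(n,t)=0$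 for $n<N_0$; $J^{\mathrm{weak}}_{k,L}(G,\rho)$ those with $N_0=0$ for all $g$; $J_{k,L}(G,\rho)$ those with $c^g(n,t)=0$ unless $n\ge Q(t)$, for all $g$. Modular forms: for a representation $\sigma$ of $\widetilde G$ on $\mathcal W$ (here $\rho|_{\widetilde G}(\gamma)=\rho(\gamma,[0,0],1)$), with $(h|_k(\gamma,\varepsilon\sqrt{c\tau+d}))(\tau)=(\varepsilon\sqrt{c\tau+d})^{-2k}h(\gamma\tau)$, $M^!_k(G,\sigma)$ is the space of holomorphic $h:\mathbb H\to\mathcal W$ with $h|_k\gamma=\sigma(\gamma)h$ for $\gamma\in\widetilde G$ such that for every $\gamma\in\widetilde{\mathrm{SL}_2(\mathbb Z)}$ the $q$-expansion (in fractional powers) of $h|_k\gamma$ has finitely many negative powers; $M_k$: no negative powers; $S_k$: only positive powers. Operators: for $\mathbf p\in\mathbb Z^{\mathfrak n}$, $s(\mathbf p)=\sum p_i$. For $\Lambda=(\lambda_{ij})\in M_{\mathfrak n}(\mathbb Z_{\ge0})$: $s(\Lambda)=\sum\lambda_{ij}$, $\Lambda!=\prod\lambda_{ij}!$, $\pi(\Lambda)\in\mathbb Z^{\mathfrak n}$ with $i$-th component $\sum_j\lambda_{ij}+\sum_j\lambda_{ji}$, and for a matrix $M=(m_{ij})$, $M^\Lambda=\prod m_{ij}^{\lambda_{ij}}$ ($0^0=1$). $G_{\mathfrak B}=(B(e_i,e_j))$. Write the Taylor expansion $\phi(\tau,z_1e_1+\dots+z_{\mathfrak n}e_{\mathfrak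 n})=\sum_{\mathbf j\in\mathbb Z_{\ge0}^{\mathfrak n}}h_{\mathbf j}(\tau)z_1^{j_1}\cdots z_{\mathfrak n}^{j_{\mathfrak n}}$, with $h_{\mathbf j}=0$ if $\mathbf j\notin\mathbb Z_{\ge0}^{\mathfrak n}$. For $\mathbf p\in\mathbb Z_{\ge0}^{\mathfrak n}$, with $\lambda=[s(\mathbf p)/2]$, $\lambda'=[(s(\mathbf p)-1)/2]$, $D_{k,\mathbf p}\phi=4^\lambda\lambda!\sum_{\Lambda:\,s(\Lambda)\le\lambda}\frac{(-\pi iG_{\mathfrak B})^\Lambda}{\Lambda!}\Big(\prod_{m=\lambda'}^{s(\mathbf p)-2-s(\Lambda)}(k+m)\Big)\frac{d^{s(\Lambda)}}{d\tau^{s(\Lambda)}}h_{\mathbf p-\pi(\Lambda)}$ (empty product $=1$). Partial order: $\mathbf p_1\preceq\mathbf p_2$ iff $\mathbf p_2-\mathbf p_1\in\mathbb Z_{\ge0}^{\mathfrak n}$ and $s(\mathbf p_1)\equiv s(\mathbf p_2)\pmod 2$; $\widehat{\mathcal P}=\{\mathbf p\in\mathbb Z^{\mathfrak n}_{\ge0}:\mathbf p\preceq\mathbf p'\text{ for some }\mathbf p'\in\mathcal P\}$. Theta series: for $t\in L^\sharp$, $\vartheta_{\underline L,t}(\tau,z)=\sum_{v\in t+L}e(\tau Q(v)+B(v,z))$; $\partial^{\mathbf p}=\partial^{s(\mathbf p)}/\partial z_1^{p_1}\cdots\partial z_{\mathfrak n}^{p_{\mathfrak n}}$ in the coordinates $z=\sum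 z_ie_i$. *)

(* Defs.v *)
From HB Require Import structures.
From mathcomp Require Import all_boot all_order all_algebra.
From mathcomp Require Import all_classical all_reals all_analysis.
From mathcomp.real_closed Require Export complex.
Set Implicit Arguments.
Unset Strict Implicit.
Unset Printing Implicit Defensive.
Import Order.TTheory GRing.Theory Num.Theory.
Import numFieldNormedType.Exports.
Local Open Scope ring_scope.

Section Defs.
Variable R : realType.
Local Notation C := R[i].

Definition cRe (z : C) : R := let: Complex a _ := z in a.
Definition cIm (z : C) : R := let: Complex _ b := z in b.
Definition toC (x : R) : C := Complex x 0.
Definition iC : C := Complex 0 1.
Definition piC : C := toC pi.
(* e(x) = exp(2 pi i x) *)
Definition ee (x : C) : C :=
  Complex (expR (- (2 * pi) * cIm x) * cos (2 * pi * cRe x))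
          (expR (- (2 * pi) * cIm x) * sin (2 * pi * cRe x)).
(* principal branch of the square root: Re >= 0, arg in (-pi/2, pi/2] *)
Definition csqrt (z : C) : C :=
  let r := Num.sqrt (cRe z ^+ 2 + cIm z ^+ 2) in
  Complex (Num.sqrt ((r + cRe z) / 2))
          ((if cIm z < 0 then -1 else 1) * Num.sqrt ((r - cRe z) / 2)).
Definition sgnC (b : bool) : C := if b then -1 else 1.
Definition inH (tau : C) : Prop := 0 < cIm tau.

Definition HasSum (I : eqType) (W : normedModType C) (f : I -> W) (s : W) : Prop :=
  forall eps : R, 0 < eps -> exists F0 : seq I, forall F : seq I,
    uniq F -> {subset F0 <= F} -> `|\sum_(i <- F) f i - s| < toC eps.

Variable n : nat.

Definition vC (v : 'rV[R]_n) : 'rV[C]_n := map_mx toC v.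
Definition Bre (Bm : 'M[R]_n) (v w : 'rV[R]_n) : R := (v *m Bm *m w^T) 0 0.
Definition BC (Bm : 'M[R]_n) (z w : 'rV[C]_n) : C := (z *m map_mx toC Bm *m w^T) 0 0.
Definition QC (Bm : 'M[R]_n) (z : 'rV[C]_n) : C := BC Bm z z / 2.
Definition Qre (Bm : 'M[R]_n) (v : 'rV[R]_n) : R := Bre Bm v v / 2.

Definition posdef_sym (Bm : 'M[R]_n) : Prop :=
  Bm^T = Bm /\ forall v : 'rV[R]_n, v != 0 -> 0 < Bre Bm v v.

(* L = Z-span of the rows of Lb (an R-basis of V) *)
Definition latv (Lb : 'M[R]_n) (a : 'rV[int]_n) : 'rV[R]_n :=
  map_mx (fun x : int => x%:~R) a *m Lb.
Definition is_lattice (Lb : 'M[R]_n) : Prop := Lb \in unitmx.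
Definition inL (Lb : 'M[R]_n) (v : 'rV[R]_n) : Prop := exists a, v = latv Lb a.
Definition integral_lattice (Bm Lb : 'M[R]_n) : Prop :=
  forall a b, exists z : int, Bre Bm (latv Lb a) (latv Lb b) = z%:~R.
Definition inLsharp (Bm Lb : 'M[R]_n) (v : 'rV[R]_n) : Prop :=
  forall w, inL Lb w -> exists z : int, Bre Bm v w = z%:~R.
(* t : 'I_d -> V is a complete system of distinct representatives of L^#/L
   (so d = |L^#/L|) *)
Definition dual_reps (Bm Lb : 'M[R]_n) (d : nat) (t : 'I_d -> 'rV[R]_n) : Prop :=
  (forall j, inLsharp Bm Lb (t j)) /\
  forall v, inLsharp Bm Lb v -> exists j, inL Lb (v - t j) /\
    forall j', inL Lb (v - t j') -> j' = j.

Definition i0 : 'I_2 := ord0.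
Definition i1 : 'I_2 := ord_max.
Definition fin_index_subgroup (G : 'M[int]_2 -> Prop) : Prop :=
  (forall g, G g -> \det g = 1) /\ G 1%:M /\
  (forall g h, G g -> G h -> G (g *m h)) /\ (forall g, G g -> G (invmx g)) /\
  exists (N : nat) (r : 'I_N -> 'M[int]_2), (forall j, \det (r j) = 1) /\
    forall g, \det g = 1 -> exists j, G (g *m invmx (r j)).

(* ---------- elements of Mp_2(Z) |x H(L,1) ----------
   (gam, eps, a, b, xi) stands for (gam, (-1)^eps sqrt(c tau + d), [a Lb, b Lb], (-1)^xi) *)
Record melt := MElt { mgam : 'M[int]_2; meps : bool;
                      ma : 'rV[int]_n; mb : 'rV[int]_n; mxi : bool }.
Definition ga (g : 'M[int]_2) : C := (g i0 i0)%:~R.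
Definition gb (g : 'M[int]_2) : C := (g i0 i1)%:~R.
Definition gc (g : 'M[int]_2) : C := (g i1 i0)%:~R.
Definition gd (g : 'M[int]_2) : C := (g i1 i1)%:~R.
Definition mobius (g : 'M[int]_2) (tau : C) : C := (ga g * tau + gb g) / (gc g * tau + gd g).
Definition jfac (g : 'M[int]_2) (eps : bool) (tau : C) : C :=
  sgnC eps * csqrt (gc g * tau + gd g).
Definition valid (G : 'M[int]_2 -> Prop) (g : melt) : Prop :=
  \det (mgam g) = 1 /\ G (mgam g).

(* g3 = g1 * g2 in Mp_2(Z) |x H(L,1), where (gam1 h1)(gam2 h2) = gam1 gam2 (h1 . gam2) h2 *)
Definition mul_rel (Bm Lb : 'M[R]_n) (g1 g2 g3 : melt) : Prop :=
  let A := mgam g2 i0 i0 in let Bq := mgam g2 i0 i1 in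
  let Cq := mgam g2 i1 i0 in let D := mgam g2 i1 i1 in
  let a1 := A *: ma g1 + Cq *: mb g1 in
  let b1 := Bq *: ma g1 + D *: mb g1 in
  mgam g3 = mgam g1 *m mgam g2 /\
  (forall tau, inH tau -> jfac (mgam g3) (meps g3) tau =
       jfac (mgam g1) (meps g1) (mobius (mgam g2) tau) * jfac (mgam g2) (meps g2) tau) /\
  ma g3 = a1 + ma g2 /\ mb g3 = b1 + mb g2 /\
  sgnC (mxi g3) = sgnC (mxi g1) * sgnC (mxi g2) *
     ee (toC (Bre Bm (latv Lb a1) (latv Lb (mb g2)) - Bre Bm (latv Lb (ma g2)) (latv Lb b1)) / 2).

Variable m : nat. (* W = C^m, column vectors *)

Definition is_rep (G : 'M[int]_2 -> Prop) (Bm Lb : 'M[R]_n) (rho : melt -> 'M[C]_m) : Prop :=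
  (forall g, valid G g -> rho g \in unitmx) /\
  (forall g1 g2 g3, valid G g1 -> valid G g2 -> valid G g3 ->
      mul_rel Bm Lb g1 g2 g3 -> rho g3 = rho g1 *m rho g2) /\
  (* finitely many cosets of ker rho: g lies in (ker rho) r_j iff rho g = rho r_j *)
  exists (N : nat) (r : 'I_N -> melt), (forall j, valid G (r j)) /\
    forall g, valid G g -> exists j, rho g = rho (r j).

(* ---------- slash operators (weight k = k2/2) ---------- *)
Definition slashJ (Bm Lb : 'M[R]_n) (k2 : int) (g : melt)
  (phi : C -> 'rV[C]_n -> 'cV[C]_m) (tau : C) (z : 'rV[C]_n) : 'cV[C]_m :=
  let v := vC (latv Lb (ma g)) in let w := vC (latv Lb (mb g)) in
  let c := gc (mgam g) in let d := gd (mgam g) in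
  let u := z + tau *: v + w in
  ((jfac (mgam g) (meps g) tau) ^ (- k2) * sgnC (mxi g) *
     ee (- c * QC Bm u / (c * tau + d) + tau * QC Bm v + BC Bm v z + BC Bm v w / 2))
  *: phi (mobius (mgam g) tau) ((c * tau + d)^-1 *: u).

Definition slashM (k2 : int) (gam : 'M[int]_2) (eps : bool) (h : C -> 'cV[C]_m) (tau : C)
  : 'cV[C]_m := (jfac gam eps tau) ^ (- k2) *: h (mobius gam tau).

Definition holoJ (phi : C -> 'rV[C]_n -> 'cV[C]_m) : Prop :=
  forall tau z, inH tau ->
    differentiable (fun p : C^o * 'rV[C]_n => phi p.1 p.2) (tau : C^o, z).
Definition holoM (h : C -> 'cV[C]_m) : Prop :=
  forall tau, inH tau -> differentiable (h : C^o -> 'cV[C]_m) (tau : C^o).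

Inductive jkind := JWeakHol | JWeak | JHol.

Definition jsupport (Bm : 'M[R]_n) (kd : jkind) (M : nat)
  (c : int -> 'rV[R]_n -> 'cV[C]_m) : Prop :=
  match kd with
  | JWeakHol => exists N0 : R, forall a t, c a t != 0 -> N0 <= (a%:~R / M%:R : R)
  | JWeak => forall a t, c a t != 0 -> 0 <= (a%:~R / M%:R : R)
  | JHol => forall a t, c a t != 0 -> Qre Bm t <= (a%:~R / M%:R : R)
  end.

Definition JForm (kd : jkind) (G : 'M[int]_2 -> Prop) (Bm Lb : 'M[R]_n)
  (rho : melt -> 'M[C]_m) (k2 : int) (phi : C -> 'rV[C]_n -> 'cV[C]_m) : Prop :=
  holoJ phi /\
  (forall g, valid G g -> forall tau z, inH tau ->
      slashJ Bm Lb k2 g phi tau z = rho g *m phi tau z) /\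
  (forall g : melt, \det (mgam g) = 1 ->
    exists M : nat, (0 < M)%N /\ exists c : int -> 'rV[R]_n -> 'cV[C]_m,
      (forall a t, c a t != 0 -> inLsharp Bm Lb (M%:R *: t)) /\
      jsupport Bm kd M c /\
      forall tau z, inH tau ->
        HasSum (fun p : int * 'rV[R]_n =>
                  (ee ((p.1%:~R / M%:R) * tau) * ee (BC Bm (vC p.2) z)) *: c p.1 p.2)
               (slashJ Bm Lb k2 g phi tau z)).

Inductive mkind := MWeakHol | MHol | MCusp.

Definition msupport (kd : mkind) (c : int -> 'cV[C]_m) : Prop :=
  match kd with
  | MWeakHol => exists N0 : int, forall a, c a != 0 -> N0 <= a
  | MHol => forall a, c a != 0 -> 0 <= a
  | MCusp => forall a, c a != 0 -> 0 < a
  end.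

Definition MForm (kd : mkind) (G : 'M[int]_2 -> Prop) (rho : melt -> 'M[C]_m)
  (k2 : int) (h : C -> 'cV[C]_m) : Prop :=
  holoM h /\
  (forall gam eps, \det gam = 1 -> G gam -> forall tau, inH tau ->
      slashM k2 gam eps h tau = rho (MElt gam eps 0 0 false) *m h tau) /\
  (forall gam eps, \det gam = 1 ->
    exists M : nat, (0 < M)%N /\ exists c : int -> 'cV[C]_m,
      msupport kd c /\
      forall tau, inH tau ->
        HasSum (fun a : int => ee ((a%:~R / M%:R) * tau) *: c a) (slashM k2 gam eps h tau)).

Definition mi_sum (p : {ffun 'I_n -> nat}) : nat := \sum_i p i.

Definition pD (W : normedModType C) (v : 'rV[C]_n) (f : 'rV[C]_n -> W) : 'rV[C]_n -> W :=
  fun x => 'D_v f x.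
Definition partialn (W : normedModType C) (p : {ffun 'I_n -> nat})
  (f : 'rV[C]_n -> W) : 'rV[C]_n -> W :=
  foldr (fun i g => iter (p i) (pD (delta_mx 0 i)) g) f (enum 'I_n).

Definition EC (E : 'M[R]_n) : 'M[C]_n := map_mx toC E.

Definition hcoef (E : 'M[R]_n) (phi : C -> 'rV[C]_n -> 'cV[C]_m)
  (p : {ffun 'I_n -> nat}) (tau : C) : 'cV[C]_m :=
  (\prod_i ((p i)`!)%:R)^-1 *: partialn p (fun x => phi tau (x *m EC E)) 0.

Definition tauD (s : nat) (h : C -> 'cV[C]_m) : C -> 'cV[C]_m :=
  iter s (fun (g : C -> 'cV[C]_m) (t : C) => 'D_(1 : C^o) (g : C^o -> 'cV[C]_m) (t : C^o)) h.

Definition piL (lam : nat) (L : {ffun 'I_n * 'I_n -> 'I_lam.+1}) (i : 'I_n) : nat :=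
  \sum_j (L (i, j) : nat) + \sum_j (L (j, i) : nat).
Definition sumL (lam : nat) (L : {ffun 'I_n * 'I_n -> 'I_lam.+1}) : nat :=
  \sum_ij (L ij : nat).

Definition hshift (E : 'M[R]_n) (phi : C -> 'rV[C]_n -> 'cV[C]_m)
  (p : {ffun 'I_n -> nat}) (lam : nat) (L : {ffun 'I_n * 'I_n -> 'I_lam.+1})
  : C -> 'cV[C]_m :=
  if [forall i, (piL L i <= p i)%N] then hcoef E phi [ffun i => (p i - piL L i)%N]
  else fun _ => 0.

Definition prodk (k : C) (lo hi : int) : C :=
  if lo <= hi then \prod_(j < absz (hi - lo + 1)) (k + (lo + j%:Z)%:~R) else 1.

Definition Dk (Bm E : 'M[R]_n) (k2 : int) (p : {ffun 'I_n -> nat})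
  (phi : C -> 'rV[C]_n -> 'cV[C]_m) (tau : C) : 'cV[C]_m :=
  let s := mi_sum p in
  let lam := (s %/ 2)%N in
  let lam' := ((s%:Z - 1) %/ 2)%Z in
  let Gm := E *m Bm *m E^T in
  let k : C := k2%:~R / 2 in
  ((4 : C) ^+ lam * (lam`!)%:R) *:
  \sum_(L : {ffun 'I_n * 'I_n -> 'I_lam.+1} | (sumL L <= lam)%N)
     ((\prod_ij ((- piC * iC * toC (Gm ij.1 ij.2)) ^+ L ij / ((L ij)`!)%:R))
        * prodk k lam' (s%:Z - 2 - (sumL L)%:Z))
     *: tauD (sumL L) (hshift E phi p L) tau.

Definition thetaL (Bm Lb : 'M[R]_n) (t : 'rV[R]_n) (tau : C) (z : 'rV[C]_n) : C :=
  xget (0 : C) [set s : C | HasSum (W := C^o)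
     (fun a : 'rV[int]_n => let v := vC (t + latv Lb a) in ee (tau * QC Bm v + BC Bm v z))
     (s : C^o)].

Definition Fdet (Bm Lb E : 'M[R]_n) (d : nat) (P0 : 'I_d -> {ffun 'I_n -> nat})
  (t : 'I_d -> 'rV[R]_n) (tau : C) : C :=
  \det (\matrix_(i < d, j < d)
     ((2 * piC * iC) ^- mi_sum (P0 i) *
      partialn (W := C^o) (P0 i) (fun x => (thetaL Bm Lb (t j) tau (x *m EC E) : C^o)) 0)).

Definition preceq (p1 p2 : {ffun 'I_n -> nat}) : bool :=
  [forall i, (p1 i <= p2 i)%N] && (odd (mi_sum p1) == odd (mi_sum p2)).
Definition in_hat (d : nat) (P0 : 'I_d -> {ffun 'I_n -> nat}) (p : {ffun 'I_n -> nat}) : Prop :=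
  exists j, preceq p (P0 j).

End Defs.

(* Main.v *)
(**
  All functions involved are absolutely convergent sums of exponentials e(a tau + B(t, z)) with
  real exponents: for a Jacobi form this is the expansion at each cusp.  Such sums may be
  differentiated termwise, and the exponents with nonzero coefficient are determined by the function
  (a character averaging argument), so no complex analysis is used.

  Modularity of D_{k,p} phi: on a line z = w x, the generating polynomial of D_{k,p} phi over
  s(p) = s is a combination of tau-derivatives of the one-variable Taylor coefficients in w.  The
  transformation law of phi multiplies the Taylor series by exp(kappa c w^2 / (c tau + d)); expanding
  and differentiating, the unwanted terms are alternating binomial sums of polynomials of too
  small degree, hence vanish.  The support conditions are read off termwise: the terms of D_{k,p} phi
  have the same tau-exponents n as those of phi, and for s(p) > 0 the term with n = 0, t = 0 dies.

  Injectivity: since k is not a nonpositive integer, the coefficient of h_p in D_{k,p} is nonzero,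
  so the Taylor coefficients h_p, p in the hat of P_0, are recovered recursively.  By invariance
  under H(L,1), phi = sum_j H_j theta_{t_j} with H_j a q-series times e(-Q(t_j) tau), so the h_p
  with p in P_0 give d linear equations in the H_j with determinant F up to nonzero constants.
  The ring of q-series with bounded denominators is a domain and F is not zero, so the H_j are
  determined by the D_{k,p} phi.
*)
Require Import Defs.
From HB Require Import structures.
From mathcomp Require Import all_boot all_order all_algebra.
From mathcomp Require Import all_classical all_reals all_analysis.
From mathcomp.real_closed Require Import complex.
From mathcomp Require Import ring lra zify.
Import Order.TTheory GRing.Theory Num.Theory.
Import numFieldNormedType.Exports.
Import Normc.
Set Implicit Arguments.
Unset Strict Implicit.
Unset Printing Implicit Defensive.
Local Open Scope classical_set_scope.
Local Open Scope ring_scope.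

(** * Complex numbers and unordered sums *)

(** The constants in $D_{k,p}$ are tuned to the transformation law. With $\kappa=-\pi
    i\sum_{i,j}G_{ij}x_ix_j$, the multinomial theorem turns $\sum_{s(\Lambda)=r}(-\pi iG)^\Lambda
    x^{\pi(\Lambda)}/\Lambda!$ into $\kappa^r/r!$, while $2\pi i\,Q(w\sum_l x_le_l)=-\kappa w^2$ is,
    up to the factor $-c/(c\tau+d)$, the exponent of the slash operator. The operator and the
    automorphy factor thus carry the same $\kappa$, which is what makes a cancellation possible. A
    form and its slash by $\gamma$ have unrelated expansions, evaluated at different points
    $\gamma\tau$ and $\tau$. They are compared only through their power series in $w$, whose
    coefficients are separated on $|w|=1$ by the same character argument that separates Fourier
    coefficients. Real exponents make absolute convergence strong: the norms of an exponential
    $e(bh)$ at $h=\pm ir$ dominate $e^{2\pi|b|r}$, and this pays for all derivatives and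
    rearrangements. *)

Section Norm.
Variable R : realType.
Local Notation C := R[i].
Implicit Types x y z : C.

Lemma cRe_normE (x : C) : `|x| = toC (normc x).
Proof. by case: x. Qed.

Lemma toCD (a b : R) : toC (a + b) = toC a + toC b.
Proof. exact: (rmorphD (real_complex R)). Qed.
Lemma toCN (a : R) : toC (- a) = - toC a.
Proof. exact: (rmorphN (real_complex R)). Qed.
Lemma toCB (a b : R) : toC (a - b) = toC a - toC b.
Proof. exact: (rmorphB (real_complex R)). Qed.
Lemma toCM (a b : R) : toC (a * b) = toC a * toC b.
Proof. exact: (rmorphM (real_complex R)). Qed.
Lemma toCV (a : R) : toC (a^-1) = (toC a)^-1.
Proof. exact: (fmorphV (real_complex R)). Qed.
Lemma toCX (a : R) k : toC (a ^+ k) = toC a ^+ k.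
Proof. exact: (rmorphXn (real_complex R)). Qed.
Lemma toC_nat k : toC (k%:R : R) = k%:R.
Proof. exact: (rmorph_nat (real_complex R)). Qed.
Lemma toC_int k : toC (k%:~R : R) = k%:~R.
Proof. exact: (rmorph_int (real_complex R)). Qed.
Lemma toC_sum (I : Type) (r : seq I) (P : pred I) (F : I -> R) :
  toC (\sum_(i <- r | P i) F i) = \sum_(i <- r | P i) toC (F i).
Proof. exact: (rmorph_sum (real_complex R)). Qed.
Lemma cReD x y : cRe (x + y) = cRe x + cRe y.
Proof. by case: x; case: y. Qed.
Lemma cImD x y : cIm (x + y) = cIm x + cIm y.
Proof. by case: x; case: y. Qed.
Lemma cReN x : cRe (- x) = - cRe x. Proof. by case: x. Qed.
Lemma cImN x : cIm (- x) = - cIm x. Proof. by case: x. Qed.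
Lemma cRe_sum (I : Type) (r : seq I) (P : pred I) (F : I -> C) :
  cRe (\sum_(i <- r | P i) F i) = \sum_(i <- r | P i) cRe (F i).
Proof. by apply: (big_morph (@cRe R) cReD). Qed.
Lemma cIm_sum (I : Type) (r : seq I) (P : pred I) (F : I -> C) :
  cIm (\sum_(i <- r | P i) F i) = \sum_(i <- r | P i) cIm (F i).
Proof. by apply: (big_morph (@cIm R) cImD). Qed.
Lemma cE x : x = toC (cRe x) + iC R * toC (cIm x).
Proof. by case: x => a b; rewrite /toC /iC /cRe /cIm; simpc. Qed.

Lemma normc_ge0 x : 0 <= normc x.
Proof. by case: x => a b; apply: sqrtr_ge0. Qed.
Lemma normcB x y : normc (x - y) = normc (y - x).
Proof. by rewrite -normcN opprB. Qed.
Lemma normc_toC (a : R) : normc (toC a) = `|a|.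
Proof. by rewrite /normc /toC expr0n addr0 sqrtr_sqr. Qed.
Lemma normcX x k : normc (x ^+ k) = normc x ^+ k.
Proof. by elim: k => [|k IH]; rewrite ?expr0 ?normc1 // !exprS normcM IH. Qed.
Lemma normc_nat k : normc (k%:R : C) = k%:R.
Proof. by rewrite -toC_nat normc_toC normr_nat. Qed.
Lemma normc_sum (I : Type) (r : seq I) (P : pred I) (F : I -> C) :
  normc (\sum_(i <- r | P i) F i) <= \sum_(i <- r | P i) normc (F i).
Proof.
elim/big_ind2: _ => //; first by rewrite normc0.
by move=> x a y b h1 h2; apply: le_trans (le_normcD _ _) _; apply: lerD.
Qed.
Lemma normc_Re x : `|cRe x| <= normc x.
Proof.
case: x => a b /=; rewrite -sqrtr_sqr ler_wsqrtr //.
by rewrite lerDl sqr_ge0.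
Qed.
Lemma normc_Im x : `|cIm x| <= normc x.
Proof.
case: x => a b /=; rewrite -sqrtr_sqr ler_wsqrtr //.
by rewrite lerDr sqr_ge0.
Qed.
Lemma normc_le x : normc x <= `|cRe x| + `|cIm x|.
Proof.
case: x => a b /=.
have -> : `|a| + `|b| = Num.sqrt ((`|a| + `|b|) ^+ 2).
  by rewrite sqrtr_sqr [RHS]ger0_norm ?addr_ge0.
rewrite ler_wsqrtr // sqrrD !real_normK ?num_real //.
by rewrite lerD2r lerDl mulrn_wge0 // mulr_ge0.
Qed.
Lemma normc_eq0 x : (normc x == 0) = (x == 0).
Proof. by apply/eqP/eqP => [/eq0_normc //|->]; rewrite normc0. Qed.
Lemma normc_gt0 x : x != 0 -> 0 < normc x.
Proof. by move=> x0; rewrite lt_def normc_eq0 x0 normc_ge0. Qed.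
Lemma normc_small x : (forall e : R, 0 < e -> normc x <= e) -> x = 0.
Proof.
move=> h; apply/eqP; apply: contraT => /normc_gt0 x0.
have x2 : 0 < normc x / 2 by lra.
have := h _ x2; lra.
Qed.
Lemma normc_sub x y z : normc (x - z) <= normc (x - y) + normc (y - z).
Proof. by apply: le_trans (le_normcD _ _); rewrite subrKA. Qed.

End Norm.

Section Sums.
Variable R : realType.
Local Notation C := R[i].

Definition abssum (I : eqType) (f : I -> C) : Prop :=
  exists K : R, forall F : seq I, uniq F -> \sum_(i <- F) normc (f i) <= K.

Definition hsum (I : eqType) (f : I -> C) (s : C) : Prop :=
  forall e : R, 0 < e -> exists F0 : seq I, forall F : seq I,
    uniq F -> {subset F0 <= F} -> normc (\sum_(i <- F) f i - s) < e.

Lemma HasSum_hsum (I : eqType) (f : I -> C) (s : C) :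
  HasSum (W := C^o) f s <-> hsum f s.
Proof.
split=> h e e0; have [F0 hF] := h e e0; exists F0 => F uF sF; have := hF F uF sF.
  by rewrite cRe_normE ltcR.
by move=> h1; rewrite [`|_|]cRe_normE ltcR.
Qed.

(** The norm of a column is the maximum of the norms of its entries, so finitely many thresholds
    merge into one. This reduces later statements on vector-valued sums to scalar ones. *)
Lemma HasSum_mx (I : eqType) m (f : I -> 'cV[C]_m) (s : 'cV[C]_m) :
  HasSum f s <-> forall r, hsum (fun i => f i r 0) (s r 0).
Proof.
have key (e : R) (v : 'cV[C]_m) : 0 < e ->
    `|v| < toC e <-> forall r, normc (v r 0) < e.
  move=> e0; rewrite [`|v|]mx_normE.
  have pe : 0 < toC e by rewrite ltcR.
  have -> : toC e = (NngNum (ltW pe))%:num :> C by [].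
  rewrite num_lt.
  split.
    move/bigmax_ltP => [_ h] r.
    have := h (r, 0) isT; rewrite -num_lt /= cRe_normE ltcR //.
  move=> h; apply/bigmax_ltP; split=> [|[r j] _]; rewrite -num_lt //=.
  by rewrite (ord1 j) cRe_normE ltcR.
split.
  move=> h r e e0; have [F0 hF] := h e e0; exists F0 => F uF sF.
  have /key := hF F uF sF => /(_ e0 r).
  by rewrite !mxE summxE.
move=> h e e0.
pose F0 r := sval (cid (h r e e0)).
exists (flatten [seq F0 r | r <- enum 'I_m]) => F uF sF; apply/key => // r.
have := svalP (cid (h r e e0)) F uF; rewrite !mxE summxE; apply.
move=> x xF; apply: sF; apply/flattenP; exists (F0 r) => //.
by apply/mapP; exists r => //; rewrite mem_enum.
Qed.

Lemma sum_subset (I : eqType) (F F' : seq I) (g : I -> R) :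
  uniq F -> uniq F' -> {subset F <= F'} -> (forall i, 0 <= g i) ->
  \sum_(i <- F) g i <= \sum_(i <- F') g i.
Proof.
move=> uF uF' sF g0; rewrite [leRHS](bigID (mem F)) /= -[X in _ <= X + _]big_filter.
have -> : \sum_(i <- [seq i <- F' | i \in F]) g i = \sum_(i <- F) g i.
  apply: perm_big; apply: uniq_perm => //; first exact: filter_uniq.
  by move=> i; rewrite mem_filter; case iF: (i \in F) => //=; rewrite sF.
by rewrite lerDl; apply: sumr_ge0.
Qed.

Lemma cat_disj_uniq (I : eqType) (F F' : seq I) :
  uniq F -> uniq F' -> (forall i, i \in F' -> i \notin F) -> uniq (F ++ F').
Proof.
move=> uF uF' d; rewrite cat_uniq uF uF' andbT /=.
by apply/hasPn => i /d.
Qed.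

(** Finite sums over sets disjoint from [F0] have norm at most 2. Splitting such a set by the signs
    of the real, respectively imaginary, parts removes cancellation and bounds the sums of absolute
    values: 2 for each sign, hence 4 for each of the two parts. *)
Lemma hsum_abssum (I : eqType) (f : I -> C) s : hsum f s -> abssum f.
Proof.
move=> /(_ 1 ltr01) [F0 hF].
have dis (F : seq I) : uniq F -> (forall i, i \in F -> i \notin F0) ->
    normc (\sum_(i <- F) f i) <= 2.
  move=> uF dF.
  have u1 : uniq (undup F0 ++ F).
    by apply: cat_disj_uniq => //; [exact: undup_uniq | move=> i /dF; rewrite mem_undup].
  have s0 : {subset F0 <= undup F0} by move=> i; rewrite mem_undup.
  have s1 : {subset F0 <= undup F0 ++ F} by move=> i /s0; rewrite mem_cat => ->.
  have h1 := hF _ u1 s1; have h2 := hF _ (undup_uniq F0) s0.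
  rewrite big_cat /= in h1.
  have := normc_sub (\sum_(i <- undup F0) f i + \sum_(i <- F) f i) s
    (\sum_(i <- undup F0) f i).
  by rewrite addrAC subrr add0r (normcB s); lra.
have part (p : C -> R) (F : seq I) : (forall x, `|p x| <= normc x) ->
    (forall (r : seq I) (P : pred I) (F : I -> C),
      p (\sum_(i <- r | P i) F i) = \sum_(i <- r | P i) p (F i)) ->
    uniq F -> (forall i, i \in F -> i \notin F0) ->
    \sum_(i <- F) `|p (f i)| <= 4.
  move=> pn ps uF dF.
  rewrite (bigID (fun i => 0 <= p (f i))) /=.
  have -> : (4 : R) = 2 + 2 by ring.
  apply: lerD.
    rewrite (eq_bigr (fun i => p (f i))); last by move=> i /ger0_norm.
    rewrite -ps -big_filter; apply: le_trans (ler_norm _) _; apply: le_trans (pn _) _.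
    by apply: dis; [exact: filter_uniq | move=> i; rewrite mem_filter => /andP[_ /dF]].
  rewrite (eq_bigr (fun i => - p (f i))); last first.
    by move=> i; rewrite -ltNge => /ltr0_norm.
  rewrite sumrN -ps -big_filter.
  apply: le_trans (ler_norm _) _; rewrite normrN; apply: le_trans (pn _) _.
  by apply: dis; [exact: filter_uniq | move=> i; rewrite mem_filter => /andP[_ /dF]].
exists (8 + \sum_(i <- undup F0) normc (f i)) => F uF.
rewrite (bigID (mem F0)) /= addrC; apply: lerD.
  rewrite -big_filter; set G := [seq _ <- _ | _].
  have uG : uniq G by exact: filter_uniq.
  have dG i : i \in G -> i \notin F0 by rewrite mem_filter => /andP[].
  apply: (@le_trans _ _ (\sum_(i <- G) (`|cRe (f i)| + `|cIm (f i)|))).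
    by apply: ler_sum => i _; exact: normc_le.
  rewrite big_split /=.
  have h1 := part (@cRe R) G (@normc_Re R) (@cRe_sum R I) uG dG.
  have h2 := part (@cIm R) G (@normc_Im R) (@cIm_sum R I) uG dG.
  lra.
rewrite -big_filter; apply: sum_subset => //; first exact: filter_uniq.
- exact: undup_uniq.
- by move=> i; rewrite mem_filter mem_undup => /andP[].
- by move=> i; exact: normc_ge0.
Qed.

(** [F0] is a finite set whose sum of norms comes within [e] of the supremum; a disjoint set cannot
    add more than [e]. *)
Lemma abssum_tail (I : eqType) (f : I -> C) : abssum f -> forall e : R, 0 < e ->
  exists2 F0 : seq I, uniq F0 & forall F : seq I, uniq F ->
    (forall i, i \in F -> i \notin F0) -> \sum_(i <- F) normc (f i) <= e.
Proof.
move=> [K hK] e e0.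
pose S := [set x : R | exists2 F : seq I, uniq F & x = \sum_(i <- F) normc (f i)]%classic.
have S0 : (S !=set0)%classic by exists 0; exists [::] => //; rewrite big_nil.
have hS : has_sup S by split => //; exists K => _ [F uF ->]; exact: hK.
have [x [F0 uF0 ->] hx] := sup_adherent e0 hS.
exists F0 => // F uF dF.
have : \sum_(i <- F0 ++ F) normc (f i) <= sup S.
  by apply: sup_upper_bound => //; exists (F0 ++ F) => //; apply: cat_disj_uniq.
by rewrite big_cat /=; lra.
Qed.

Lemma eq_hsum (I : eqType) (f g : I -> C) s : f =1 g -> hsum f s -> hsum g s.
Proof. by move=> /funext ->. Qed.

Lemma eq_abssum (I : eqType) (f g : I -> C) : f =1 g -> abssum f -> abssum g.
Proof. by move=> /funext ->. Qed.

Lemma abssum_le (I : eqType) (f g : I -> C) :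
  (forall i, normc (f i) <= normc (g i)) -> abssum g -> abssum f.
Proof.
move=> h [K hK]; exists K => F uF; apply: le_trans (hK F uF).
by apply: ler_sum => i _.
Qed.

Lemma abssumZ (I : eqType) (f : I -> C) c : abssum f -> abssum (fun i => c * f i).
Proof.
move=> [K hK]; exists (normc c * K) => F uF.
under eq_bigr do rewrite normcM.
by rewrite -mulr_sumr ler_wpM2l ?normc_ge0 ?hK.
Qed.

Lemma hsumD (I : eqType) (f g : I -> C) s t :
  hsum f s -> hsum g t -> hsum (fun i => f i + g i) (s + t).
Proof.
move=> hf hg e e0; have e2 : 0 < e / 2 by lra.
have [F hF] := hf _ e2; have [G hG] := hg _ e2.
exists (F ++ G) => H uH sH.
rewrite big_split /= opprD addrACA; apply: le_lt_trans (le_normcD _ _) _.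
rewrite (splitr e); apply: ltrD.
  by apply: hF => // i iF; apply: sH; rewrite mem_cat iF.
by apply: hG => // i iF; apply: sH; rewrite mem_cat iF orbT.
Qed.

Lemma hsumZ (I : eqType) (f : I -> C) s c :
  hsum f s -> hsum (fun i => c * f i) (c * s).
Proof.
move=> hf e e0; have c1 : 0 < normc c + 1 by have := normc_ge0 c; lra.
have e2 : 0 < e / (normc c + 1) by rewrite divr_gt0.
have [F hF] := hf _ e2; exists F => H uH sH.
rewrite -mulr_sumr -mulrBr normcM.
have := hF H uH sH; rewrite ltr_pdivlMr //.
have := normc_ge0 (\sum_(i <- H) f i - s); have := normc_ge0 c; nra.
Qed.

Lemma hsumN (I : eqType) (f : I -> C) s : hsum f s -> hsum (fun i => - f i) (- s).
Proof.
by move=> /(hsumZ (-1)); rewrite mulN1r; apply: eq_hsum => i; rewrite mulN1r.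
Qed.

Lemma hsumB (I : eqType) (f g : I -> C) s t :
  hsum f s -> hsum g t -> hsum (fun i => f i - g i) (s - t).
Proof. by move=> hf /hsumN hg; apply: hsumD. Qed.

Lemma hsum_supp (I : eqType) (f : I -> C) (r : seq I) : uniq r ->
  (forall i, i \notin r -> f i = 0) -> hsum f (\sum_(i <- r) f i).
Proof.
move=> ur h e e0; exists r => F uF sF.
rewrite (bigID (mem r)) /= -big_filter [X in _ + X - _]big1 ?addr0; last by move=> i /h.
rewrite (@perm_big _ _ _ _ _ r) ?subrr ?normc0 //.
apply: uniq_perm => //; first exact: filter_uniq.
by move=> i; rewrite mem_filter; case ir: (i \in r) => //=; rewrite sF.
Qed.

Lemma hsum_fin (I : finType) (f : I -> C) : hsum f (\sum_i f i).
Proof.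
rewrite -big_enum /=; apply: hsum_supp; first exact: enum_uniq.
by move=> i; rewrite mem_enum.
Qed.

Lemma hsum0 (I : eqType) : hsum (fun _ : I => 0) 0.
Proof. by have := @hsum_supp I (fun=> 0) [::] isT (fun _ _ => erefl); rewrite big_nil. Qed.

Lemma hsum_sum (I : eqType) (J : Type) (r : seq J) (P : pred J) (f : J -> I -> C) (s : J -> C) :
  (forall j, P j -> hsum (f j) (s j)) ->
  hsum (fun i => \sum_(j <- r | P j) f j i) (\sum_(j <- r | P j) s j).
Proof.
move=> h; elim: r => [|j r IH].
  by rewrite big_nil; apply: eq_hsum (hsum0 I) => i; rewrite big_nil.
rewrite big_cons; case: ifP => Pj.
  by apply: eq_hsum (hsumD (h j Pj) IH) => i; rewrite big_cons Pj.
by apply: eq_hsum IH => i; rewrite big_cons Pj.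
Qed.

Lemma hsum_bound (I : eqType) (f : I -> C) s K : hsum f s ->
  (forall F, uniq F -> \sum_(i <- F) normc (f i) <= K) -> normc s <= K.
Proof.
move=> hf hK; apply/ler_addgt0Pr => e e0.
have [F hF] := hf e e0.
have sF : {subset F <= undup F} by move=> i; rewrite mem_undup.
have h1 := hF _ (undup_uniq F) sF; have h2 := hK _ (undup_uniq F).
have := normc_sub s (\sum_(i <- undup F) f i) 0; rewrite !subr0 (normcB s).
have := normc_sum (undup F) xpredT f; lra.
Qed.

Lemma hsum_unique (I : eqType) (f : I -> C) s t : hsum f s -> hsum f t -> s = t.
Proof.
move=> hs ht; apply/eqP; rewrite -subr_eq0; apply/eqP; apply: normc_small => e e0.
have e2 : 0 < e / 2 by lra.
have [F hF] := hs _ e2; have [G hG] := ht _ e2.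
have uH := undup_uniq (F ++ G).
have h1 : normc (\sum_(i <- undup (F ++ G)) f i - s) < e / 2.
  by apply: hF => // i; rewrite mem_undup mem_cat => ->.
have h2 : normc (\sum_(i <- undup (F ++ G)) f i - t) < e / 2.
  by apply: hG => // i; rewrite mem_undup mem_cat orbC => ->.
by have := normc_sub s (\sum_(i <- undup (F ++ G)) f i) t; rewrite (normcB s (\sum_(i <- _) _)); lra.
Qed.

Lemma hsum_pos (I : eqType) (g : I -> R) : (forall i, 0 <= g i) ->
  abssum (fun i => toC (g i)) -> exists s, hsum (fun i => toC (g i)) s.
Proof.
move=> g0 ag; have [K hK] := ag.
pose S := [set x : R | exists2 F : seq I, uniq F & x = \sum_(i <- F) g i]%classic.
have gE F : \sum_(i <- F) normc (toC (g i)) = \sum_(i <- F) g i.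
  by apply: eq_bigr => i _; rewrite normc_toC ger0_norm.
have S0 : (S !=set0)%classic by exists 0; exists [::] => //; rewrite big_nil.
have hS : has_sup S by split => //; exists K => _ [F uF ->]; rewrite -gE; exact: hK.
exists (toC (sup S)) => e e0.
have [x [F0 uF0 ->] hx] := sup_adherent e0 hS.
exists F0 => F uF sF; rewrite -toC_sum -toCB normc_toC.
have h1 : \sum_(i <- F) g i <= sup S by apply: sup_upper_bound => //; exists F.
have h2 := sum_subset uF0 uF sF g0.
by rewrite ler0_norm; lra.
Qed.

Lemma abssum_hsum (I : eqType) (f : I -> C) : abssum f -> exists s, hsum f s.
Proof.
move=> af.
have part (p : I -> R) : (forall i, `|p i| <= normc (f i)) ->
    exists s, hsum (fun i => toC (p i)) s.
  move=> hp.
  have aux (q : R -> R) : (forall x, 0 <= q x <= `|x|) ->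
      exists s, hsum (fun i => toC (q (p i))) s.
    move=> hq; apply: hsum_pos => [i|]; first by case/andP: (hq (p i)).
    apply: abssum_le af => i; rewrite normc_toC.
    by have /andP[q0 q1] := hq (p i); rewrite ger0_norm // (le_trans q1).
  have [x|s1 h1] := aux (fun x => Num.max x 0).
    by rewrite le_max lexx orbT ge_max ler_norm normr_ge0.
  have [x|s2 h2] := aux (fun x => Num.max (- x) 0).
    by rewrite le_max lexx orbT ge_max -normrN ler_norm normr_ge0.
  exists (s1 - s2); apply: eq_hsum (hsumB h1 h2) => i.
  by rewrite -toCB; congr toC; case: (lerP (p i) 0); case: (lerP (- p i) 0); lra.
have [s1 h1] := part (fun i => cRe (f i)) (fun i => normc_Re _).
have [s2 h2] := part (fun i => cIm (f i)) (fun i => normc_Im _).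
exists (s1 + iC R * s2); apply: eq_hsum (hsumD h1 (hsumZ (iC R) h2)) => i.
by rewrite -cE.
Qed.

Definition tsum (I : eqType) (f : I -> C) : C := xget 0 [set s | hsum f s].

Lemma tsumP (I : eqType) (f : I -> C) : abssum f -> hsum f (tsum f).
Proof. by move=> /abssum_hsum [s hs]; rewrite /tsum; case: xgetP => [t -> //|/(_ s)]. Qed.

(** Fubini along the fibres of [p], the principle behind the rearrangements below. If [G] contains
    the image of [F0], then $\sum_{j\in G}g_j-s$ is minus the sum of the [f i] with [p i] outside
    [G], and no such [i] lies in [F0]. *)
Lemma hsum_group (I J : eqType) (p : I -> J) (f : I -> C) (g : J -> C) s :
  hsum f s -> (forall j, hsum (fun i => if p i == j then f i else 0) (g j)) ->
  hsum g s.
Proof.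
move=> hf hg e e0; have af := hsum_abssum hf; have e2 : 0 < e / 2 by lra.
have [F0 uF0 hF0] := abssum_tail af e2.
exists [seq p i | i <- F0] => G uG sG.
have h1 := hsumB (hsum_sum G (fun j (_ : true) => hg j)) hf.
apply: le_lt_trans (_ : e / 2 < e); last lra.
apply: hsum_bound h1 _ => F uF.
apply: le_trans (hF0 [seq i <- F | p i \notin G] _ _); first last.
- by move=> i; rewrite mem_filter => /andP[pG _]; apply: contra pG => iF; apply: sG; exact: map_f.
- exact: filter_uniq.
rewrite big_filter [leRHS]big_mkcond; apply: ler_sum => i _ /=.
rewrite -big_mkcond /= -big_filter.
case: ifPn => [pG|/negPn pG].
  rewrite big_filter big_mkcond big_seq big1 ?sub0r ?normcN // => j jG.
  by case: eqP => // pj; rewrite pj jG in pG.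
rewrite big_filter (eq_bigl (pred1 (p i))); last by move=> j; rewrite /= eq_sym.
by rewrite -big_filter filter_pred1_uniq // big_seq1 subrr normc0.
Qed.

Lemma abssum_fiber (I : eqType) (f : I -> C) (P : pred I) :
  abssum f -> abssum (fun i => if P i then f i else 0).
Proof. by apply: abssum_le => i; case: ifP => _ //; rewrite normc0 normc_ge0. Qed.

Lemma abssum_inj (I J : eqType) (h : I -> J) (f : J -> C) : injective h ->
  abssum f -> abssum (f \o h).
Proof.
move=> ih [K hK]; exists K => F uF.
by rewrite -(big_map h xpredT (fun j => normc (f j))) hK // map_inj_uniq.
Qed.

Lemma hsum_reindex (I J : eqType) (h : I -> J) (f : J -> C) s : injective h ->
  (forall j, f j != 0 -> exists i, h i = j) -> hsum (f \o h) s -> hsum f s.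
Proof.
move=> ih sh hs; apply: (hsum_group (p := h) hs) => j.
have [[i <-]|no] := pselect (exists i, h i = j).
  suff -> : f (h i) = \sum_(k <- [:: i]) (if h k == h i then (f \o h) k else 0).
    apply: hsum_supp => // k; rewrite inE (inj_eq ih) => /negbTE -> //.
  by rewrite big_seq1 eqxx.
have -> : f j = 0 by apply/eqP/negPn/negP => /sh.
apply: eq_hsum (hsum0 I) => i; case: eqP => // hi; case: no; exists i; exact: hi.
Qed.

Lemma hsum_reindex_inv (I J : eqType) (h : I -> J) (f : J -> C) s : injective h ->
  (forall j, f j != 0 -> exists i, h i = j) -> hsum f s -> hsum (f \o h) s.
Proof.
move=> ih sh hs.
have h2 := tsumP (abssum_inj ih (hsum_abssum hs)).
by rewrite (hsum_unique hs (hsum_reindex ih sh h2)).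
Qed.

Lemma abssum_pair (I J : eqType) (f : I * J -> C) (K : I -> R) (L : R) :
  (forall i F, uniq F -> \sum_(j <- F) normc (f (i, j)) <= K i) ->
  (forall F, uniq F -> \sum_(i <- F) K i <= L) -> abssum f.
Proof.
move=> hK hL; exists L => F uF.
pose A := undup (map fst F); pose B := undup (map snd F).
apply: (@le_trans _ _ (\sum_(q <- [seq (i, j) | i <- A, j <- B]) normc (f q))).
  apply: sum_subset => //.
  - by apply: allpairs_uniq; rewrite ?undup_uniq // => -[? ?] [? ?].
  - move=> [i j] ijF; apply/allpairsP; exists (i, j); split=> //; rewrite mem_undup.
      by apply/mapP; exists (i, j).
    by apply/mapP; exists (i, j).
  - by move=> q; exact: normc_ge0.
rewrite big_allpairs; apply: le_trans (hL A (undup_uniq _)).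
by apply: ler_sum => i _; apply: hK; exact: undup_uniq.
Qed.

Lemma hsum_fst (I J : eqType) (f : I * J -> C) (g : I -> C) s :
  hsum f s -> (forall i, hsum (fun j => f (i, j)) (g i)) -> hsum g s.
Proof.
move=> hf hg; apply: (hsum_group (p := fst) hf) => i.
apply: (@hsum_reindex _ _ (fun j => (i, j))) => [j k []//| [i' j] /=|].
  by case: (i' =P i) => [-> _|_]; [exists j|rewrite eqxx].
by apply: eq_hsum (hg i) => j /=; rewrite eqxx.
Qed.

Lemma hsum_snd (I J : eqType) (f : I * J -> C) (g : J -> C) s :
  hsum f s -> (forall j, hsum (fun i => f (i, j)) (g j)) -> hsum g s.
Proof.
move=> hf hg; apply: (hsum_group (p := snd) hf) => j.
apply: (@hsum_reindex _ _ (fun i => (i, j))) => [i k []//| [i j'] /=|].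
  by case: (j' =P j) => [-> _|_]; [exists i|rewrite eqxx].
by apply: eq_hsum (hg j) => i /=; rewrite eqxx.
Qed.

Lemma hsum_prod (I J : eqType) (f : I -> C) (g : J -> C) s t :
  hsum f s -> hsum g t -> hsum (fun q : I * J => f q.1 * g q.2) (s * t).
Proof.
move=> hf hg; have [K hK] := hsum_abssum hf; have [L hL] := hsum_abssum hg.
have L0 : 0 <= L by have := hL [::] isT; rewrite big_nil.
have a : abssum (fun q : I * J => f q.1 * g q.2).
  apply: (@abssum_pair _ _ _ (fun i => normc (f i) * L) (K * L)) => [i F uF|F uF] /=.
    under eq_bigr do rewrite normcM.
    by rewrite -mulr_sumr ler_wpM2l ?normc_ge0 ?hL.
  by rewrite -mulr_suml ler_wpM2r ?hK.
have h1 := tsumP a.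
have h2 : hsum (fun i => t * f i) (tsum (fun q : I * J => f q.1 * g q.2)).
  apply: (hsum_fst h1) => i /=; rewrite mulrC; exact: hsumZ.
by rewrite mulrC -(hsum_unique h2 (hsumZ t hf)).
Qed.

End Sums.

(** * The exponential and termwise differentiation *)

Section Cexp.
Variable R : realType.
Local Notation C := R[i].

Definition cexp (w : C) : C :=
  Complex (expR (cRe w) * cos (cIm w)) (expR (cRe w) * sin (cIm w)).

(** Kept in the exact form of the constant in [Fdet], so that [FdetE] holds by conversion. *)
Definition tpi : C := 2 * piC R * iC R.

Lemma cRe_toCM (a : R) (x : C) : cRe (toC a * x) = a * cRe x.
Proof. by case: x => b c; rewrite /toC; simpc. Qed.
Lemma cIm_toCM (a : R) (x : C) : cIm (toC a * x) = a * cIm x.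
Proof. by case: x => b c; rewrite /toC; simpc. Qed.
Lemma tpiE : tpi = Complex 0 (2 * pi).
Proof. by rewrite /tpi /piC /toC /iC -(toC_nat R 2) /toC; simpc. Qed.
Lemma cRe_tpi x : cRe (tpi * x) = - (2 * pi * cIm x).
Proof. by rewrite tpiE; case: x => a b; simpc; rewrite /=. Qed.
Lemma cIm_tpi x : cIm (tpi * x) = 2 * pi * cRe x.
Proof. by rewrite tpiE; case: x => a b; simpc; rewrite /=. Qed.
Lemma normc_tpi : normc tpi = 2 * pi.
Proof.
by rewrite tpiE /= expr0n add0r sqrtr_sqr ger0_norm // mulr_ge0 ?pi_ge0.
Qed.

Lemma ee_cexp (x : C) : ee x = cexp (tpi * x).
Proof. by rewrite /ee /cexp cRe_tpi cIm_tpi mulNr. Qed.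

Lemma cexpD (x y : C) : cexp (x + y) = cexp x * cexp y.
Proof.
rewrite /cexp cReD cImD expRD cosD sinD; simpc.
by congr Complex; ring.
Qed.
Lemma cexp0 : cexp 0 = 1.
Proof. by rewrite /cexp /= expR0 cos0 sin0 mulr1 mulr0. Qed.
Lemma normc_cexp (x : C) : normc (cexp x) = expR (cRe x).
Proof.
rewrite /cexp /= !exprMn -mulrDr cos2Dsin2 mulr1 sqrtr_sqr ger0_norm // expR_ge0.
Qed.

Lemma eeD (x y : C) : ee (x + y) = ee x * ee y.
Proof. by rewrite !ee_cexp mulrDr cexpD. Qed.
Lemma ee0 : ee (0 : C) = 1.
Proof. by rewrite ee_cexp mulr0 cexp0. Qed.
Lemma normc_ee (x : C) : normc (ee x) = expR (- (2 * pi * cIm x)).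
Proof. by rewrite ee_cexp normc_cexp cRe_tpi. Qed.
Lemma eeN (x : C) : ee (- x) * ee x = 1.
Proof. by rewrite -eeD addNr ee0. Qed.
Lemma ee_neq0 (x : C) : ee x != 0.
Proof. by rewrite -normc_eq0 normc_ee gt_eqF ?expR_gt0. Qed.

Lemma expR_partial (r : R) N : 0 <= r ->
  \sum_(j <- iota 0 N) r ^+ j / j`!%:R <= expR r.
Proof.
move=> r0.
have := @nondecreasing_cvgn_le R (series (exp_coeff r)) _ (is_cvg_series_exp_coeff r) N.
rewrite {2}/series /= /index_iota subn0; apply.
apply/nondecreasing_seqP => k; rewrite /series /= big_nat_recr //= lerDl.
by rewrite divr_ge0 ?exprn_ge0.
Qed.

Lemma sub_iota (F : seq nat) : exists N, {subset F <= iota 0 N}.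
Proof.
exists (\max_(i <- F) i).+1 => i iF; rewrite mem_iota add0n ltnS /=.
exact: (leq_bigmax_seq (F := id)).
Qed.

Lemma expR_fin (r : R) (F : seq nat) : 0 <= r -> uniq F ->
  \sum_(j <- F) r ^+ j / j`!%:R <= expR r.
Proof.
move=> r0 uF; have [N hN] := sub_iota F.
apply: le_trans (expR_partial N r0); apply: sum_subset => //; first exact: iota_uniq.
by move=> j; rewrite divr_ge0 ?exprn_ge0.
Qed.

Lemma normc_expterm (w : C) j : normc (w ^+ j / j`!%:R) = normc w ^+ j / j`!%:R.
Proof. by rewrite normcM normcX normcV normc_nat. Qed.

Lemma cexp_abssum (w : C) : abssum (fun j => w ^+ j / j`!%:R).
Proof.
exists (expR (normc w)) => F uF.
under eq_bigr do rewrite normc_expterm.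
by apply: expR_fin => //; exact: normc_ge0.
Qed.

Lemma hsum_series (f : nat -> R) (s : R) :
  hsum (fun j => toC (f j)) (toC s) -> limn (series f) = s.
Proof.
move=> h; apply/cvg_lim => //; apply/cvgrPdist_lt => e e0.
have [F0 hF] := h e e0; have [N hN] := sub_iota F0.
exists N => // k /= Nk.
have uk : uniq (iota 0 k) := iota_uniq _ _.
have sk : {subset F0 <= iota 0 k}.
  by move=> i /hN; rewrite !mem_iota !add0n /= => /leq_trans; exact.
have := hF _ uk sk; rewrite -toC_sum -toCB normc_toC distrC.
by rewrite /series /= /index_iota subn0.
Qed.

Lemma hsum_cauchy (f g : nat -> C) s t : hsum f s -> hsum g t ->
  hsum (fun j => \sum_(i < j.+1) f (j - i)%N * g i) (s * t).
Proof.
move=> hs ht; have h := hsum_prod hs ht.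
apply: (hsum_group (p := fun q : nat * nat => (q.1 + q.2)%N) h) => j.
pose r := [seq ((j - i)%N, i) | i <- iota 0 j.+1].
have -> : \sum_(i < j.+1) f (j - i)%N * g i =
    \sum_(q <- r) (if (q.1 + q.2)%N == j then f q.1 * g q.2 else 0).
  rewrite big_map -(big_mkord xpredT (fun i => f (j - i)%N * g i)) /index_iota subn0.
  rewrite big_seq [RHS]big_seq; apply: eq_bigr => i; rewrite mem_iota add0n ltnS => /= ij.
  by rewrite subnK // eqxx.
apply: hsum_supp; first by rewrite map_inj_uniq ?iota_uniq // => x y [].
move=> [x y] /= nr; case: eqP => // e; case/negP: nr; apply/mapP; exists y.
  by rewrite mem_iota -e add0n ltnS leq_addl.
by rewrite -e addnK.
Qed.

Lemma natC_fact_neq0 k : (k`!%:R : C) != 0.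
Proof. by rewrite pnatr_eq0 -lt0n fact_gt0. Qed.

Lemma divpow_add (a b : C) j :
  \sum_(i < j.+1) a ^+ (j - i) / (j - i)`!%:R * (b ^+ i / i`!%:R) = (a + b) ^+ j / j`!%:R.
Proof.
rewrite exprDn mulr_suml; apply: eq_bigr => i _.
have ij : (i <= j)%N by rewrite -ltnS.
rewrite -(bin_fact ij) !natrM -mulr_natr.
have bz : ('C(j, i)%:R : C) != 0 by rewrite pnatr_eq0 -lt0n bin_gt0.
by field; rewrite !natC_fact_neq0 bz.
Qed.

Lemma hsum_expterm_mul (a b : C) s t : hsum (fun j => a ^+ j / j`!%:R) s ->
  hsum (fun j => b ^+ j / j`!%:R) t -> hsum (fun j => (a + b) ^+ j / j`!%:R) (s * t).
Proof. by move=> hs ht; apply: eq_hsum (hsum_cauchy hs ht) => j; exact: divpow_add. Qed.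

Lemma hsum_part (I : eqType) (f : I -> C) (s : C) (p : C -> R) :
  (forall x, `|p x| <= normc x) -> (forall x y, p (x - y) = p x - p y) ->
  (forall (r : seq I) (P : pred I) (F : I -> C),
      p (\sum_(i <- r | P i) F i) = \sum_(i <- r | P i) p (F i)) ->
  hsum f s -> hsum (fun i => toC (p (f i))) (toC (p s)).
Proof.
move=> pn pB ps h e e0; have [F0 hF] := h e e0; exists F0 => F uF sF.
rewrite -toC_sum -toCB normc_toC -ps -pB; apply: le_lt_trans (pn _) _.
exact: hF.
Qed.

Lemma hsum_Re (I : eqType) (f : I -> C) (s : C) :
  hsum f s -> hsum (fun i => toC (cRe (f i))) (toC (cRe s)).
Proof.
apply: hsum_part; first exact: normc_Re; last exact: cRe_sum.
by move=> x y; rewrite cReD cReN.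
Qed.

Lemma hsum_Im (I : eqType) (f : I -> C) (s : C) :
  hsum f s -> hsum (fun i => toC (cIm (f i))) (toC (cIm s)).
Proof.
apply: hsum_part; first exact: normc_Im; last exact: cIm_sum.
by move=> x y; rewrite cImD cImN.
Qed.

Lemma iC_expn j : iC R ^+ j =
  Complex ((~~ odd j)%:R * (-1) ^+ j./2) ((odd j)%:R * (-1) ^+ j.-1./2).
Proof.
have ii : iC R ^+ 2 = -1 by exact: sqr_i.
rewrite -{1}[j]odd_double_half exprD -mul2n exprM ii.
have sgn k : (-1) ^+ k = toC ((-1) ^+ k) :> C by rewrite toCX toCN.
rewrite sgn; case oj: (odd j) => /=.
  have -> : j.-1./2 = j./2 by rewrite -[in LHS](odd_double_half j) oj /= doubleK.
  by rewrite expr1 /iC /toC; simpc.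
by rewrite expr0 mul1r /toC !mul0r !mul1r.
Qed.

(** [cexp] is built from the real functions [expR], [cos] and [sin], which are limits of ordinary
    series. Real and imaginary parts of the unordered sum are identified with these limits,
    separately for real and for imaginary arguments; the Cauchy product joins the two. *)
Lemma cexp_hsum (w : C) : hsum (fun j => w ^+ j / j`!%:R) (cexp w).
Proof.
have hre (a : R) : hsum (fun j => toC a ^+ j / j`!%:R) (toC (expR a)).
  have [s hs] := abssum_hsum (cexp_abssum (toC a)).
  have e j : toC a ^+ j / j`!%:R = toC (exp_coeff a j).
    by rewrite /exp_coeff /= toCM toCX toCV toC_nat.
  have h0 : hsum (fun j => toC (exp_coeff a j)) s by apply: eq_hsum hs.
  have h1 : hsum (fun j => toC (exp_coeff a j)) (toC (cRe s)) := hsum_Re h0.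
  by rewrite /expR (hsum_series h1) -(hsum_unique h0 h1).
have him (b : R) : hsum (fun j => (iC R * toC b) ^+ j / j`!%:R) (Complex (cos b) (sin b)).
  have [s hs] := abssum_hsum (cexp_abssum (iC R * toC b)).
  have e j : (iC R * toC b) ^+ j / j`!%:R = Complex (cos_coeff b j) (sin_coeff b j).
    have -> : (iC R * toC b) ^+ j / j`!%:R = iC R ^+ j * toC (b ^+ j / j`!%:R).
      by rewrite exprMn -mulrA toCM toCX toCV toC_nat.
    rewrite iC_expn /toC /cos_coeff /sin_coeff /=; simpc.
    by rewrite -!mulrA.
  have h1 := hsum_Re (eq_hsum e hs); have h2 := hsum_Im (eq_hsum e hs).
  have := hsum_series h1; have := hsum_series h2; rewrite /cRe /cIm => e2 e1.
  have -> : Complex (cos b) (sin b) = s.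
    by rewrite ![in LHS]unlock; case: (s) e1 e2 => x y <- <-.
  exact: hs.
have -> : cexp w = toC (expR (cRe w)) * Complex (cos (cIm w)) (sin (cIm w)).
  by rewrite /cexp /toC; simpc.
by rewrite [w in X in hsum X _]cE; apply: hsum_expterm_mul.
Qed.

Lemma cexp_bound2 (w : C) : normc (cexp w - 1 - w) <= normc w ^+ 2 * expR (normc w).
Proof.
have h1 : hsum (fun j => if (j < 2)%N then w ^+ j / j`!%:R else 0) (1 + w).
  have -> : 1 + w = \sum_(j <- iota 0 2) (if (j < 2)%N then w ^+ j / j`!%:R else 0).
    by rewrite !big_cons big_nil /= expr0 expr1 fact0 (_ : 1`! = 1)%N // !divr1 addr0.
  by apply: hsum_supp => // j; rewrite mem_iota add0n /= => /negbTE ->.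
have := hsumB (cexp_hsum w) h1; rewrite opprD addrA => h2.
apply: hsum_bound h2 _ => F uF.
have w0 := normc_ge0 w.
have [N hN] := sub_iota F.
have sub : {subset F <= iota 0 (2 + N)}.
  by move=> i /hN; rewrite !mem_iota; lia.
apply: (le_trans (sum_subset uF (iota_uniq 0 (2 + N)) sub _)) => [j|]; first exact: normc_ge0.
have split2 (G : nat -> R) : \sum_(j <- iota 0 (2 + N)) G j =
    G 0%N + (G 1%N + \sum_(j <- iota 0 N) G (2 + j)%N).
  rewrite (_ : iota 0 (2 + N) = [:: 0%N, 1%N & iota 2 N]) // !big_cons.
  by rewrite (_ : iota 2 N = [seq (2 + i)%N | i <- iota 0 N]) ?big_map // -iotaDl.
rewrite split2 !subrr !normc0 !add0r.
apply: (@le_trans _ _ (\sum_(i <- iota 0 N) normc w ^+ 2 * (normc w ^+ i / i`!%:R))).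
  apply: ler_sum => i _; rewrite /= subr0 normc_expterm exprD -mulrA.
  rewrite ler_wpM2l ?exprn_ge0 // ler_wpM2l ?exprn_ge0 //.
  rewrite lef_pV2 ?posrE ?ltr0n ?fact_gt0 // ler_nat.
  by rewrite (_ : (2 + i)`! = (2 + i) * ((1 + i) * i`!))%N // mulnA leq_pmull.
by rewrite -mulr_sumr ler_wpM2l ?exprn_ge0 ?expR_partial.
Qed.

Lemma ee_bound2 (b : R) (h : C) :
  normc (ee (toC b * h) - 1 - tpi * toC b * h) <=
  (2 * pi * `|b| * normc h) ^+ 2 * expR (2 * pi * `|b| * normc h).
Proof.
have e : 2 * pi * `|b| * normc h = normc (tpi * (toC b * h)).
  by rewrite (normcM tpi) (normcM (toC b)) normc_toC normc_tpi !mulrA.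
by rewrite e ee_cexp -[tpi * _ * h]mulrA cexp_bound2.
Qed.

Lemma expR_le_sq (x : R) : 0 <= x -> x ^+ 2 <= 2 * expR x.
Proof.
move=> x0; have := expR_partial 3 x0; rewrite !big_cons big_nil.
rewrite expr0 expr1 fact0 (_ : 1`! = 1)%N // (_ : 2`! = 2)%N // !divr1 addr0.
by have := sqr_ge0 x; lra.
Qed.

(** According to the sign of $b_i$, the factor $e^{2\pi|b_i|r}$ is the norm of the exponential at
    $-ir$ or at $ir$, hence at most the sum of both norms. *)
Lemma abssum_exp_abs (I : eqType) (a : I -> C) (b : I -> R) (r : R) :
  abssum (fun i => a i * ee (toC (b i) * (iC R * toC r))) ->
  abssum (fun i => a i * ee (toC (b i) * (iC R * toC (- r)))) ->
  abssum (fun i => a i * toC (expR (2 * pi * `|b i| * r))).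
Proof.
move=> [K1 h1] [K2 h2]; exists (K1 + K2) => F uF.
apply: le_trans (lerD (h1 F uF) (h2 F uF)); rewrite -big_split.
apply: ler_sum => i _ /=; rewrite !normcM -mulrDr ler_wpM2l ?normc_ge0 // !normc_ee.
rewrite normc_toC ger0_norm ?expR_ge0 //.
have e (x : R) : cIm (toC (b i) * (iC R * toC x)) = b i * x.
  by rewrite cIm_toCM /iC /toC; simpc.
rewrite !e; have := expR_ge0 (- (2 * pi * (b i * r))).
have := expR_ge0 (- (2 * pi * (b i * - r))).
have [b0|b0] := lerP 0 (b i); rewrite ?(ger0_norm b0) ?(ltr0_norm b0).
  have -> : 2 * pi * b i * r = - (2 * pi * (b i * - r)) by ring.
  lra.
have -> : 2 * pi * - b i * r = - (2 * pi * (b i * r)) by ring.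
lra.
Qed.

(** Everything is dominated by $|a_i|e^{2\pi|b_i|s}$ with $s=r/2$, summable because $\pm is$ lie
    strictly inside the disc. With $B=2\pi|b_i|$ and $|h|<s/2$, the remainder $(B|h|)^2e^{B|h|}$ is
    paid for by splitting $e^{Bs}$ into two factors $e^{Bs/2}$: one bounds $e^{B|h|}$, the other
    bounds the square through $x^2\le 2e^x$ at $x=Bs/2$. This is the origin of $8/s^2$. *)
Lemma termwise_deriv (I : eqType) (a : I -> C) (b : I -> R) (f : C -> C) (r : R) :
  0 < r ->
  (forall h, normc h < r -> hsum (fun i => a i * ee (toC (b i) * h)) (f h)) ->
  exists D, hsum (fun i => a i * (tpi * toC (b i))) D /\
    exists M rho, 0 < rho /\
      forall h, normc h < rho -> normc (f h - f 0 - h * D) <= M * normc h ^+ 2.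
Proof.
move=> r0 hf; pose s := r / 2.
have s0 : 0 < s by rewrite /s; lra.
have niC (x : R) : normc (iC R * toC x) = `|x|.
  by rewrite normcM normc_toC /iC /= expr0n add0r expr1n sqrtr1 mul1r.
have : abssum (fun i => a i * toC (expR (2 * pi * `|b i| * s))).
  apply: abssum_exp_abs.
    by apply: hsum_abssum (hf _ _); rewrite niC ger0_norm /s; lra.
  by apply: hsum_abssum (hf _ _); rewrite niC normrN ger0_norm /s; lra.
move=> aE.
have pb i : 0 <= 2 * pi * `|b i| by rewrite !mulr_ge0 // pi_ge0.
have aD : abssum (fun i => a i * (tpi * toC (b i))).
  apply: abssum_le (abssumZ (toC s^-1) aE) => i.
  rewrite [leRHS]normcM !(normcM (a i)) mulrCA ler_wpM2l ?normc_ge0 //.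
  rewrite (normcM tpi) !normc_toC normc_tpi (ger0_norm (expR_ge0 _)).
  rewrite [ `|s^-1| ]ger0_norm ?invr_ge0 ?(ltW s0) //.
  rewrite ler_pdivlMl //; apply: le_trans (expR_ge1Dx _); lra.
have [D hD] := abssum_hsum aD; exists D; split=> //.
have [K hK] := aE; exists (K * (8 / s ^+ 2)), (s / 2); split; first by lra.
move=> h hh.
have h0 := normc_ge0 h.
have f0 : hsum a (f 0).
  have : normc (0 : C) < r by rewrite normc0.
  by move=> /hf; apply: eq_hsum => i; rewrite mulr0 ee0 mulr1.
have hr : normc h < r by move: hh; rewrite /s; lra.
have h1 := hsumB (hsumB (hf h hr) f0) (hsumZ h hD).
apply: hsum_bound h1 _ => F uF.
have -> : K * (8 / s ^+ 2) * normc h ^+ 2 = (8 / s ^+ 2) * normc h ^+ 2 * K by ring.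
apply: le_trans (ler_wpM2l _ (hK F uF)); last first.
  by rewrite mulr_ge0 ?exprn_ge0 // divr_ge0 ?sqr_ge0.
rewrite mulr_sumr; apply: ler_sum => i _.
have -> : a i * ee (toC (b i) * h) - a i - h * (a i * (tpi * toC (b i))) =
  a i * (ee (toC (b i) * h) - 1 - tpi * toC (b i) * h) by ring.
rewrite !(normcM (a i)) mulrCA ler_wpM2l ?normc_ge0 // normc_toC ger0_norm ?expR_ge0 //.
apply: le_trans (ee_bound2 _ _) _.
set B := 2 * pi * `|b i| in pb *; have B0 : 0 <= B := pb i.
have e1 : expR (B * normc h) <= expR (B * (s / 2)).
  by rewrite ler_expR ler_wpM2l // ltW.
have e2 : (B * (s / 2)) ^+ 2 <= 2 * expR (B * (s / 2)).
  by apply: expR_le_sq; rewrite mulr_ge0 //; lra.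
have e3 : expR (B * s) = expR (B * (s / 2)) * expR (B * (s / 2)).
  by rewrite -expRD; congr expR; field.
rewrite e3; have := expR_ge0 (B * (s / 2)); set E := expR (B * (s / 2)) in e1 e2 * => E0.
have -> : (B * normc h) ^+ 2 = 4 / s ^+ 2 * normc h ^+ 2 * (B * (s / 2)) ^+ 2.
  by field; rewrite gt_eqF.
have -> : 8 / s ^+ 2 * normc h ^+ 2 * (E * E) = 4 / s ^+ 2 * normc h ^+ 2 * (2 * E) * E by ring.
have p0 : 0 <= 4 / s ^+ 2 * normc h ^+ 2 by rewrite mulr_ge0 ?exprn_ge0 ?divr_ge0 ?sqr_ge0.
apply: ler_pM => //; last by rewrite ler_wpM2l.
by rewrite mulr_ge0 ?sqr_ge0.
Qed.

(* Differentiability at [0] with a quadratic remainder, which is what a termwise estimate of an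
   exponential series gives without completeness or uniform convergence arguments. *)
Definition quad_deriv (f : C -> C) (D : C) : Prop :=
  exists M rho : R, 0 < rho /\
    forall h, normc h < rho -> normc (f h - f 0 - h * D) <= M * normc h ^+ 2.

Lemma quad_is_derive (V : normedModType C) (F : V -> C^o) (x v : V) (D : C) :
  quad_deriv (fun h => F (h *: v + x)) D -> is_derive x v F D.
Proof.
move=> [M [rho [rho0 hM]]].
have cv : h^-1 *: (F (h *: v + x) - F x) @[h --> (0 : C^o)^'] --> (D : C^o).
  apply/cvgrPdist_lt => e e0.
  (* In the partial order of the complex numbers, a positive element is real. *)
  have ee : e = toC (cRe e) by case: e e0 => a b; rewrite ltcE /= => /andP[/eqP -> _].
  have e1 : 0 < cRe e by move: e0; rewrite ee ltcR.
  pose d := Num.min rho (cRe e / (`|M| + 1)).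
  have M1 : 0 < `|M| + 1 by have := normr_ge0 M; lra.
  have d0 : 0 < d by rewrite lt_min rho0 divr_gt0.
  exists (toC d) => /=; first by rewrite ltcR.
  move=> h; rewrite /ball_ /= sub0r normrN cRe_normE ltcR => hd h0.
  rewrite [e]ee [`|_|]cRe_normE ltcR.
  have hp : 0 < normc h by rewrite normc_gt0.
  have -> : D - h^-1 *: (F (h *: v + x) - F x) =
      - (h^-1 * (F (h *: v + x) - F (0 *: v + x) - h * D)).
    by rewrite scale0r add0r /GRing.scale /=; field.
  rewrite normcN normcM normcV mulrC ltr_pdivrMr //.
  move: hd; rewrite lt_min => /andP[hr hd].
  apply: le_lt_trans (hM h hr) _.
  rewrite ltr_pdivlMr // in hd.
  rewrite expr2 mulrA ltr_pM2r //.
  apply: le_lt_trans hd; rewrite mulrC ler_wpM2l ?(ltW hp) //.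
  by have := ler_norm M; lra.
by apply: DeriveDef; [apply/cvg_ex; exists D | apply/cvg_lim].
Qed.

Lemma is_derive_cV (V : normedModType C) m (F : V -> 'cV[C]_m) (x v : V) (D : 'cV[C]_m) :
  (forall r, is_derive x v (fun y => F y r 0 : C^o) (D r 0)) -> is_derive x v F D.
Proof.
move=> hr.
pose W : normedModType C := 'cV[C]_m.
have cv : h^-1 *: (F (h *: v + x) - F x) @[h --> (0 : C^o)^'] --> (D : W).
  apply/cvgrPdist_le => e e0; near=> h.
  rewrite [`|_|]mx_normE.
  have -> : e = (NngNum (ltW e0))%:num by [].
  rewrite num_le; apply/bigmax_leP; split=> [|[r j] _]; first by rewrite -num_le /= ltW.
  rewrite -num_le /= (ord1 j) !mxE.
  move: r {j}; near: h; apply: filter_forall => r.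
  have [/cvg_ex [l hl] hD] := hr r.
  have lD : l = D r 0 by rewrite -hD; apply/esym/cvg_lim.
  by have /cvgrPdist_le := hl; rewrite lD; exact.
by apply: DeriveDef; [apply/cvg_ex; exists D | apply/cvg_lim].
Unshelve. all: by end_near. Qed.

End Cexp.

(** * Exponential expansions and the termwise action of the operators $D_{k,p}$ *)

Section Termwise.
Variable R : realType.
Local Notation C := R[i].

(** The index type only labels the terms and exponents may repeat, so that pairs $(n,t)$ or lattice
    vectors can serve as labels without collecting equal exponents. *)
Definition TEXP (I : eqType) (c : I -> C) (a : I -> R) (g : C -> C) : Prop :=
  forall tau, inH tau -> hsum (fun i => c i * ee (toC (a i) * tau)) (g tau).

Definition ZEXP (n : nat) (I : eqType) (c : I -> C) (b : I -> 'I_n -> R)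
    (g : 'rV[C]_n -> C) : Prop :=
  forall x : 'rV[C]_n, hsum (fun i => c i * ee (\sum_l toC (b i l) * x 0 l)) (g x).

Lemma inH_nbhs (tau h : C) : inH tau -> normc h < cIm tau -> inH (h + tau).
Proof.
rewrite /inH cImD => ht hh; have := normc_Im h; have := ler_norm (- cIm h).
by rewrite normrN; lra.
Qed.

Lemma near_inH (tau : C) : inH tau -> \forall s \near (tau : C^o), inH (s : C).
Proof.
move=> ht; exists (toC (cIm tau)) => /=; first by rewrite ltcR.
move=> s; rewrite /ball_ /= [`|_|]cRe_normE ltcR normcB => hs.
by rewrite -[s](subrK tau); apply: inH_nbhs.
Qed.

Lemma TEXP_derive (I : eqType) (c : I -> C) (a : I -> R) (g : C -> C) tau :
  TEXP c a g -> inH tau ->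
  exists2 D, hsum (fun i => c i * (tpi R * toC (a i)) * ee (toC (a i) * tau)) D &
    is_derive (tau : C^o) (1 : C^o) (g : C^o -> C^o) D.
Proof.
move=> hg ht.
have h h0 : normc h0 < cIm tau ->
    hsum (fun i => (c i * ee (toC (a i) * tau)) * ee (toC (a i) * h0)) (g (h0 + tau)).
  move=> hh; apply: eq_hsum (hg _ (inH_nbhs ht hh)) => i.
  by rewrite mulrDr addrC eeD mulrA.
have [D [hD q]] := termwise_deriv ht h.
exists D; first by apply: eq_hsum hD => i; rewrite -!mulrA; congr (_ * _); ring.
apply: quad_is_derive; move: q; rewrite /quad_deriv.
move=> [M [rho [r0 hM]]]; exists M, rho; split=> // k hk.
have e (u : C) : (u *: (1 : C^o) + (tau : C^o)) = u + tau by rewrite /GRing.scale /= mulr1.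
by rewrite !e; apply: hM.
Qed.

Lemma ZEXP_derive n (I : eqType) (c : I -> C) (b : I -> 'I_n -> R) (g : 'rV[C]_n -> C) (x : 'rV[C]_n) l :
  ZEXP c b g ->
  exists2 D, hsum (fun i => c i * (tpi R * toC (b i l)) * ee (\sum_l toC (b i l) * x 0 l)) D &
    is_derive x (delta_mx 0 l) (g : 'rV[C]_n -> C^o) D.
Proof.
move=> hg.
have h h0 : normc h0 < 1 ->
    hsum (fun i => (c i * ee (\sum_l toC (b i l) * x 0 l)) * ee (toC (b i l) * h0))
      (g (h0 *: delta_mx 0 l + x)).
  move=> hh; apply: eq_hsum (hg _) => i.
  rewrite -mulrA -eeD; congr (_ * ee _); rewrite addrC.
  under eq_bigr do rewrite !mxE mulrDr.
  rewrite big_split /=; congr (_ + _); rewrite (bigD1 l) //= !eqxx /= mulr1 big1 ?addr0 //.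
  by move=> k /negbTE kl; rewrite kl !mulr0.
have [D [hD q]] := termwise_deriv ltr01 h.
exists D; last exact: quad_is_derive.
by apply: eq_hsum hD => i; rewrite -!mulrA; congr (_ * _); ring.
Qed.

Section Vec.
Variable m : nat.

Lemma TEXP_vec (I : eqType) (c : 'I_m -> I -> C) (a : I -> R) (g : C -> 'cV[C]_m) :
  (forall r, TEXP (c r) a (fun t => g t r 0)) ->
  (forall r, TEXP (fun i => c r i * (tpi R * toC (a i))) a
    (fun t => ('D_(1 : C^o) (g : C^o -> 'cV[C]_m) (t : C^o)) r 0)) /\
  (forall tau, inH tau -> differentiable (g : C^o -> 'cV[C]_m) (tau : C^o)).
Proof.
move=> h.
have key tau : inH tau -> exists D : 'cV[C]_m,
    (forall r, hsum (fun i => c r i * (tpi R * toC (a i)) * ee (toC (a i) * tau)) (D r 0)) /\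
    is_derive (tau : C^o) (1 : C^o) (g : C^o -> 'cV[C]_m) D.
  move=> ht; have ex r := TEXP_derive (h r) ht.
  pose d r := sval (cid2 (ex r)).
  exists (\col_r d r); split=> [r|].
    by rewrite mxE /d; case: cid2.
  by apply: is_derive_cV => r; rewrite mxE /d; case: cid2.
split=> [r tau ht|tau ht]; have [D [hD dD]] := key tau ht.
  by rewrite (@derive_val _ _ _ _ _ _ _ dD).
by apply/derivable1_diffP; exact: (@ex_derive _ _ _ _ _ _ _ dD).
Qed.

Lemma ZEXP_vec n (I : eqType) (c : 'I_m -> I -> C) (b : I -> 'I_n -> R)
    (g : 'rV[C]_n -> 'cV[C]_m) l :
  (forall r, ZEXP (c r) b (fun t => g t r 0)) ->
  forall r, ZEXP (fun i => c r i * (tpi R * toC (b i l))) b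
    (fun x => pD (delta_mx 0 l) g x r 0).
Proof.
move=> h r x; have ex r := ZEXP_derive x l (h r).
pose d r := sval (cid2 (ex r)).
have dD : is_derive x (delta_mx 0 l) g (\col_r d r).
  by apply: is_derive_cV => k; rewrite mxE /d; case: cid2.
by rewrite /pD (@derive_val _ _ _ _ _ _ _ dD) mxE /d; case: cid2.
Qed.

Lemma partialn_vec n (I : eqType) (c : 'I_m -> I -> C) (b : I -> 'I_n -> R)
    (g : 'rV[C]_n -> 'cV[C]_m) (p : {ffun 'I_n -> nat}) :
  (forall r, ZEXP (c r) b (fun t => g t r 0)) ->
  forall r, ZEXP (fun i => c r i * \prod_l (tpi R * toC (b i l)) ^+ p l) b
    (fun x => partialn p g x r 0).
Proof.
move=> h; rewrite /partialn.
have key s r : ZEXP (fun i => c r i * \prod_(l <- s) (tpi R * toC (b i l)) ^+ p l) b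
    (fun x => foldr (fun i g => iter (p i) (pD (delta_mx 0 i)) g) g s x r 0).
  elim: s r => [|l s IH] r /=.
    by move=> x; apply: eq_hsum (h r x) => i; rewrite big_nil mulr1.
  have it k r' : ZEXP (fun i => c r' i * \prod_(l <- s) (tpi R * toC (b i l)) ^+ p l *
        (tpi R * toC (b i l)) ^+ k) b
      (fun x => iter k (pD (delta_mx 0 l))
         (foldr (fun i g => iter (p i) (pD (delta_mx 0 i)) g) g s) x r' 0).
    elim: k r' => [|k IHk] r'.
      by move=> x; apply: eq_hsum (IH r' x) => i; rewrite expr0 mulr1.
    move=> x; apply: eq_hsum (ZEXP_vec l IHk r' x) => i.
    by rewrite exprSr -!mulrA.
  move=> x; apply: eq_hsum (it (p l) r x) => i.
  by rewrite big_cons; ring.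
by move=> r x; apply: eq_hsum (key (enum 'I_n) r x) => i; rewrite big_enum.
Qed.

End Vec.

(** Counterpart of [partialn_vec] for the theta series, whose values are scalars in [C^o] and not
    columns. *)
Lemma partialn_C0 n (I : eqType) (c : I -> C) (b : I -> 'I_n -> R)
    (g : 'rV[C]_n -> C^o) (p : {ffun 'I_n -> nat}) : ZEXP c b g ->
  ZEXP (fun i => c i * \prod_l (tpi R * toC (b i l)) ^+ p l) b (partialn p g).
Proof.
move=> h; rewrite /partialn.
have key s : ZEXP (fun i => c i * \prod_(l <- s) (tpi R * toC (b i l)) ^+ p l) b
    (foldr (fun i g => iter (p i) (pD (delta_mx 0 i)) g) g s).
  elim: s => [|l s IH] /=.
    by move=> x; apply: eq_hsum (h x) => i; rewrite big_nil mulr1.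
  have it k : ZEXP (fun i => c i * \prod_(l <- s) (tpi R * toC (b i l)) ^+ p l *
        (tpi R * toC (b i l)) ^+ k) b
      (iter k (pD (delta_mx 0 l))
         (foldr (fun i g => iter (p i) (pD (delta_mx 0 i)) g) g s)).
    elim: k => [|k IHk].
      by move=> x; apply: eq_hsum (IH x) => i; rewrite expr0 mulr1.
    move=> x; have [D hD dD] := ZEXP_derive x l IHk.
    rewrite /= {1}/pD (@derive_val _ _ _ _ _ _ _ dD).
    by apply: eq_hsum hD => i; rewrite exprSr -!mulrA.
  move=> x; apply: eq_hsum (it (p l) x) => i.
  by rewrite big_cons; ring.
by move=> x; apply: eq_hsum (key (enum 'I_n) x) => i; rewrite big_enum.
Qed.

Section Dk.
Variables (n m : nat) (Bm E : 'M[R]_n) (k2 : int).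

(** This is the coefficient of $z^p$ in the Taylor series of $e(\sum_l b_lz_l)$. *)
Definition exp_moment (b : 'I_n -> R) (p : {ffun 'I_n -> nat}) : C :=
  \prod_l ((tpi R * toC (b l)) ^+ p l / (p l)`!%:R).

(* [D_{k,p}] of the single exponential [e(a tau + sum_l b_l z_l)] is [Dk_term p a b * e(a tau)]. *)
Definition Dk_term (p : {ffun 'I_n -> nat}) (a : R) (b : 'I_n -> R) : C :=
  let s := mi_sum p in
  let lam := (s %/ 2)%N in
  let lam' := ((s%:Z - 1) %/ 2)%Z in
  let Gm := E *m Bm *m E^T in
  let k : C := k2%:~R / 2 in
  ((4 : C) ^+ lam * (lam`!)%:R) *
  \sum_(L : {ffun 'I_n * 'I_n -> 'I_lam.+1} | (sumL L <= lam)%N)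
     ((\prod_ij ((- piC R * iC R * toC (Gm ij.1 ij.2)) ^+ L ij / ((L ij)`!)%:R))
        * prodk k lam' (s%:Z - 2 - (sumL L)%:Z))
     * ((tpi R * toC a) ^+ sumL L *
        if [forall i, (piL L i <= p i)%N] then exp_moment b [ffun i => (p i - piL L i)%N] else 0).

Definition JEXP (I : eqType) (c : 'I_m -> I -> C) (a : I -> R) (b : I -> 'I_n -> R)
    (phi : C -> 'rV[C]_n -> 'cV[C]_m) : Prop :=
  forall r tau (x : 'rV[C]_n), inH tau ->
    hsum (fun i => c r i * ee (toC (a i) * tau + \sum_l toC (b i l) * x 0 l))
         (phi tau (x *m EC E) r 0).

Variables (I : eqType) (c : 'I_m -> I -> C) (a : I -> R) (b : I -> 'I_n -> R).
Variable phi : C -> 'rV[C]_n -> 'cV[C]_m.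
Hypothesis hphi : JEXP c a b phi.

Lemma hcoef_TEXP p r :
  TEXP (fun i => c r i * exp_moment (b i) p) a (fun tau => hcoef E phi p tau r 0).
Proof.
move=> tau ht.
have h r' : ZEXP (fun i => c r' i * ee (toC (a i) * tau)) b
    (fun x => phi tau (x *m EC E) r' 0).
  by move=> x; apply: eq_hsum (hphi r' x ht) => i; rewrite eeD mulrA.
have := partialn_vec p h r (0 : 'rV[C]_n).
move=> /(hsumZ (\prod_i ((p i)`!)%:R)^-1); rewrite /hcoef !mxE; apply: eq_hsum => i.
have -> : \sum_l toC (b i l) * (0 : 'rV[C]_n) 0 l = 0.
  by apply: big1 => l _; rewrite mxE mulr0.
rewrite ee0 mulr1 /exp_moment big_split /= -prodfV; ring.
Qed.

Lemma tauD_TEXP (g : C -> 'cV[C]_m) s (d : 'I_m -> I -> C) :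
  (forall r, TEXP (d r) a (fun t => g t r 0)) ->
  forall r, TEXP (fun i => d r i * (tpi R * toC (a i)) ^+ s) a (fun t => tauD s g t r 0).
Proof.
move=> h; rewrite /tauD; elim: s => [|s IH] r.
  by move=> t ht; apply: eq_hsum (h r t ht) => i; rewrite expr0 mulr1.
move=> t ht; have := (TEXP_vec IH).1 r t ht; apply: eq_hsum => i.
by rewrite exprSr -!mulrA.
Qed.

(** $D_{k,p}$ is a finite combination of Taylor coefficients and their $\tau$-derivatives, each of
    which acts termwise on an expansion. Identities for $D_{k,p}$ thereby become identities between
    the numbers [Dk_term]. *)
Lemma Dk_TEXP p r :
  TEXP (fun i => c r i * Dk_term p (a i) (b i)) a (fun tau => Dk Bm E k2 p phi tau r 0).
Proof.
move=> tau ht; rewrite /Dk /= mxE summxE.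
set lam := (mi_sum p %/ 2)%N; set A := _ ^+ lam * _.
have hL (L : {ffun 'I_n * 'I_n -> 'I_lam.+1}) :
    TEXP (fun i => c r i * (if [forall i, (piL L i <= p i)%N] then
         exp_moment (b i) [ffun i => (p i - piL L i)%N] else 0) * (tpi R * toC (a i)) ^+ sumL L)
      a (fun t => tauD (sumL L) (hshift E phi p L) t r 0).
  apply: (@tauD_TEXP _ _ (fun r i => c r i * (if [forall i, (piL L i <= p i)%N] then
         exp_moment (b i) [ffun i => (p i - piL L i)%N] else 0))) => r'.
  rewrite /hshift; case: ifP => _; first exact: hcoef_TEXP.
  move=> t t0; apply: (@eq_hsum _ _ (fun=> 0)) => [i|].
    by rewrite mulr0 mul0r.
  by rewrite mxE; exact: hsum0.
pose co (L : {ffun 'I_n * 'I_n -> 'I_lam.+1}) :=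
     ((\prod_ij ((- piC R * iC R * toC ((E *m Bm *m E^T) ij.1 ij.2)) ^+ L ij / ((L ij)`!)%:R))
        * prodk (k2%:~R / 2 : C) (((mi_sum p)%:Z - 1) %/ 2)%Z ((mi_sum p)%:Z - 2 - (sumL L)%:Z)).
have := hsumZ A (hsum_sum (index_enum _) (P := fun L => (sumL L <= lam)%N)
  (fun L _ => hsumZ (co L) (hL L tau ht))).
have -> : \sum_(i | (sumL i <= lam)%N) co i * tauD (sumL i) (hshift E phi p i) tau r 0 =
  \sum_(i | (sumL i <= lam)%N) (co i *: tauD (sumL i) (hshift E phi p i) tau) r 0.
  by apply: eq_bigr => L _; rewrite mxE.
apply: eq_hsum => i; rewrite /Dk_term /= -/lam -/A.
set S := \sum_(L | _) _ * (_ * if _ then _ else _).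
have -> : c r i * (A * S) * ee (toC (a i) * tau) = A * (S * (c r i * ee (toC (a i) * tau))).
  by ring.
congr (_ * _); rewrite mulr_suml; apply: eq_bigr => L _; rewrite -/(co L).
set w := if _ then _ else _; set v := _ ^+ sumL L.
by move: (co L) w v (ee _) => x y z u; ring.
Qed.

Lemma Dk_holoM p : holoM (Dk Bm E k2 p phi).
Proof. exact: (TEXP_vec (fun r => Dk_TEXP p r)).2. Qed.

End Dk.

End Termwise.

(** * Uniqueness of exponential expansions *)

Section Characters.
Variable R : realType.
Local Notation C := R[i].

Lemma ee_toC (x : R) : ee (toC x) = Complex (cos (2 * pi * x)) (sin (2 * pi * x)).
Proof. by rewrite /ee /= mulr0 expR0 !mul1r. Qed.

Lemma ee_nat_mul j (x : R) : ee (toC x) ^+ j = ee (toC (j%:R * x)).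
Proof.
elim: j => [|j IH]; first by rewrite expr0 mul0r ee0.
by rewrite exprS IH -eeD -toCD mulrSr mulrDl mul1r addrC.
Qed.

Lemma ee_half : ee (toC (2^-1 : R)) = -1.
Proof.
rewrite ee_toC mulrAC divff ?mul1r ?pnatr_eq0 //.
by rewrite cospi sinpi; apply/eqP; rewrite eq_complex /= oppr0 !eqxx.
Qed.

Lemma ee_1 : ee (1 : C) = 1.
Proof.
have e : 2^-1 + 2^-1 = 1 :> R by field.
have -> : ee (1 : C) = ee (toC 2^-1 + toC 2^-1) by rewrite -toCD e.
by rewrite eeD ee_half mulrNN mulr1.
Qed.

Lemma ee_int (z : int) : ee (z%:~R : C) = 1.
Proof.
have nat_case (k : nat) : ee (k%:R : C) = 1.
  by elim: k => [|k IH]; rewrite ?mulr0n ?ee0 // mulrS eeD ee_1 IH mul1r.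
case: z => k; first exact: nat_case.
by have := eeN (k.+1%:R : C); rewrite nat_case mulr1 NegzE mulrNz.
Qed.

(** For the fractional part [f] of [x], the relation $e(f/2)^2=1$ makes $\sin(\pi f)$ vanish,
    whereas the sine is positive on $(0,\pi)$. *)
Lemma ee_toC_eq1 (x : R) : ee (toC x) = 1 -> exists z : int, x = z%:~R.
Proof.
move=> h; exists (Num.floor x); apply/eqP; rewrite -subr_eq0; apply/eqP.
set f := x - _; have f0 : 0 <= f by rewrite subr_ge0 Num.Theory.floor_le.
have f1 : f < 1 by rewrite ltrBlDl; have := Num.Theory.floorD1_gt x; rewrite intrD.
have e1 : ee (toC f) = 1.
  have : ee (toC f + toC (Num.floor x)%:~R) = 1 by rewrite -toCD subrK.
  by rewrite eeD toC_int ee_int mulr1.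
have e2 : ee (toC (f / 2)) ^+ 2 = 1.
  by rewrite expr2 -eeD -toCD -e1; congr (ee (toC _)); field.
have s0 : sin (pi * f) = 0.
  have := e2; move/eqP; rewrite sqrf_eq1 ee_toC.
  have -> : 2 * pi * (f / 2) = pi * f by field.
  by case/orP => /eqP [_ ->] //; rewrite oppr0.
apply/eqP; rewrite -[_ == _]negbK; apply/negP => fn.
have : 0 < sin (pi * f).
  apply: sin_gt0_pi; have pp := pi_gt0 R.
  by rewrite pmulr_rgt0 // lt_def fn f0 /= -[X in _ < X]mulr1 ltr_pM2l.
by rewrite s0 ltxx.
Qed.

Lemma normc_half1 (w : C) : normc w = 1 -> w != 1 -> normc ((1 + w) / 2) < 1.
Proof.
case: w => a b h w1.
have h2 : a ^+ 2 + b ^+ 2 = 1.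
  by rewrite -[LHS]sqr_sqrtr ?addr_ge0 ?sqr_ge0 // -[Num.sqrt _]/(normc (Complex a b)) h expr1n.
have a1 : a < 1.
  have : a <= 1 by have := sqr_ge0 b; nra.
  rewrite le_eqVlt => /orP[/eqP ea|//]; case/negP: w1.
  have : b ^+ 2 = 0 by move: h2; rewrite ea expr1n; lra.
  by move=> /eqP; rewrite sqrf_eq0 ea => /eqP ->.
rewrite normcM normcV normc_nat ltr_pdivrMr // mul1r.
rewrite -[1 + _]/(Complex (1 + a) (0 + b)) /= add0r.
have -> : (2 : R) = Num.sqrt (2 ^+ 2) by rewrite sqrtr_sqr ger0_norm.
rewrite ltr_sqrt ?exprn_gt0 //; nra.
Qed.

Lemma expr_small (r e : R) : 0 <= r -> r < 1 -> 0 < e -> exists N, r ^+ N <= e.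
Proof.
move=> r0 r1 e0; have r1' : `|r| < 1 by rewrite ger0_norm.
have /cvgrPdist_lt /(_ e e0) [N _ hN] := cvg_expr r1'.
exists N; have := hN N (leqnn N); rewrite /= sub0r normrN ger0_norm ?exprn_ge0 //.
exact: ltW.
Qed.

(* Averaging the relation over translates by x, twisted by the character of i0, multiplies the
   i-th coefficient by (1 + w_i)/2 with |w_i| = 1; iterating kills every character other than
   that of i0. *)
Lemma char_uniq (X : zmodType) (I : eqType) (chi : X -> I -> C) (c : I -> C) (i0 : I) :
  (forall x i, normc (chi x i) = 1) ->
  (forall x y i, chi (x + y) i = chi x i * chi y i) ->
  (forall x, hsum (fun i => c i * chi x i) 0) ->
  (forall i, i != i0 -> c i != 0 -> exists x, chi x i != chi x i0) ->
  c i0 = 0.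
Proof.
move=> chi1 chiM hs sep.
pose K (m : I -> C) := [/\ forall i, normc (m i) <= 1, m i0 = 1 &
  forall x, hsum (fun i => c i * m i * chi x i) 0].
have chi_n0 x i : chi x i != 0 by rewrite -normc_eq0 chi1 oner_eq0.
pose w x i := chi x i / chi x i0.
have w1 x i : normc (w x i) = 1 by rewrite normcM normcV !chi1 divr1.
have K1 : K (fun=> 1).
  by split=> [i|//|x]; [rewrite normc1|apply: eq_hsum (hs x) => i; rewrite mulr1].
have Kstep m x : K m -> K (fun i => m i * ((1 + w x i) / 2)).
  move=> [m1 mi0 mh]; split=> [i||y].
  - rewrite normcM -[leRHS]mulr1; apply: ler_pM; rewrite ?normc_ge0 //.
    rewrite normcM normcV normc_nat ler_pdivrMr // mul1r.
    by apply: le_trans (le_normcD _ _) _; rewrite normc1 w1.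
  - by rewrite mi0 /w divff // mul1r; field.
  - have h1 := hsumZ 2^-1 (hsumD (mh y) (hsumZ (chi x i0)^-1 (mh (x + y)))).
    rewrite mulr0 addr0 mulr0 in h1; apply: eq_hsum h1 => i.
    by rewrite chiM /w; field.
have KN m x N : K m -> K (fun i => m i * ((1 + w x i) / 2) ^+ N).
  move=> Km; elim: N => [|N IH].
    by have [? ? h] := Km; split=> [i||y]; rewrite ?expr0 ?mulr1 //; apply: eq_hsum (h y) => i; rewrite expr0 mulr1.
  have [h1 h2 h3] := Kstep _ x IH; split=> [i||y].
  - by rewrite exprSr mulrA.
  - by rewrite exprSr mulrA.
  - by apply: eq_hsum (h3 y) => i; rewrite exprSr !mulrA.
(* Infinitely many characters cannot be damped at once. Making the multiplier small on a finite set
   suffices: elsewhere $|m|\le 1$ and absolute summability control the terms. *)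
have kill (F : seq I) (e : R) : 0 < e -> exists2 m, K m &
    forall i, i \in F -> i != i0 -> c i != 0 -> normc (m i) <= e.
  move=> e0; elim: F => [|j F [m Km hm]]; first by exists (fun=> 1).
  have [->|ji0] := eqVneq j i0.
    by exists m => // i; rewrite inE => /orP[/eqP -> /eqP //|]; exact: hm.
  have [cj|cj] := eqVneq (c j) 0.
    by exists m => // i; rewrite inE => /orP[/eqP -> _ /eqP //|]; exact: hm.
  have [x hx] := sep j ji0 cj.
  have wj : w x j != 1.
    apply: contra hx => /eqP; rewrite /w => h.
    by apply/eqP; rewrite -[LHS](divfK (chi_n0 x i0)) h mul1r.
  have [N hN] := expr_small (normc_ge0 _) (normc_half1 (w1 x j) wj) e0.
  have Km' := KN m x N Km.
  exists (fun i => m i * ((1 + w x i) / 2) ^+ N) => // i.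
  have [m1 _ _] := Km.
  have half1 k : normc ((1 + w x k) / 2) <= 1.
    rewrite normcM normcV normc_nat ler_pdivrMr // mul1r.
    by apply: le_trans (le_normcD _ _) _; rewrite normc1 w1.
  rewrite inE => /orP[/eqP -> _ _|iF ii0 ci]; rewrite normcM normcX.
    rewrite -[e]mul1r; apply: ler_pM => //; first exact: normc_ge0.
    by rewrite exprn_ge0 ?normc_ge0.
  rewrite -[e]mulr1; apply: ler_pM; rewrite ?normc_ge0 ?exprn_ge0 ?normc_ge0 ?hm //.
  by rewrite exprn_ile1 ?normc_ge0.
have chi0 i : chi 0 i = 1.
  by apply: (mulfI (chi_n0 0 i)); rewrite -chiM addr0 mulr1.
have ac : abssum c.
  by apply: hsum_abssum (_ : hsum c 0); apply: eq_hsum (hs 0) => i; rewrite chi0 mulr1.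
apply: normc_small => e e0; have e2 : 0 < e / 2 by lra.
have [F uF hF] := abssum_tail ac e2.
pose L := \sum_(i <- F) normc (c i).
have L0 : 0 <= L by apply: sumr_ge0 => i _; exact: normc_ge0.
(* Dividing by [L + 1] and not by [L] keeps the threshold positive when all coefficients on [F]
   vanish. *)
have d0 : 0 < e / 2 / (L + 1) by apply: divr_gt0 => //; lra.
have [m [m1 mi0 mh] hm] := kill F _ d0.
pose c0 i := if i == i0 then c i else 0.
have h0 : hsum c0 (c i0).
  have -> : c i0 = \sum_(i <- [:: i0]) c0 i by rewrite big_seq1 /c0 eqxx.
  by apply: hsum_supp => // i; rewrite inE /c0 => /negbTE ->.
have h1 : hsum (fun i => c i * m i - c0 i) (0 - c i0).
  by apply: hsumB h0; apply: eq_hsum (mh 0) => i; rewrite chi0 mulr1.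
rewrite -normcN -sub0r; apply: hsum_bound h1 _ => G uG.
have bnd i : normc (c i * m i - c0 i) <= normc (c i).
  rewrite /c0; have [->|_] := eqVneq i i0; first by rewrite mi0 mulr1 subrr normc0 normc_ge0.
  by rewrite subr0 normcM ler_piMr ?normc_ge0.
rewrite (bigID (mem F)) /=; have -> : e = e / 2 + e / 2 by field.
apply: lerD; last first.
  rewrite -big_filter; apply: le_trans (hF [seq i <- G | i \notin F] _ _).
  - by apply: ler_sum => i _; exact: bnd.
  - exact: filter_uniq.
  - by move=> i; rewrite mem_filter => /andP[].
apply: (@le_trans _ _ (\sum_(i <- G | i \in F) normc (c i) * (e / 2 / (L + 1)))).
  apply: ler_sum => i iF; rewrite /c0; have [->|ii0] := eqVneq i i0.
    by rewrite mi0 mulr1 subrr normc0 mulr_ge0 ?normc_ge0 // ltW.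
  rewrite subr0 normcM; have [->|ci] := eqVneq (c i) 0; first by rewrite normc0 !mul0r.
  by rewrite ler_wpM2l ?normc_ge0 ?hm.
rewrite -mulr_suml; apply: (@le_trans _ _ (L * (e / 2 / (L + 1)))).
  rewrite ler_wpM2r ?(ltW d0) // -big_filter; apply: sum_subset => //.
  - exact: filter_uniq.
  - by move=> i; rewrite mem_filter => /andP[].
  - by move=> i; exact: normc_ge0.
by rewrite mulrA ler_pdivrMr; nra.
Qed.

End Characters.

(** * The multinomial theorem and uniqueness of polynomial coefficients *)

Section Multinomial.
Variable R : realType.
Local Notation C := R[i].

(** Both sides compute the coefficient of $X^s$ in a product of exponential series truncated at
    degree [N]; the truncation does not reach this coefficient because $s\le N$. *)
Lemma multinomial (T : finType) (y : T -> C) (N s : nat) : (s <= N)%N ->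
  \sum_(f : {ffun T -> 'I_N.+1} | (\sum_t (f t : nat) == s)%N)
    \prod_t (y t ^+ f t / (f t)`!%:R) = (\sum_t y t) ^+ s / s`!%:R.
Proof.
move=> sN.
pose P t : {poly C} := \poly_(j < N.+1) (y t ^+ j / j`!%:R).
have key (r : seq T) k : (k <= N)%N ->
    (\prod_(t <- r) P t)`_k = (\sum_(t <- r) y t) ^+ k / k`!%:R.
  elim: r k => [|t r IH] k kN.
    rewrite !big_nil coef1; case: k kN => [|k] _; first by rewrite expr0 divr1.
    by rewrite expr0n mul0r.
  rewrite !big_cons coefM addrC -divpow_add; apply: eq_bigr => i _.
  have ik : (i <= k)%N by rewrite -ltnS.
  rewrite coef_poly ltnS (leq_trans ik kN) IH ?(leq_trans (leq_subr _ _)) //.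
  exact: mulrC.
rewrite -(key _ s sN) /P.
under [in RHS]eq_bigr do rewrite poly_def.
rewrite (bigA_distr_bigA) coef_sum [LHS]big_mkcond; apply: eq_bigr => f _.
have -> : \prod_t (y t ^+ f t / (f t)`!%:R *: 'X^(f t)) =
    (\prod_t (y t ^+ f t / (f t)`!%:R)) *: 'X^(\sum_t f t) :> {poly C}.
  by rewrite scaler_prod prodrXr.
by rewrite coefZ coefXn eq_sym; case: eqP => _; rewrite ?mulr1 ?mulr0.
Qed.

(** At points $x_l=e(\theta_l)$ of the torus the monomials become pairwise distinct characters of
    $\theta\in\mathbb R^n$, so [char_uniq] applies. *)
Lemma poly_coef_uniq n s (d : {ffun 'I_n -> 'I_s.+1} -> C) :
  (forall x : 'I_n -> C, \sum_q d q * \prod_l x l ^+ q l = 0) -> forall q, d q = 0.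
Proof.
move=> h q0.
pose chi (th : 'rV[R]_n) (q : {ffun 'I_n -> 'I_s.+1}) : C := ee (toC (\sum_l (q l)%:R * th 0 l)).
apply: (@char_uniq R _ _ chi d q0).
- by move=> th q; rewrite normc_ee /= mulr0 oppr0 expR0.
- move=> x y q; rewrite /chi -eeD -toCD -big_split; congr (ee (toC _)).
  by apply: eq_bigr => l _; rewrite mxE mulrDr.
- move=> th; rewrite -(h (fun l => ee (toC (th 0 l)))).
  apply: eq_hsum (hsum_fin _) => q /=; congr (_ * _); rewrite /chi toC_sum.
  rewrite (big_morph _ (@eeD R) (ee0 R)).
  by apply: eq_bigr => l _; rewrite ee_nat_mul.
move=> q qq0 _.
have [l hl] : exists l, q l != q0 l.
  apply/existsP; rewrite -[X in is_true X]negbK negb_exists; apply: contra qq0 => /forallP e.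
  by apply/eqP/ffunP => l; apply/eqP; have := e l; rewrite negbK.
pose D : R := (q l)%:R - (q0 l)%:R.
have D0 : D != 0 by rewrite subr_eq0 eqr_nat.
(* This translation changes the relative phase of the two characters by $D/(2D)=1/2$, so their
   values differ by the factor $e(1/2)=-1$. *)
exists ((2 * D)^-1 *: delta_mx 0 l).
have e p : \sum_k (p k : 'I_s.+1)%:R * ((2 * D)^-1 *: delta_mx 0 l : 'rV[R]_n) 0 k = (p l)%:R / (2 * D).
  rewrite (bigD1 l) //= !mxE !eqxx mulr1 big1 ?addr0 // => k /negbTE kl.
  by rewrite !mxE kl andbF !mulr0.
rewrite /chi !e.
have -> : (q l)%:R / (2 * D) = (q0 l)%:R / (2 * D) + 2^-1.
  by rewrite /D; field; rewrite -/D.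
rewrite toCD eeD ee_half mulrN1 eq_sym -subr_eq0 opprK -mulr2n mulrn_eq0 /=.
exact: ee_neq0.
Qed.

End Multinomial.

(** * The transformation law of the differential operators *)

Section Poch.
Variable R : realType.
Local Notation C := R[i].

Definition poch (x : C) (l : nat) : C := \prod_(t < l) (x + t%:R).

Lemma poch0 x : poch x 0 = 1. Proof. by rewrite /poch big_ord0. Qed.
Lemma pochS x l : poch x l.+1 = poch x l * (x + l%:R).
Proof. by rewrite /poch big_ord_recr. Qed.
Lemma pochSl x l : poch x l.+1 = x * poch (x + 1) l.
Proof.
rewrite /poch big_ord_recl addr0; congr (_ * _); apply: eq_bigr => i _.
by rewrite lift0 -addrA -natr1 [1 + _]addrC.
Qed.
Lemma pochD x a b : poch x (a + b) = poch x a * poch (x + a%:R) b.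
Proof.
elim: b => [|b IH]; first by rewrite addn0 poch0 mulr1.
by rewrite addnS !pochS IH -mulrA natrD addrA.
Qed.

(** An [N]-th finite difference kills a polynomial of degree $l<N$. Pascal's rule lowers the order
    of the difference by one, and the difference of two neighbouring rising factorials of length $l$
    is $l$ times one of length $l-1$. *)
Lemma alt_binom_poch N l y : (l < N)%N ->
  \sum_(t < N.+1) (-1) ^+ t * 'C(N, t)%:R * poch (y - t%:R) l = 0.
Proof.
elim: N l y => [//|N IH] l y lN.
have pasc : \sum_(t < N.+2) (-1) ^+ t * 'C(N.+1, t)%:R * poch (y - t%:R) l =
    \sum_(t < N.+1) (-1) ^+ t * 'C(N, t)%:R * (poch (y - t%:R) l - poch (y - t%:R - 1) l).
  under [RHS]eq_bigr do rewrite mulrBr.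
  rewrite sumrB [LHS]big_ord_recl [X in _ = X - _]big_ord_recl /= !bin0 -addrA; congr (_ + _).
  under eq_bigr do rewrite binS natrD mulrDr mulrDl.
  rewrite big_split /= [X in X + _ = _]big_ord_recr /= bin_small // mulr0 mul0r addr0.
  congr (_ + _); rewrite -sumrN; apply: eq_bigr => i _.
  by rewrite exprS -natr1 opprD addrA; ring.
rewrite pasc; case: l lN {pasc} => [|l] lN.
  by apply: big1 => t _; rewrite !poch0 subrr mulr0.
transitivity ((l.+1)%:R * \sum_(t < N.+1) (-1) ^+ t * 'C(N, t)%:R * poch (y - t%:R) l).
  rewrite mulr_sumr; apply: eq_bigr => t _.
  by rewrite pochS pochSl subrK -natr1; ring.
by rewrite IH ?mulr0.
Qed.

(** The left side is the product over the runs $u,\dots,u+l-t-1$ and $u+l-M+1-t,\dots,u+l-M$;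
    exchanging their right ends gives the right side. The gain is that [t] then enters only through
    a polynomial of degree $M-1$, which an [M]-th difference annihilates. The two cases of the proof
    record which run starts first. *)
Lemma poch_swap u (l M t : nat) : (0 < M)%N -> (t <= M)%N -> (M <= l)%N ->
  poch u (l - t) * poch (u + (l - M).+1%:R - t%:R) t =
  poch u (l - M).+1 * poch (u + (l - M).+1%:R - t%:R) M.-1.
Proof.
move=> M0 tM Ml.
have [le|lt] := leqP t (l - M).+1.
  have e : u + (l - M).+1%:R - t%:R = u + ((l - M).+1 - t)%:R by rewrite natrB // addrA.
  have -> : (l - t = ((l - M).+1 - t) + M.-1)%N by lia.
  have e2 : poch u (l - M).+1 =
      poch u ((l - M).+1 - t) * poch (u + ((l - M).+1 - t)%:R) t by rewrite -pochD subnK.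
  by rewrite e2 pochD -e; ring.
pose e := (t - (l - M).+1)%N.
have -> : u + (l - M).+1%:R - t%:R = u - e%:R.
  by rewrite /e natrB ?(ltnW lt) //; ring.
have -> : (t = e + (l - M).+1)%N by rewrite /e; lia.
have -> : (M.-1 = e + (l - (e + (l - M).+1)))%N by rewrite /e; lia.
have -> : (e + (l - (e + (l - M).+1)) = e + (l - t))%N by rewrite /e; lia.
have -> : (l - (e + (l - M).+1) = l - t)%N by rewrite /e; lia.
by rewrite !pochD subrK; ring.
Qed.

Lemma poch_cancel u (l M : nat) : (M <= l)%N ->
  \sum_(t < M.+1) (-1) ^+ t * 'C(M, t)%:R *
     (poch u (l - t) * poch (u + (l - M).+1%:R - t%:R) t) =
  if M == 0%N then poch u l else 0.
Proof.
case: M => [|M] Ml.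
  by rewrite big_ord1 /= subn0 poch0 bin0; ring.
rewrite (eq_bigr (fun t : 'I_M.+2 => poch u (l - M.+1).+1 *
   ((-1) ^+ t * 'C(M.+1, t)%:R * poch (u + (l - M.+1).+1%:R - t%:R) M))); last first.
  move=> t _; rewrite poch_swap //; last by rewrite -ltnS.
  by rewrite mulrCA.
by rewrite -mulr_sumr alt_binom_poch // mulr0.
Qed.

(** $\lfloor(s-1)/2\rfloor=s-1-\lfloor s/2\rfloor$, also for $s=0$ where the value is $-1$. The
    range therefore has $\lfloor s/2\rfloor-r$ factors, and the empty range of [prodk] corresponds
    to the rising factorial of length 0. *)
Lemma prodk_poch (k : C) (s r : nat) : (r <= s %/ 2)%N ->
  prodk k ((s%:Z - 1) %/ 2)%Z (s%:Z - 2 - r%:Z) =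
  poch (k + s%:R - 1 - (s %/ 2)%N%:R) (s %/ 2 - r).
Proof.
move=> rs.
have -> : (((s%:Z - 1) %/ 2)%Z = s%:Z - 1 - (s %/ 2)%N%:Z) by lia.
rewrite /prodk; case: ifP => h.
  have -> : absz (s%:Z - 2 - r%:Z - (s%:Z - 1 - (s %/ 2)%N%:Z) + 1) = (s %/ 2 - r)%N by lia.
  rewrite /poch; apply: eq_bigr => t _.
  by rewrite !(rmorphD, rmorphB, rmorphN) /= !rmorph1 /=; ring.
have -> : (s %/ 2 - r = 0)%N by lia.
by rewrite poch0.
Qed.

End Poch.

(** * The principal root, the automorphy factor and derivatives of slashed functions *)

Section Mobius.
Variable R : realType.
Local Notation C := R[i].

Lemma csqrt_sqr (z : C) : csqrt z ^+ 2 = z.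
Proof.
case: z => a b; rewrite /csqrt /=; set r := Num.sqrt (a ^+ 2 + b ^+ 2).
have hr : r ^+ 2 = a ^+ 2 + b ^+ 2 by rewrite sqr_sqrtr // addr_ge0 ?sqr_ge0.
have r0 : 0 <= r := sqrtr_ge0 _.
have ra : `|a| <= r by rewrite -sqrtr_sqr ler_wsqrtr // lerDl sqr_ge0.
have [ra1 ra2] : 0 <= (r + a) / 2 /\ 0 <= (r - a) / 2.
  by have := ler_norm a; have := ler_norm (- a); rewrite normrN; split; lra.
set p := Num.sqrt _; set q := Num.sqrt ((r - a) / 2).
have hp : p ^+ 2 = (r + a) / 2 by rewrite sqr_sqrtr.
have hq : q ^+ 2 = (r - a) / 2 by rewrite sqr_sqrtr.
have hpq : p * q = `|b| / 2.
  rewrite -sqrtrM // -[RHS]ger0_norm ?divr_ge0 // -sqrtr_sqr; congr Num.sqrt.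
  by rewrite expr_div_n real_normK ?num_real //; nra.
rewrite expr2; simpc; apply/eqP; rewrite eq_complex /=; apply/andP; split; apply/eqP.
  have -> : p * p - (if b < 0 then -1 else 1) * q * ((if b < 0 then -1 else 1) * q) = p ^+ 2 - q ^+ 2.
    by case: ifP => _; ring.
  by rewrite hp hq; field.
have -> : p * ((if b < 0 then -1 else 1) * q) + (if b < 0 then -1 else 1) * q * p =
    2 * (if b < 0 then -1 else 1) * (p * q) by ring.
by rewrite hpq; case: ltrP => [/ltr0_norm ->|/ger0_norm ->]; field.
Qed.

Lemma csqrt_Re_ge0 (z : C) : 0 <= cRe (csqrt z).
Proof. exact: sqrtr_ge0. Qed.

Lemma csqrt_Re_gt0 (z : C) : cIm z != 0 -> 0 < cRe (csqrt z).
Proof.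
case: z => a b /= b0; rewrite sqrtr_gt0 divr_gt0 //.
have b2 : 0 < b ^+ 2 by rewrite lt_def sqrf_eq0 b0 sqr_ge0.
have : `|a| < Num.sqrt (a ^+ 2 + b ^+ 2).
  by rewrite -sqrtr_sqr ltr_sqrt ?ltrDl // ltr_wpDl ?sqr_ge0.
by have := ler_norm (- a); rewrite normrN; lra.
Qed.

(** From $s'^2-s^2=h$ follows $s'-s=h/(s'+s)$, and $\mathrm{Re}\,s'\ge 0$ gives
    $|s'+s|\ge\mathrm{Re}\,s>0$ for every [h], even across the branch cut. The radius 1 is therefore
    arbitrary. *)
Lemma csqrt_deriv (z : C) : cIm z != 0 ->
  quad_deriv (fun h => csqrt (h + z)) (2 * csqrt z)^-1.
Proof.
move=> z0; pose s := csqrt z; pose rho := cRe s.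
have rho0 : 0 < rho := csqrt_Re_gt0 z0.
have s0 : s != 0.
  by apply: contraTneq rho0 => e; rewrite /rho e ltxx.
exists ((2 * normc s)^-1 / rho ^+ 2), 1; split=> // h _.
rewrite add0r -/s; pose s' := csqrt (h + z).
have hs : rho <= normc (s' + s).
  apply: le_trans (normc_Re _); apply: le_trans (ler_norm _).
  by rewrite cReD -/rho lerDr csqrt_Re_ge0.
have ss : s' + s != 0.
  by rewrite -normc_eq0 gt_eqF // (lt_le_trans rho0).
have e1 : (s' - s) * (s' + s) = h.
  have : s' ^+ 2 - s ^+ 2 = h by rewrite /s' /s !csqrt_sqr addrK.
  by move=> <-; ring.
have -> : csqrt (h + z) - s - h * (2 * s)^-1 = - (h ^+ 2) / (2 * s * (s' + s) ^+ 2).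
  rewrite -/s' -e1; field; by rewrite s0 ss.
rewrite normcM normcN normcX normcV (normcM (2 * s)) (normcM 2) normcX normc_nat mulrC.
rewrite ler_wpM2r ?exprn_ge0 ?normc_ge0 // -invfM lef_pV2 ?posrE; last first.
- by rewrite !mulr_gt0 ?exprn_gt0 ?normc_gt0.
- by rewrite !mulr_gt0 ?exprn_gt0 ?normc_gt0.
rewrite ler_wpM2l ?mulr_ge0 ?normc_ge0 // lerXn2r ?nnegrE ?normc_ge0 //.
exact: ltW.
Qed.

Lemma cIm_int (z : int) : cIm (z%:~R : C) = 0.
Proof. by rewrite -toC_int. Qed.

Lemma det2 (g : 'M[int]_2) : \det g = g i0 i0 * g i1 i1 - g i0 i1 * g i1 i0.
Proof.
rewrite (expand_det_row _ i0) !big_ord_recl big_ord0 addr0 /cofactor !det_mx11 !mxE /=.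
rewrite expr0 mul1r /bump /= add0n expr1 mulN1r mulrN; congr (_ * _ - _ * _).
- by congr (g _ _); apply/val_inj.
- by congr (g _ _); apply/val_inj.
- by congr (g _ _); apply/val_inj.
Qed.

Variables (g : 'M[int]_2) (eps : bool).
Hypothesis detg : \det g = 1.
Local Notation J tau := (gc R g * tau + gd R g).

Lemma cIm_J (tau : C) : cIm (J tau) = (g i1 i0)%:~R * cIm tau.
Proof. by rewrite cImD /gc /gd cIm_int addr0 -toC_int cIm_toCM. Qed.

Lemma J_neq0 (tau : C) : inH tau -> J tau != 0.
Proof.
move=> ht; apply/eqP => h.
have c0 : g i1 i0 = 0.
  have : cIm (J tau) = 0 by rewrite h.
  rewrite cIm_J => /eqP; rewrite mulf_eq0 intr_eq0 => /orP[/eqP //|/eqP e].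
  by move: ht; rewrite /inH e ltxx.
have d0 : g i1 i1 = 0.
  by move: h; rewrite /gc /gd c0 mul0r add0r => /eqP; rewrite intr_eq0 => /eqP.
by have := detg; rewrite det2 c0 d0 !mulr0 subrr.
Qed.

Lemma det_C : ga R g * gd R g - gb R g * gc R g = 1.
Proof. by rewrite /ga /gb /gc /gd -!intrM -intrB -det2 detg. Qed.

Lemma mobius_inH (tau : C) : inH tau -> inH (mobius g tau).
Proof.
move=> ht; have J0 := J_neq0 ht; have nJ := normc_gt0 J0.
rewrite /inH /mobius.
have -> : (ga R g * tau + gb R g) / (J tau) =
   toC ((normc (J tau)) ^+ 2)^-1 * ((ga R g * tau + gb R g) * conjc (J tau)).
  have -> : (J tau)^-1 = toC ((normc (J tau)) ^+ 2)^-1 * conjc (J tau).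
    by rewrite [LHS]invc_norm cRe_normE toCV toCX.
  by rewrite mulrCA.
rewrite cIm_toCM pmulr_rgt0 ?invr_gt0 ?exprn_gt0 //.
have det' : ((g i0 i0)%:~R * (g i1 i1)%:~R - (g i0 i1)%:~R * (g i1 i0)%:~R : R) = 1.
  by rewrite -!intrM -intrB -det2 detg.
move: ht; rewrite /inH /ga /gb /gc /gd -!toC_int; case: (tau) => x y /= y0.
rewrite /toC; simpc => /=.
have -> : - (((g i0 i0)%:~R * x + (g i0 i1)%:~R) * ((g i1 i0)%:~R * y)) +
   (g i0 i0)%:~R * y * ((g i1 i0)%:~R * x + (g i1 i1)%:~R) =
   ((g i0 i0)%:~R * (g i1 i1)%:~R - (g i0 i1)%:~R * (g i1 i0)%:~R) * y :> R by ring.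
by rewrite det' mul1r.
Qed.

Lemma jfac_sqr (tau : C) : jfac g eps tau ^+ 2 = J tau.
Proof. by rewrite /jfac exprMn csqrt_sqr /sgnC; case: eps; rewrite ?sqrrN expr1n mul1r. Qed.

Lemma jfac_neq0 (tau : C) : inH tau -> jfac g eps tau != 0.
Proof. by move=> /J_neq0; rewrite -jfac_sqr sqrf_eq0. Qed.

Definition cderiv (f : C -> C) (tau D : C) : Prop :=
  is_derive (tau : C^o) (1 : C^o) (f : C^o -> C^o) D.

Lemma cderiv_eq f tau D D' : cderiv f tau D -> D = D' -> cderiv f tau D'.
Proof. by move=> h <-. Qed.

Lemma cderiv_ext f f' tau D : f =1 f' -> cderiv f tau D -> cderiv f' tau D.
Proof. by move=> /funext ->. Qed.

Lemma cderiv_uniq f tau D D' : cderiv f tau D -> cderiv f tau D' -> D = D'.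
Proof.
move=> h h'; rewrite -(@derive_val _ _ _ _ _ _ _ h).
by rewrite (@derive_val _ _ _ _ _ _ _ h').
Qed.

Lemma cderiv_near f f' tau D : inH tau -> (forall t, inH t -> f t = f' t) ->
  cderiv f tau D -> cderiv f' tau D.
Proof.
move=> ht e; apply: near_eq_is_derive.
have := near_inH ht; apply: filterS => t; exact: e.
Qed.

Lemma cderiv_cst c tau : cderiv (fun=> c) tau 0.
Proof. exact: is_derive_cst. Qed.

Lemma cderiv_id tau : cderiv id tau 1.
Proof. exact: is_derive_id. Qed.

Lemma cderiv_add f f' tau D D' : cderiv f tau D -> cderiv f' tau D' ->
  cderiv (fun t => f t + f' t) tau (D + D').
Proof. by move=> h h'; exact: (@is_deriveD _ _ _ _ _ _ _ _ _ h h'). Qed.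

Lemma cderiv_mul f f' tau D D' : cderiv f tau D -> cderiv f' tau D' ->
  cderiv (fun t => f t * f' t) tau (f tau * D' + f' tau * D).
Proof. by move=> h h'; exact: (@is_deriveM _ _ _ _ _ _ _ _ h h'). Qed.

Lemma cderiv_scale c f tau D : cderiv f tau D -> cderiv (fun t => c * f t) tau (c * D).
Proof. by move=> h; apply: cderiv_eq (cderiv_mul (cderiv_cst c tau) h) _; rewrite mulr0 addr0. Qed.

Lemma cderiv_sum k (f : 'I_k -> C -> C) tau (D : 'I_k -> C) :
  (forall i, cderiv (f i) tau (D i)) -> cderiv (fun t => \sum_i f i t) tau (\sum_i D i).
Proof.
elim: k f D => [|k IH] f D h.
  rewrite big_ord0; apply: cderiv_ext (cderiv_cst 0 tau) => t; by rewrite big_ord0.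
rewrite big_ord_recl; have := cderiv_add (h ord0) (IH _ _ (fun i => h (lift ord0 i))).
by apply: cderiv_ext => t; rewrite big_ord_recl.
Qed.

Lemma cderiv_inv f tau D : f tau != 0 -> cderiv f tau D ->
  cderiv (fun t => (f t)^-1) tau (- (f tau ^- 2) * D).
Proof.
move=> f0 h; have dv := @ex_derive _ _ _ _ _ _ _ h.
apply: DeriveDef; first exact: derivableV.
by rewrite (@deriveV C^o) // (@derive_val _ _ _ _ _ _ _ h).
Qed.

Lemma cderiv_exp f tau D k : cderiv f tau D ->
  cderiv (fun t => f t ^+ k) tau (k%:R * f tau ^+ k.-1 * D).
Proof.
move=> h; elim: k => [|k IH]; first by apply: cderiv_eq (cderiv_cst 1 tau) _; rewrite !mul0r.
apply: cderiv_ext (cderiv_eq (cderiv_mul h IH) _) => [t|]; first by rewrite exprS.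
case: k {IH} => [|k]; first by rewrite expr0 /=; ring.
by rewrite /= exprS -[k.+2%:R]natr1; ring.
Qed.

Lemma cderiv_exprz f tau D (z : int) : f tau != 0 -> cderiv f tau D ->
  cderiv (fun t => f t ^ z) tau (z%:~R * (f tau ^ z / f tau) * D).
Proof.
move=> f0 h.
have pos k : cderiv (fun t => f t ^+ k) tau (k%:R * (f tau ^+ k / f tau) * D).
  apply: cderiv_eq (cderiv_exp k h) _; congr (_ * _); case: k => [|k]; first by rewrite !mul0r.
  by rewrite exprSr mulfK.
case: z => k; first exact: pos.
have fk : f tau ^+ k.+1 != 0 by rewrite expf_neq0.
apply: (cderiv_eq (cderiv_inv (f := fun t => f t ^+ k.+1) fk (pos k.+1))).
rewrite NegzE mulrNz -[_ ^ (- _)]/((f tau ^+ k.+1)^-1).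
move: fk; set F := f tau ^+ k.+1 => fk; rewrite -[(k.+1)%:~R]/(k.+1%:R).
by move: (k.+1%:R : C) => K; field; rewrite f0 fk.
Qed.

Lemma linear_scalar (F : {linear C^o -> C^o}) (x y : C) : F (1 : C^o) = y -> F x = x * y.
Proof.
move=> <-; have -> : F x = F (x *: (1 : C^o)).
  by congr (F _); rewrite /GRing.scale /= mulr1.
exact: linearZZ.
Qed.

Lemma cderiv_comp f h tau D D' : cderiv h tau D -> cderiv f (h tau) D' ->
  cderiv (f \o h) tau (D * D').
Proof.
move=> hh hf.
have dh : differentiable (h : C^o -> C^o) (tau : C^o).
  by apply/derivable1_diffP; exact: (@ex_derive _ _ _ _ _ _ _ hh).
have df : differentiable (f : C^o -> C^o) (h tau : C^o).
  by apply/derivable1_diffP; exact: (@ex_derive _ _ _ _ _ _ _ hf).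
have dc : differentiable ((f \o h) : C^o -> C^o) (tau : C^o) := differentiable_comp dh df.
apply: DeriveDef; first by apply/derivable1_diffP.
rewrite deriveE //.
have e1 : 'd (h : C^o -> C^o) (tau : C^o) (1 : C^o) = D.
  by rewrite -(deriveE _ dh); exact: (@derive_val _ _ _ _ _ _ _ hh).
have e2 : 'd (f : C^o -> C^o) (h tau : C^o) (1 : C^o) = D'.
  by rewrite -(deriveE _ df); exact: (@derive_val _ _ _ _ _ _ _ hf).
apply: (etrans (congr1 (fun F => F (1 : C^o)) (diff_comp dh df))).
exact: (etrans (congr1 ('d (f : C^o -> C^o) (h tau : C^o)) e1) (linear_scalar D e2)).
Qed.

Lemma cderiv_J tau : cderiv (fun t => J t) tau (gc R g).
Proof.
have := cderiv_add (cderiv_scale (gc R g) (cderiv_id tau)) (cderiv_cst (gd R g) tau).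
by rewrite mulr1 addr0.
Qed.

Lemma cderiv_mobius tau : inH tau -> cderiv (mobius g) tau (J tau ^- 2).
Proof.
move=> ht; have J0 := J_neq0 ht.
have h1 := cderiv_add (cderiv_scale (ga R g) (cderiv_id tau)) (cderiv_cst (gb R g) tau).
have h2 := cderiv_inv (f := fun t => J t) J0 (cderiv_J tau).
apply: cderiv_eq (cderiv_mul h1 h2) _ => /=.
rewrite mulr1 addr0 -[RHS]mul1r -det_C.
by field.
Qed.

Lemma cderiv_jfac tau : inH tau -> cderiv (jfac g eps) tau (gc R g / (2 * jfac g eps tau)).
Proof.
move=> ht; have J0 := J_neq0 ht; have j0 := jfac_neq0 ht.
rewrite /jfac; set e := sgnC R eps.
(* For $c=0$ the argument of the root is the constant $d=\pm1$, possibly on the branch cut, but then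
   nothing varies. Otherwise it has nonzero imaginary part. *)
have [c0|c0] := eqVneq (g i1 i0) 0.
  have c0' : gc R g = 0 by rewrite /gc c0.
  rewrite c0' mul0r; apply: cderiv_ext (cderiv_cst (e * csqrt (gd R g)) tau) => t.
  by rewrite mul0r add0r.
have z0 : cIm (J tau) != 0.
  by rewrite cIm_J mulf_neq0 ?intr_eq0 // gt_eqF.
have h : cderiv (@csqrt R) (J tau) (2 * csqrt (J tau))^-1.
  apply: quad_is_derive; have [M [r [r0 hM]]] := csqrt_deriv z0.
  exists M, r; split=> // u hu.
  have ee (v : C) : v *: (1 : C^o) + (J tau : C^o) = v + J tau by rewrite /GRing.scale /= mulr1.
  by rewrite !ee; exact: hM.
have h1 := cderiv_scale e (cderiv_comp (cderiv_J tau) h).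
apply: cderiv_eq h1 _.
have ee : e * e = 1 by rewrite /e /sgnC; case: eps; ring.
have e0 : e != 0 by apply/eqP => e0; move: ee; rewrite e0 mul0r => /eqP; rewrite eq_sym oner_eq0.
have s0 : csqrt (J tau) != 0 by apply: contra j0 => /eqP s0; rewrite /jfac s0 mulr0.
have -> : gc R g / (2 * (e * csqrt (J tau))) = e * e * (gc R g / (2 * (e * csqrt (J tau)))).
  by rewrite ee mul1r.
by move: (csqrt _) s0 => s s0; field; rewrite e0 s0.
Qed.

(* [f] slashed in weight [k2 / 2 + p]. *)
Definition wslash (k2 : int) (p : nat) (f : C -> C) (tau : C) : C :=
  jfac g eps tau ^ (- k2) * J tau ^- p * f (mobius g tau).

(** The logarithmic derivative of [jfac] is $c/(2J)$ with $J=c\tau+d$, so the exponent $-k_2$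
    contributes $-kc/J$ with $k=k_2/2$, exactly as for an integral weight. The inner derivative
    $J^{-2}$ of the Moebius map raises the exponent of $J$ by two. *)
Lemma cderiv_wslash k2 p f df tau : inH tau -> cderiv f (mobius g tau) (df (mobius g tau)) ->
  cderiv (wslash k2 p f) tau
    (- ((k2%:~R / 2 + p%:R) * gc R g) * wslash k2 p.+1 f tau + wslash k2 p.+2 df tau).
Proof.
move=> ht hf; have J0 := J_neq0 ht; have j0 := jfac_neq0 ht.
have h1 := cderiv_exprz (- k2) j0 (cderiv_jfac ht).
have h2 := cderiv_exprz (f := fun t => J t) (- p%:Z) J0 (cderiv_J tau).
have h3 := cderiv_comp (cderiv_mobius ht) hf.
apply: (cderiv_ext (f := fun t => jfac g eps t ^ (- k2) * J t ^ (- p%:Z) * (f \o mobius g) t)).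
  by move=> t; rewrite /wslash -exprnN.
apply: cderiv_eq (cderiv_mul (cderiv_mul h1 h2) h3) _ => /=.
rewrite /wslash -!exprnN !mulrNz.
have -> : gc R g / (2 * jfac g eps tau) = gc R g * jfac g eps tau / (2 * J tau).
  by rewrite -jfac_sqr; field.
move: (J tau) J0 => J' J0.
rewrite [J' ^+ p.+2]exprS [J' ^+ p.+1]exprS.
have q0 : J' ^+ p != 0 by rewrite expf_neq0.
move: (J' ^+ p) q0 => q q0.
move: (jfac g eps tau ^ (- k2)) (jfac g eps tau) j0 => w j j0.
rewrite -[p%:Z%:~R]/(p%:R); move: (p%:R : C) => y.
by field; rewrite J0 q0 j0.
Qed.

(* The [r]-th derivative of [wslash k2 p (f 0)] when [f i] is the [i]-th derivative of [f 0]. *)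
Definition wslashD (k2 : int) (p : nat) (f : nat -> C -> C) (r : nat) (tau : C) : C :=
  \sum_(i < r.+1) 'C(r, i)%:R * (- gc R g) ^+ (r - i) *
       poch (k2%:~R / 2 + p%:R + i%:R) (r - i) * wslash k2 (p + r + i) (f i) tau.

Lemma cderiv_wslashD k2 p (f : nat -> C -> C) r tau :
  (forall s tau, inH tau -> cderiv (f s) tau (f s.+1 tau)) -> inH tau ->
  cderiv (wslashD k2 p f r) tau (wslashD k2 p f r.+1 tau).
Proof.
move=> hf ht.
have h' (i : 'I_r.+1) := cderiv_scale ('C(r, i)%:R * (- gc R g) ^+ (r - i) *
       poch (k2%:~R / 2 + p%:R + i%:R) (r - i))
  (cderiv_wslash k2 (p + r + i) ht (hf i _ (mobius_inH ht))).
apply: cderiv_eq (cderiv_sum h') _; rewrite /wslashD {h'}.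
set k : C := k2%:~R / 2.
under eq_bigr do rewrite mulrDr.
rewrite big_split /=.
rewrite [RHS]big_ord_recl /= [X in X + _]big_ord_recl /= [X in _ + X]big_ord_recr /=.
rewrite [X in _ = _ + X]big_ord_recr /=.
rewrite addrA [RHS]addrA; congr (_ + _); last first.
  rewrite /bump /= !add1n !subnn !binn !expr0 !poch0 !mul1r.
  by congr (wslash _ _ _ _); lia.
rewrite -!addrA; congr (_ + _).
  rewrite !bin0 !subn0 !addn0 !mul1r exprS pochS addnS natrD !addr0.
  by move: (wslash _ _ _ _) => W; ring.
rewrite -big_split /=; apply: eq_bigr => i _.
rewrite /bump /= !add1n.
have ir : (i < r)%N := ltn_ord i.
have -> : (p + r + i.+1).+1 = (p + r.+1 + i.+1)%N by lia.
have -> : (p + r + i).+2 = (p + r.+1 + i.+1)%N by lia.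
move: (wslash _ _ _ _) => W; rewrite subSS.
have -> : (r - i = (r - i.+1).+1)%N by lia.
have e1 : poch (k + p%:R + i%:R) (r - i.+1).+1 =
    (k + p%:R + i%:R) * poch (k + p%:R + i.+1%:R) (r - i.+1).
  by rewrite pochSl -[i.+1%:R]natr1 addrA.
rewrite e1 pochS binS (natrD _ 'C(r, i.+1) 'C(r, i)) exprS.
(* Differentiating the automorphy factor contributes $k+p+r+i+1$, while the rising factorial wanted
   at order $r+1$ ends with $k+p+r$. This identity turns the excess $i+1$ on $\binom{r}{i+1}$ into
   the $r-i$ that $\binom{r}{i}$ lacks, since it comes with $k+p+i$ only. *)
have b : (i.+1)%:R * 'C(r, i.+1)%:R = ((r - i.+1).+1)%:R * 'C(r, i)%:R :> C.
  by rewrite -!natrM mul_bin_left; congr (_ * _)%:R; lia.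
have e2 : (p + r + i.+1)%:R = p%:R + (r - i.+1)%:R + i.+1%:R + i.+1%:R :> C.
  by rewrite -!natrD; congr (_%:R); lia.
rewrite e2; move: b; rewrite -[(r - i.+1).+1%:R]natr1 -[i.+1%:R]natr1.
move: ('C(r, i)%:R : C) ('C(r, i.+1)%:R : C) ((r - i.+1)%:R : C) (i%:R : C) (p%:R : C) => b0 b1 q x y b.
move: (poch _ _) (gc R g ) (_ ^+ (r - i.+1)) => P c0 cc.
have -> : - ((k + (y + q + (x + 1) + (x + 1))) * c0) * W = - c0 * (k + y + q + (x + 1)) * W + - c0 * (x + 1) * W.
  by ring.
have -> : b1 * cc * P * (- c0 * (k + y + q + (x + 1)) * W + - c0 * (x + 1) * W) =
   b1 * cc * P * (- c0 * (k + y + q + (x + 1)) * W) - ((x + 1) * b1) * cc * P * c0 * W by ring.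
by rewrite b; ring.
Qed.

End Mobius.

(** * Covariance of the combinations of Taylor coefficients on a line *)

Section Covariance.
Variable R : realType.
Local Notation C := R[i].
Variables (g : 'M[int]_2) (eps : bool).
Hypothesis detg : \det g = 1.
Variables (k2 : int) (kap : C).
Let k : C := k2%:~R / 2.

Lemma sum_shift (lam r : nat) (F : nat -> C) : (r <= lam)%N ->
  \sum_(N < lam.+1 | (r <= N)%N) F N = \sum_(mu < (lam - r).+1) F (mu + r)%N.
Proof.
move=> rl; have -> : \sum_(mu < (lam - r).+1) F (mu + r)%N = \sum_(0 + r <= N < lam.+1) F N.
  by rewrite big_addn subSn // big_mkord.
by rewrite add0n big_geq_mkord.
Qed.

Section Inner.
Variables (s lam : nat).
Hypothesis lamE : lam = (s %/ 2)%N.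
Let u : C := k + s%:R - 1 - lam%:R.

(* The coefficient of [W N i] in the expansion of [Dline Y] through the transformation law of the
   Taylor coefficients: only the [i = N] term survives, as the sum over [r] is an alternating
   binomial sum of a polynomial of degree [< N - i] in [r]. *)
Lemma inner_cancel (N i : nat) : (i <= N)%N -> (N <= lam)%N ->
  \sum_(r < lam.+1 | (r <= N)%N && (i <= r)%N)
     poch u (lam - r) * kap ^+ r / r`!%:R *
     ((kap * gc R g) ^+ (N - r) / (N - r)`!%:R *
      ('C(r, i)%:R * (- gc R g) ^+ (r - i) * poch (k + (s - r - N)%:R + i%:R) (r - i))) =
  if N == i then poch u (lam - N) * kap ^+ N / N`!%:R else 0.
Proof.
move=> iN Nl; pose M := (N - i)%N; pose c := gc R g.
set F := fun r : nat => poch u (lam - r) * kap ^+ r / r`!%:R *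
     ((kap * c) ^+ (N - r) / (N - r)`!%:R *
      ('C(r, i)%:R * (- c) ^+ (r - i) * poch (k + (s - r - N)%:R + i%:R) (r - i))).
transitivity (\sum_(t < M.+1) F (t + i)%N).
  have -> : \sum_(t < M.+1) F (t + i)%N = \sum_(0 + i <= r < N.+1) F r.
    by rewrite big_addn subSn // big_mkord.
  rewrite add0n big_geq_mkord (big_ord_widen_cond lam.+1 (fun r => true && (i <= r)%N) F) //.
  by apply: eq_bigl => r; rewrite /= ltnS andbC.
transitivity (kap ^+ N * c ^+ M / (i`!%:R * M`!%:R) *
   \sum_(t < M.+1) (-1) ^+ t * 'C(M, t)%:R *
     (poch u ((lam - i) - t) * poch (u + ((lam - i) - M).+1%:R - t%:R) t)).
  rewrite mulr_sumr; apply: eq_bigr => t _.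
  have tM : (t <= M)%N by rewrite -ltnS.
  rewrite /F addnK.
  have -> : (N - (t + i) = M - t)%N by rewrite /M; lia.
  have -> : (lam - (t + i) = lam - i - t)%N by lia.
  have -> : k + (s - (t + i) - N)%:R + i%:R = u + (lam - i - M).+1%:R - t%:R.
    rewrite /u -[(lam - i - M).+1%:R]natr1.
    have -> : (lam - i - M = lam - N)%N by rewrite /M; lia.
    rewrite [(lam - N)%:R]natrB // !natrB //; first last.
    - by lia.
    - by rewrite lamE in Nl; lia.
    by rewrite natrD; ring.
  have -> : kap ^+ N = kap ^+ (t + i) * kap ^+ (M - t).
    by rewrite -exprD; congr (_ ^+ _); rewrite /M in tM *; lia.
  have -> : c ^+ M = c ^+ t * c ^+ (M - t) by rewrite -exprD subnKC.
  rewrite exprMn (exprNn c).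
  have bt := bin_fact tM; have bi := bin_fact (leq_addl t i).
  rewrite addnK in bi.
  move: (poch _ _) (poch _ _) => p1 p2.
  have -> : (M`!%:R : C) = 'C(M, t)%:R * (t`!%:R * (M - t)`!%:R) by rewrite -bt !natrM.
  have -> : ((t + i)`!%:R : C) = 'C(t + i, i)%:R * (i`!%:R * t`!%:R) by rewrite -bi !natrM.
  have b1 : ('C(M, t)%:R : C) != 0 by rewrite pnatr_eq0 -lt0n bin_gt0.
  have b2 : ('C(t + i, i)%:R : C) != 0 by rewrite pnatr_eq0 -lt0n bin_gt0 leq_addl.
  have := natC_fact_neq0 R t; have := natC_fact_neq0 R i; have := natC_fact_neq0 R (M - t).
  move: (t`!%:R : C) (i`!%:R : C) ((M - t)`!%:R : C) b1 b2 => f1 f2 f3 b1 b2 n3 n2 n1.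
  move: (_ ^+ (t + i)) (_ ^+ (M - t)) (_ ^+ t) (c ^+ (M - t)) (c ^+ t) => x1 x2 x3 x4 x5.
  by field; rewrite n1 n2 n3 b1 b2.
rewrite poch_cancel; last by rewrite /M; lia.
have -> : (M == 0%N) = (N == i) by rewrite /M; lia.
case: eqP => [e|_]; last by rewrite mulr0.
by rewrite /M e subnn fact0 expr0 !mulr1; ring.
Qed.

End Inner.

Variables X Y : nat -> nat -> C -> C.
Hypothesis hX : forall s r tau, inH tau -> cderiv (X s r) tau (X s r.+1 tau).
Hypothesis hY : forall s r tau, inH tau -> cderiv (Y s r) tau (Y s r.+1 tau).
(** The exponent $s-\mu$ of $J=c\tau+d$ has two sources: $J^{-(s-2\mu)}$ from replacing $w$ by $w/J$
    in the Taylor series, and $J^{-\mu}$ from the $\mu$-th term of $\exp(\kappa cw^2/J)$. *)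
Hypothesis hXY : forall s tau, inH tau -> Y s 0%N tau =
  \sum_(mu < (s %/ 2).+1) (kap * gc R g) ^+ mu / mu`!%:R *
     wslash g eps k2 (s - mu) (X (s - 2 * mu) 0%N) tau.

Lemma Y_der s r tau : inH tau -> Y s r tau =
  \sum_(mu < (s %/ 2).+1) (kap * gc R g) ^+ mu / mu`!%:R *
     wslashD g eps k2 (s - mu) (X (s - 2 * mu)) r tau.
Proof.
move: tau; elim: r => [|r IH] tau ht.
  rewrite hXY //; apply: eq_bigr => mu _; congr (_ * _).
  by rewrite /wslashD big_ord1 bin0 subn0 expr0 poch0 !addn0 !mul1r.
have h := cderiv_near ht IH (hY s r ht).
have h' (mu : 'I_(s %/ 2).+1) := cderiv_scale ((kap * gc R g) ^+ mu / mu`!%:R)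
  (cderiv_wslashD eps detg k2 (s - mu) r (hX (s - 2 * mu)) ht).
exact: cderiv_uniq h (cderiv_sum h').
Qed.

(* For [Z s r = line_coef x s r] and [kap = line_kappa x] this is, up to the factor [4 ^ lam lam!],
   the polynomial [sum_p x ^ p D_{k,p} phi] over the [p] with [s(p) = s]. *)
Definition Dline (Z : nat -> nat -> C -> C) (s : nat) (tau : C) : C :=
  \sum_(r < (s %/ 2).+1) poch (k + s%:R - 1 - (s %/ 2)%N%:R) (s %/ 2 - r) * kap ^+ r / r`!%:R *
    Z (s - 2 * r)%N r tau.

(** With $N=r+\mu$, the $i$-th derivative of the coefficient of degree $s-2N$ occurs for all [r]
    with $i\le r\le N$. Summing over [r] innermost leaves $i=N$, and there the slash exponent
    $s-N+i$ equals [s]. *)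
Lemma Dline_cov s tau : inH tau -> Dline Y s tau = wslash g eps k2 s (Dline X s) tau.
Proof.
move=> ht; set lam := (s %/ 2)%N; pose u : C := k + s%:R - 1 - lam%:R.
have lamE : lam = (s %/ 2)%N by [].
pose co r N i : C := poch u (lam - r) * kap ^+ r / r`!%:R *
     ((kap * gc R g) ^+ (N - r) / (N - r)`!%:R *
      ('C(r, i)%:R * (- gc R g) ^+ (r - i) * poch (k + (s - r - N)%:R + i%:R) (r - i))).
pose W N i := wslash g eps k2 (s - N + i) (X (s - 2 * N) i) tau.
transitivity (\sum_(r < lam.+1) \sum_(N < lam.+1 | (r <= N)%N) \sum_(i < lam.+1 | (i <= r)%N) co r N i * W N i).
  rewrite /Dline -/lam -/u; apply: eq_bigr => r _; have rl : (r <= lam)%N by rewrite -ltnS.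
  rewrite Y_der // mulr_sumr.
  have -> : ((s - 2 * r) %/ 2 = lam - r)%N by rewrite /lam; lia.
  rewrite (sum_shift (fun N => \sum_(i < lam.+1 | (i <= r)%N) co r N i * W N i) rl).
  apply: eq_bigr => mu _; have ml : (mu <= lam - r)%N by rewrite -ltnS.
  rewrite /wslashD (big_ord_widen_cond lam.+1 xpredT (fun i => 'C(r, i)%:R * (- gc R g) ^+ (r - i) *
       poch (k2%:~R / 2 + (s - 2 * r - mu)%:R + i%:R) (r - i) *
       wslash g eps k2 (s - 2 * r - mu + r + i) (X (s - 2 * r - 2 * mu) i) tau)) //.
  rewrite !mulr_sumr; apply: eq_big => [i|i _]; first by rewrite /= ltnS.
  rewrite /co /W addnK -/k.
  have -> : (s - r - (mu + r) = s - 2 * r - mu)%N by lia.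
  have -> : (s - (mu + r) + i = s - 2 * r - mu + r + i)%N by move: ml rl; rewrite /lam; lia.
  have -> : (s - 2 * (mu + r) = s - 2 * r - 2 * mu)%N by lia.
  by move: (wslash _ _ _ _) => w; rewrite !mulrA.
rewrite (exchange_big_dep xpredT) //=.
transitivity (\sum_(N < lam.+1) poch u (lam - N) * kap ^+ N / N`!%:R * W N N); last first.
  rewrite /wslash /Dline mulr_sumr; apply: eq_bigr => N _.
  have Nl : (N <= lam)%N by rewrite -ltnS.
  rewrite /W /wslash subnK; last by move: Nl; rewrite /lam; lia.
  by rewrite -/lam -/u mulrCA mulrA.
apply: eq_bigr => N _; have Nl : (N <= lam)%N by rewrite -ltnS.
rewrite (exchange_big_dep (fun i : 'I_lam.+1 => (i <= N)%N)) /=; last first.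
  by move=> r i rN ir; exact: leq_trans ir rN.
rewrite (bigD1 N) //= [X in _ + X]big1 ?addr0 => [|i /andP[iN iN']].
  by rewrite -mulr_suml (inner_cancel lamE (leqnn N) Nl) eqxx.
rewrite -mulr_suml (inner_cancel lamE iN Nl).
case: eqP => [e|_]; last by rewrite mul0r.
by case/negP: iN'; apply/eqP/val_inj.
Qed.

End Covariance.

(** * The generating polynomial of the $D_{k,p}$ with $s(p)$ fixed *)

Section LinePolynomial.
Variable R : realType.
Local Notation C := R[i].
Variables (n : nat) (Bm E : 'M[R]_n) (k2 : int) (x : 'I_n -> C).
Let k : C := k2%:~R / 2.

Definition toN s (q : {ffun 'I_n -> 'I_s.+1}) : {ffun 'I_n -> nat} := [ffun l => q l : nat].

(** This is $-2\pi i\,Q(\sum_l x_le_l)$, as [QC_line] shows; it is spelled out by Gram matrix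
    entries so that the multinomial theorem expands its powers. *)
Definition line_kappa : C :=
  \sum_(ij : 'I_n * 'I_n) (- piC R * iC R * toC ((E *m Bm *m E^T) ij.1 ij.2)) * (x ij.1 * x ij.2).

Lemma prod_piL lam (L : {ffun 'I_n * 'I_n -> 'I_lam.+1}) :
  \prod_l x l ^+ piL L l = \prod_ij (x ij.1 * x ij.2) ^+ L ij.
Proof.
under eq_bigr do rewrite /piL exprD !expr_sum.
rewrite big_split /= [X in _ * X]exchange_big /= !pair_big /= -big_split /=.
by apply: eq_bigr => -[i j] _; rewrite /= exprMn.
Qed.

Lemma sum_piL lam (L : {ffun 'I_n * 'I_n -> 'I_lam.+1}) :
  (\sum_l piL L l = 2 * sumL L)%N.
Proof.
rewrite /piL big_split /= [X in (_ + X)%N]exchange_big /= !pair_big /= /sumL mul2n -addnn.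
by congr (_ + _)%N; apply: eq_bigr => -[].
Qed.

Lemma sum_exp_moment s (b : 'I_n -> R) N : (s <= N)%N ->
  \sum_(q : {ffun 'I_n -> 'I_N.+1} | (\sum_l (q l : nat) == s)%N)
     (\prod_l x l ^+ q l) * exp_moment b (toN q) =
  (\sum_l tpi R * toC (b l) * x l) ^+ s / s`!%:R.
Proof.
move=> sN; rewrite -(multinomial _ sN); apply: eq_bigr => q _.
rewrite /exp_moment -big_split /=; apply: eq_bigr => l _.
by rewrite ffunE [in RHS]exprMn; ring.
Qed.

Lemma sum_shift_exp_moment s (b : 'I_n -> R) lam (L : {ffun 'I_n * 'I_n -> 'I_lam.+1}) :
  (2 * sumL L <= s)%N ->
  \sum_(q : {ffun 'I_n -> 'I_s.+1} | (\sum_l (q l : nat) == s)%N)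
     (\prod_l x l ^+ q l) * (if [forall l, (piL L l <= toN q l)%N] then
         exp_moment b [ffun l => (toN q l - piL L l)%N] else 0) =
  (\prod_l x l ^+ piL L l) *
    ((\sum_l tpi R * toC (b l) * x l) ^+ (s - 2 * sumL L) / (s - 2 * sumL L)`!%:R).
Proof.
move=> Ls.
transitivity (\sum_(q : {ffun 'I_n -> 'I_s.+1} | (\sum_l (q l : nat) == s)%N &&
    [forall l, (piL L l <= toN q l)%N])
     (\prod_l x l ^+ q l) * exp_moment b [ffun l => (toN q l - piL L l)%N]).
  by rewrite [RHS]big_mkcondr; apply: eq_bigr => q _; case: ifP => // _; rewrite mulr0.
(* Here [inord] is only a cast: $\pi(\Lambda)$ has total $2s(\Lambda)$, so the shifted exponents
   have total [s] and stay in range. *)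
pose h (q : {ffun 'I_n -> 'I_s.+1}) : {ffun 'I_n -> 'I_s.+1} := [ffun l => inord (q l + piL L l)].
pose h' (q : {ffun 'I_n -> 'I_s.+1}) : {ffun 'I_n -> 'I_s.+1} := [ffun l => inord (q l - piL L l)].
rewrite (reindex_onto h h') /=; last first.
  move=> q /andP[_ /forallP pq]; apply/ffunP => l; apply/val_inj.
  have pl : (piL L l <= q l)%N by have := pq l; rewrite ffunE.
  have ql := ltn_ord (q l).
  by rewrite /= !ffunE !inordK ?subnK //; lia.
rewrite -(@sum_exp_moment _ b s (leq_subr _ _)) mulr_sumr.
have hE (q : {ffun 'I_n -> 'I_s.+1}) : (\sum_l (q l : nat) = s - 2 * sumL L)%N ->
    forall l, (h q l : nat) = (q l + piL L l)%N.
  move=> e l; rewrite ffunE inordK // ltnS.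
  have : (\sum_l (q l + piL L l) = s)%N by rewrite big_split /= sum_piL e subnK.
  move=> sE; have : (q l + piL L l <= \sum_l0 (q l0 + piL L l0))%N.
    by rewrite (bigD1 l) //= leq_addr.
  by rewrite sE.
apply: eq_big => [q|q /andP[/andP[qs pq] hq]].
  apply/idP/idP => [/andP[/andP[/eqP qs /forallP pq] /eqP hq]|/eqP qs].
    have e l : (h q l : nat) = (q l + piL L l)%N.
      have := pq l; rewrite ffunE => pl.
      have := congr1 (fun f : {ffun 'I_n -> 'I_s.+1} => f l : nat) hq.
      rewrite /= ffunE inordK; last by have := ltn_ord (h q l); lia.
      by move=> <-; rewrite subnK.
    apply/eqP; move: qs; under eq_bigr do rewrite e.
    by rewrite big_split /= sum_piL; lia.
  have e := hE q qs; apply/andP; split; [apply/andP; split|].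
  - by under eq_bigr do rewrite e; rewrite big_split /= sum_piL qs subnK.
  - by apply/forallP => l; rewrite ffunE e leq_addl.
  - by apply/eqP/ffunP => l; apply/val_inj; rewrite ffunE /= e addnK inordK.
have qs' : (\sum_l (q l : nat) = s - 2 * sumL L)%N.
  move/eqP: qs.
  have e l : (h q l : nat) = (q l + piL L l)%N.
    have /forallP /(_ l) := pq; rewrite ffunE => pl.
    have := congr1 (fun f : {ffun 'I_n -> 'I_s.+1} => f l : nat) (eqP hq).
    rewrite /= ffunE inordK; last by have := ltn_ord (h q l); lia.
    by move=> <-; rewrite subnK.
  under eq_bigr do rewrite e.
  by rewrite big_split /= sum_piL; lia.
rewrite [RHS]mulrA -[X in _ = X * _]big_split /=; congr (_ * _).
  by apply: eq_bigr => l _; rewrite (hE q qs') exprD mulrC.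
congr exp_moment; apply/ffunP => l; rewrite !ffunE.
by rewrite -[X in (X - _)%N = _]/(val (inord (q l + piL L l) : 'I_s.+1)); have := hE q qs' l; rewrite ffunE => /= ->; rewrite addnK.
Qed.

(** Writing $x^p=x^{\pi(\Lambda)}x^{p-\pi(\Lambda)}$ separates the two sums. The multinomial theorem
    over the $\Lambda$ with $s(\Lambda)=r$ gives $\kappa^r/r!$, and over the shifted exponents it
    gives the divided power of degree $s-2r$ of the linear form. *)
Lemma Dk_term_line s a (b : 'I_n -> R) (lam := (s %/ 2)%N) :
  \sum_(q : {ffun 'I_n -> 'I_s.+1} | (\sum_l (q l : nat) == s)%N)
     (\prod_l x l ^+ q l) * Dk_term Bm E k2 (toN q) a b =
  4 ^+ lam * lam`!%:R * \sum_(r < lam.+1)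
    poch (k + s%:R - 1 - lam%:R) (lam - r) * line_kappa ^+ r / r`!%:R *
    ((tpi R * toC a) ^+ r *
     ((\sum_l tpi R * toC (b l) * x l) ^+ (s - 2 * r) / (s - 2 * r)`!%:R)).
Proof.
have ms (q : {ffun 'I_n -> 'I_s.+1}) : (\sum_l (q l : nat) == s)%N -> mi_sum (toN q) = s.
  by move=> /eqP {2}<-; apply: eq_bigr => l _; rewrite ffunE.
pose co (L : {ffun 'I_n * 'I_n -> 'I_lam.+1}) : C :=
  \prod_ij ((- piC R * iC R * toC ((E *m Bm *m E^T) ij.1 ij.2)) ^+ L ij / ((L ij)`!)%:R).
transitivity (\sum_(q : {ffun 'I_n -> 'I_s.+1} | (\sum_l (q l : nat) == s)%N)
   (\prod_l x l ^+ q l) * ((4 ^+ lam * lam`!%:R) *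
   \sum_(L : {ffun 'I_n * 'I_n -> 'I_lam.+1} | (sumL L <= lam)%N)
     co L * poch (k + s%:R - 1 - lam%:R) (lam - sumL L) *
     ((tpi R * toC a) ^+ sumL L * (if [forall l, (piL L l <= toN q l)%N] then
         exp_moment b [ffun l => (toN q l - piL L l)%N] else 0)))).
  apply: eq_bigr => q qs; congr (_ * _); rewrite /Dk_term ms // -/lam.
  congr (_ * _); apply: eq_bigr => L Ls; congr (_ * _ * _).
  by rewrite prodk_poch.
under eq_bigr do rewrite mulrCA mulr_sumr.
rewrite -mulr_sumr; congr (_ * _); rewrite exchange_big /=.
transitivity (\sum_(L : {ffun 'I_n * 'I_n -> 'I_lam.+1} | (sumL L <= lam)%N)
   (\prod_ij (((- piC R * iC R * toC ((E *m Bm *m E^T) ij.1 ij.2)) * (x ij.1 * x ij.2)) ^+ L ij / ((L ij)`!)%:R)) *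
   (poch (k + s%:R - 1 - lam%:R) (lam - sumL L) * ((tpi R * toC a) ^+ sumL L *
    ((\sum_l tpi R * toC (b l) * x l) ^+ (s - 2 * sumL L) / (s - 2 * sumL L)`!%:R)))).
  apply: eq_bigr => L Ls.
  have L2 : (2 * sumL L <= s)%N by move: Ls; rewrite /lam; lia.
  have -> : \prod_ij (((- piC R * iC R * toC ((E *m Bm *m E^T) ij.1 ij.2)) * (x ij.1 * x ij.2)) ^+ L ij / ((L ij)`!)%:R)
     = co L * \prod_l x l ^+ piL L l.
    by rewrite prod_piL -big_split /=; apply: eq_bigr => ij _; rewrite exprMn mulrAC.
  rewrite -[RHS]mulrA [X in _ = _ * X]mulrCA [X in _ = _ * (_ * X)]mulrCA.
  rewrite -(sum_shift_exp_moment b L2) !mulr_sumr; apply: eq_bigr => q _.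
  set m' := if _ then _ else _; move: (poch _ _) (co L) (\prod_l _) (_ ^+ sumL L) m' => A B D F G.
  by ring.
rewrite (partition_big (fun L => inord (sumL L) : 'I_lam.+1) xpredT) //=.
apply: eq_bigr => r _; have rl : (r <= lam)%N by rewrite -ltnS.
rewrite -[poch _ _ * _ / _]mulrA [poch _ _ * (_ / _)]mulrC /line_kappa -(multinomial _ rl) -[RHS]mulrA mulr_suml.
apply: eq_big => [L|L /andP[Ls /eqP rE]].
  apply/andP/eqP => [[Ls /eqP <-]|e]; first by rewrite inordK.
  by rewrite /sumL e rl; split=> //; apply/eqP/val_inj; rewrite /= inordK.
have -> : sumL L = r by rewrite -rE inordK.
by congr (_ * _).
Qed.

End LinePolynomial.

(** * Taylor expansion along a complex line *)

Section LineSeries.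
Variable R : realType.
Local Notation C := R[i].
Variables (n : nat) (I : eqType).

Lemma abs_add_same (u v : R) : 0 <= u * v -> `|u| + `|v| <= `|u + v|.
Proof.
move=> h; have [u0|u0] := lerP 0 u; have [v0|v0] := lerP 0 v.
- by rewrite !ger0_norm ?addr_ge0.
- have u1 : u = 0 by apply: le_anti; rewrite u0 andbT; nra.
  by rewrite u1 normr0 !add0r ltr0_norm.
- have v1 : v = 0 by apply: le_anti; rewrite v0 andbT; nra.
  by rewrite v1 normr0 !addr0 ltr0_norm.
- by rewrite ltr0_norm ?ler0_norm; lra.
Qed.

Variables (c : I -> C) (a : I -> R) (b : I -> 'I_n -> R) (f : C -> 'rV[C]_n -> C).
Hypothesis hf : forall tau (x : 'rV[C]_n), inH tau ->
  hsum (fun i => c i * ee (toC (a i) * tau + \sum_l toC (b i l) * x 0 l)) (f tau x).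

(** Convergence at $\pm i$ times a real vector [y] dominates $e^{2\pi|\sum_l b_ly_l|}$. Two choices
    of [y], the sum and the difference of the real and imaginary parts of [w *: x], suffice to
    dominate the complex linear form. *)
Lemma line_abssum (tau w : C) (x : 'rV[C]_n) : inH tau ->
  abssum (fun i => c i * ee (toC (a i) * tau) *
    toC (expR (normc (w * \sum_l tpi R * toC (b i l) * x 0 l)))).
Proof.
move=> ht.
have real_case (y : 'rV[R]_n) : abssum (fun i => c i * ee (toC (a i) * tau) *
    toC (expR (2 * pi * `|\sum_l b i l * y 0 l| * 1))).
  have h (s : R) : abssum (fun i => c i * ee (toC (a i) * tau) *
      ee (toC (\sum_l b i l * y 0 l) * (iC R * toC s))).
    apply: (hsum_abssum (s := f tau (map_mx (fun t => toC t * (iC R * toC s)) y))).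
    apply: eq_hsum (hf _ ht) => i; rewrite -mulrA -eeD; congr (_ * ee (_ + _)).
    rewrite toC_sum mulr_suml; apply: eq_bigr => l _.
    by rewrite mxE toCM mulrA.
  by apply: abssum_exp_abs; exact: h.
pose x' : 'rV[C]_n := w *: x.
pose y1 : 'rV[R]_n := \row_l (cRe (x' 0 l) + cIm (x' 0 l)).
pose y2 : 'rV[R]_n := \row_l (cRe (x' 0 l) - cIm (x' 0 l)).
have [K1 h1] := real_case y1; have [K2 h2] := real_case y2.
exists (K1 + K2) => F uF; apply: le_trans (lerD (h1 F uF) (h2 F uF)).
rewrite -big_split /=; apply: ler_sum => i _.
rewrite !(normcM (_ * _) (toC _)) -mulrDr ler_wpM2l ?normc_ge0 // !normc_toC.
have ex (t : R) : `|expR t| = expR t by rewrite ger0_norm ?expR_ge0.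
rewrite !ex !mulr1.
pose z : C := \sum_l toC (b i l) * x' 0 l.
have -> : w * (\sum_l tpi R * toC (b i l) * x 0 l) = tpi R * z.
  rewrite /z !mulr_sumr; apply: eq_bigr => l _; rewrite mxE.
  by move: (tpi R) => T; ring.
have e1 : \sum_l b i l * y1 0 l = cRe z + cIm z.
  rewrite /z cRe_sum cIm_sum -big_split; apply: eq_bigr => l _ /=.
  by rewrite mxE cRe_toCM cIm_toCM mulrDr.
have e2 : \sum_l b i l * y2 0 l = cRe z - cIm z.
  rewrite /z cRe_sum cIm_sum -sumrB; apply: eq_bigr => l _ /=.
  by rewrite mxE cRe_toCM cIm_toCM mulrBr.
rewrite e1 e2 (normcM (tpi R)) normc_tpi.
have p0 : 0 <= 2 * pi :> R by rewrite mulr_ge0 ?pi_ge0.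
(* $|z|\le|\mathrm{Re}\,z|+|\mathrm{Im}\,z|$, and the right side is the absolute value of the sum or
   of the difference, according to the sign of the product of the two parts. *)
have mx : normc z <= `|cRe z + cIm z| \/ normc z <= `|cRe z - cIm z|.
  have [h|h] := lerP 0 (cRe z * cIm z); [left|right]; apply: le_trans (normc_le z) _.
    by apply: abs_add_same.
  by rewrite -[`|cIm z|]normrN; apply: abs_add_same; rewrite mulrN oppr_ge0 ltW.
have E1 := expR_ge0 (2 * pi * `|cRe z + cIm z|).
have E2 := expR_ge0 (2 * pi * `|cRe z - cIm z|).
case: mx => h.
  apply: (@le_trans _ _ (expR (2 * pi * `|cRe z + cIm z|))); last lra.
  by rewrite ler_expR ler_wpM2l.
apply: (@le_trans _ _ (expR (2 * pi * `|cRe z - cIm z|))); last lra.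
by rewrite ler_expR ler_wpM2l.
Qed.

(* The [r]-th tau-derivative of the coefficient of [w ^ s] in [w |-> f tau (w x)]. *)
Definition line_coef (x : 'rV[C]_n) (s r : nat) (tau : C) : C :=
  tsum (fun i => c i * ((tpi R * toC (a i)) ^+ r *
    ((\sum_l tpi R * toC (b i l) * x 0 l) ^+ s / s`!%:R)) * ee (toC (a i) * tau)).

Lemma line_pair (tau w : C) (x : 'rV[C]_n) : inH tau ->
  abssum (fun q : I * nat => c q.1 * ee (toC (a q.1) * tau) *
    ((w * \sum_l tpi R * toC (b q.1 l) * x 0 l) ^+ q.2 / q.2`!%:R)).
Proof.
move=> ht; have [K hK] := line_abssum w x ht.
apply: (@abssum_pair _ _ _ _ (fun i => normc (c i * ee (toC (a i) * tau) *
    toC (expR (normc (w * \sum_l tpi R * toC (b i l) * x 0 l))))) K) => [i F uF|F uF] /=; last exact: hK.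
under eq_bigr do rewrite (normcM (_ * _) (_ / _)).
rewrite -mulr_sumr (normcM (_ * _) (toC _)) ler_wpM2l ?normc_ge0 //.
rewrite normc_toC ger0_norm ?expR_ge0 //.
have -> (W : C) : \sum_(j <- F) normc (W ^+ j / j`!%:R) = \sum_(j <- F) normc W ^+ j / j`!%:R.
  by apply: eq_bigr => j _; exact: normc_expterm.
by apply: expR_fin => //; exact: normc_ge0.
Qed.

(** Summability with one more factor $2\pi i\,a_i$ is a by-product of termwise differentiation at
    the previous order, whence the induction on the number of derivatives. *)
Lemma line_coef_hsum (x : 'rV[C]_n) s r tau : inH tau ->
  hsum (fun i => c i * ((tpi R * toC (a i)) ^+ r *
    ((\sum_l tpi R * toC (b i l) * x 0 l) ^+ s / s`!%:R)) * ee (toC (a i) * tau))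
    (line_coef x s r tau) /\
  cderiv (line_coef x s r) tau (line_coef x s r.+1 tau).
Proof.
move=> ht.
have key r' : TEXP (fun i => c i * ((tpi R * toC (a i)) ^+ r' *
    ((\sum_l tpi R * toC (b i l) * x 0 l) ^+ s / s`!%:R))) a (line_coef x s r').
  elim: r' => [|r' IH] t t0; apply: tsumP.
    have := abssum_inj (h := fun i => (i, s)) _ (line_pair 1 x t0).
    move=> /(_ (fun i j e => congr1 fst e)); apply: eq_abssum => i /=.
    by rewrite mul1r expr0 mul1r mulrAC.
  have [D hD _] := TEXP_derive IH t0.
  apply: hsum_abssum (_ : hsum _ D); apply: eq_hsum hD => i.
  by rewrite exprS; move: (tpi R) => T; ring.
split; first exact: key.
have [D hD dD] := TEXP_derive (key r) ht.
apply: (cderiv_eq dD); apply: hsum_unique hD _; apply: eq_hsum (key r.+1 tau ht) => i.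
by rewrite exprS; move: (tpi R) => T; ring.
Qed.

(** The family indexed by terms and Taylor degrees is absolutely summable by [line_pair]. Summed
    over degrees first it yields the exponentials and hence the value of [f]; summed over terms
    first it yields the power series in [w]. *)
Lemma line_series (tau w : C) (x : 'rV[C]_n) : inH tau ->
  hsum (fun s => w ^+ s * line_coef x s 0 tau) (f tau (w *: x)).
Proof.
move=> ht; have h := tsumP (line_pair w x ht).
have h1 : hsum (fun i => c i * ee (toC (a i) * tau) *
    cexp (w * \sum_l tpi R * toC (b i l) * x 0 l)) (tsum (fun q : I * nat => c q.1 * ee (toC (a q.1) * tau) *
    ((w * \sum_l tpi R * toC (b q.1 l) * x 0 l) ^+ q.2 / q.2`!%:R))).
  by apply: (hsum_fst h) => i /=; apply: hsumZ; exact: cexp_hsum.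
have -> : f tau (w *: x) = tsum (fun q : I * nat => c q.1 * ee (toC (a q.1) * tau) *
    ((w * \sum_l tpi R * toC (b q.1 l) * x 0 l) ^+ q.2 / q.2`!%:R)).
  apply: hsum_unique (hf (w *: x) ht) _; apply: eq_hsum h1 => i.
  rewrite eeD [ee (\sum_l _)]ee_cexp mulrA; congr (_ * cexp _).
  by rewrite !mulr_sumr; apply: eq_bigr => l _; rewrite mxE; move: (tpi R) => T; ring.
apply: (hsum_snd h) => s /=.
apply: eq_hsum (hsumZ (w ^+ s) (line_coef_hsum x s 0 ht).1) => i.
by rewrite expr0 mul1r exprMn; move: (_ ^+ s) (\sum_l _ ) (ee _) => u v z; ring.
Qed.

End LineSeries.

(** * From the transformation law of $\phi$ to that of $D_{k,p}\phi$ *)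

Section Slash.
Variable R : realType.
Local Notation C := R[i].
Variables (n m : nat) (Bm E : 'M[R]_n) (k2 : int).

(** Supplies the separating translation for the applications of [char_uniq] below. *)
Lemma ee_sep (x y : R) : x != y ->
  ee (toC (x * (2 * (x - y))^-1)) != ee (toC (y * (2 * (x - y))^-1)).
Proof.
rewrite -subr_eq0 => D0.
have -> : x * (2 * (x - y))^-1 = y * (2 * (x - y))^-1 + 2^-1 by field.
rewrite toCD eeD ee_half mulrN1 eq_sym -subr_eq0 opprK -mulr2n mulrn_eq0 /=.
exact: ee_neq0.
Qed.

Lemma even_sum (F : nat -> C) j :
  \sum_(i < j.+1) (if odd i then 0 else F i) = \sum_(mu < (j %/ 2).+1) F (2 * mu)%N.
Proof.
elim: j => [|j IH]; first by rewrite !big_ord1.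
rewrite big_ord_recr IH /=; case oj: (odd j) => /=.
  have -> : (j.+1 %/ 2 = (j %/ 2).+1)%N by lia.
  by rewrite [RHS]big_ord_recr /=; congr (_ + F _); lia.
by have -> : (j.+1 %/ 2 = j %/ 2)%N by [lia]; rewrite addr0.
Qed.

Lemma EC_row (x : 'rV[C]_n) (t : 'rV[R]_n) :
  BC Bm (vC t) (x *m EC E) = \sum_l toC (Bre Bm t (row l E)) * x 0 l.
Proof.
rewrite /BC /vC trmx_mul mulmxA !mxE; apply: eq_bigr => l _; rewrite mxE [x^T _ _]mxE.
congr (_ * _); rewrite /Bre !mxE toC_sum; apply: eq_bigr => k _.
rewrite toCM !mxE toC_sum; congr (_ * _).
by apply: eq_bigr => k' _; rewrite toCM !mxE.
Qed.

Lemma map_toC_mul p q r (A : 'M[R]_(p, q)) (B : 'M[R]_(q, r)) :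
  map_mx (@toC R) (A *m B) = map_mx (@toC R) A *m map_mx (@toC R) B.
Proof.
apply/matrixP => i j; rewrite !mxE toC_sum; apply: eq_bigr => k _.
by rewrite toCM !mxE.
Qed.

Lemma QC_line (w : C) (x : 'rV[C]_n) :
  tpi R * QC Bm ((w *: x) *m EC E) = - (w ^+ 2 * line_kappa Bm E (fun l => x 0 l)).
Proof.
have -> : QC Bm ((w *: x) *m EC E) = w ^+ 2 * QC Bm (x *m EC E).
  rewrite /QC /BC -scalemxAl linearZ /= -scalemxAl -scalemxAl -scalemxAr !mxE.
  by move: (\sum_j _) => z; ring.
have -> : QC Bm (x *m EC E) = \sum_(ij : 'I_n * 'I_n) toC ((E *m Bm *m E^T) ij.1 ij.2) * (x 0 ij.1 * x 0 ij.2) / 2.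
  rewrite /QC /BC -mulr_suml trmx_mul !mulmxA; congr (_ / _).
  have -> : x *m EC E *m map_mx (@toC R) Bm *m (EC E)^T = x *m map_mx (@toC R) (E *m Bm *m E^T).
    by rewrite !map_toC_mul -map_trmx !mulmxA.
  rewrite mxE; under eq_bigr do rewrite !mxE mulr_suml.
  rewrite exchange_big pair_big /=; apply: eq_bigr => -[i j] _ /=.
  by rewrite !mxE; ring.
rewrite mulrCA -mulrN; congr (_ * _); rewrite /line_kappa -sumrN mulr_sumr.
by apply: eq_bigr => ij _; rewrite /tpi; field.
Qed.

Variables (g : 'M[int]_2) (eps : bool).
Hypothesis detg : \det g = 1.
Variables (I I' : eqType) (c : 'I_m -> I -> C) (a : I -> R) (b : I -> 'I_n -> R).
Variables (c' : 'I_m -> I' -> C) (a' : I' -> R) (b' : I' -> 'I_n -> R).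
Variables phi psi : C -> 'rV[C]_n -> 'cV[C]_m.
Hypothesis hphi : JEXP E c a b phi.
Hypothesis hpsi : JEXP E c' a' b' psi.
Hypothesis slash : forall tau z, inH tau -> psi tau z =
  (jfac g eps tau ^ (- k2) * ee (- gc R g * QC Bm z / (gc R g * tau + gd R g))) *:
    phi (mobius g tau) ((gc R g * tau + gd R g)^-1 *: z).

(** Both sides are the coefficients of absolutely convergent power series in $w$ with the same sum.
    Taking $w=e(\theta)$ makes the powers of $w$ distinct characters of $\theta$, so agreement on
    the unit circle already identifies the coefficients. *)
Lemma line_slash (r : 'I_m) (x : 'rV[C]_n) s tau : inH tau ->
  line_coef (c' r) a' b' x s 0 tau =
  \sum_(mu < (s %/ 2).+1) (line_kappa Bm E (fun l => x 0 l) * gc R g) ^+ mu / mu`!%:R *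
     wslash g eps k2 (s - mu) (line_coef (c r) a b x (s - 2 * mu) 0%N) tau.
Proof.
move=> ht; set kap := line_kappa _ _ _; pose J := gc R g * tau + gd R g.
have J0 : J != 0 := J_neq0 detg ht.
have hg := mobius_inH detg ht.
pose rhs s' := \sum_(mu < (s' %/ 2).+1) (kap * gc R g) ^+ mu / mu`!%:R *
     wslash g eps k2 (s' - mu) (line_coef (c r) a b x (s' - 2 * mu) 0%N) tau.
apply/eqP; rewrite -subr_eq0; apply/eqP.
pose d s' := line_coef (c' r) a' b' x s' 0 tau - rhs s'.
apply: (@char_uniq R R _ (fun th s' => ee (toC (s'%:R * th))) d s).
- by move=> th i; rewrite normc_ee /= mulr0 oppr0 expR0.
- by move=> th th' i; rewrite mulrDr toCD eeD.
- move=> th; pose w := ee (toC th).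
  have h1 := line_series (hpsi r) w x ht.
  have h2 := line_series (hphi r) (w / J) x hg.
  (* The exponential in $w^2$ is listed by its degree in [w], with zeros in odd degrees, so that
     [hsum_cauchy] applies; [even_sum] later discards the zeros. *)
  have h3 : hsum (fun j => if odd j then 0 else (kap * gc R g / J * w ^+ 2) ^+ (j %/ 2) / (j %/ 2)`!%:R)
      (cexp (kap * gc R g / J * w ^+ 2)).
    apply: (@hsum_reindex _ _ _ (fun j => 2 * j)%N) => [i j|j|]; first by lia.
      case: ifP => [_|oj _]; first by rewrite eqxx.
      by exists (j %/ 2)%N; lia.
    apply: eq_hsum (cexp_hsum _) => j /=.
    by rewrite oddM /= mulKn.
  have h4 := hsumZ (jfac g eps tau ^ (- k2)) (hsum_cauchy h2 h3).
  have e : psi tau ((w *: x) *m EC E) r 0 = jfac g eps tau ^ (- k2) *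
     (phi (mobius g tau) ((w / J) *: x *m EC E) r 0 * cexp (kap * gc R g / J * w ^+ 2)).
    have hq := QC_line w x; rewrite slash // mxE; set Q := QC Bm _ in hq *.
    move: Q hq => Q hq; rewrite -mulrA; congr (_ * _); rewrite mulrC; congr (_ * _).
      by rewrite -scalemxAl scalerA mulrC scalemxAl.
    rewrite ee_cexp; congr cexp.
    transitivity (- (tpi R * Q) * gc R g / J).
      by rewrite -/J; move: (tpi R) (J^-1) => T iJ; ring.
    by rewrite hq opprK -/kap; move: (J^-1) => iJ; ring.
  rewrite -e in h4; have := hsumB h1 h4; rewrite subrr.
  apply: eq_hsum => j; rewrite /d mulrBl -ee_nat_mul -/w mulrC; congr (_ - _).
  rewrite (eq_bigr (fun i : 'I_j.+1 => if odd i then 0 else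
    (w / J) ^+ (j - i) * line_coef (c r) a b x (j - i) 0 (mobius g tau) *
    ((kap * gc R g / J * w ^+ 2) ^+ (i %/ 2) / (i %/ 2)`!%:R))); last first.
    by move=> i _; case: ifP => _; rewrite ?mulr0.
  rewrite (even_sum (fun i => (w / J) ^+ (j - i) * line_coef (c r) a b x (j - i) 0 (mobius g tau) *
    ((kap * gc R g / J * w ^+ 2) ^+ (i %/ 2) / (i %/ 2)`!%:R))).
  rewrite mulr_sumr /rhs [RHS]mulr_suml; apply: eq_bigr => mu _.
  have mj : (2 * mu <= j)%N by have := ltn_ord mu; lia.
  rewrite mulKn // /wslash -/J.
  have -> : w ^+ j = w ^+ (j - 2 * mu) * (w ^+ 2) ^+ mu by rewrite -exprM -exprD subnK.
  have -> : J ^- (j - mu) = J ^- (j - 2 * mu) * J ^- mu.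
    by rewrite -invfM -exprD; congr (_ ^- _); lia.
  rewrite !expr_div_n ![(_ * w ^+ 2) ^+ mu]exprMn expr_div_n.
  by move: (line_coef _ _ _ _ _ _ _) (_ ^+ mu) => z z'; ring.
move=> i ne_is _; exists (2 * (i%:R - s%:R))^-1; apply: ee_sep.
by rewrite eqr_nat.
Qed.

Lemma sum_Dk (J : eqType) (d : 'I_m -> J -> C) (al : J -> R) (be : J -> 'I_n -> R) f r x s tau :
  JEXP E d al be f -> inH tau ->
  \sum_(q : {ffun 'I_n -> 'I_s.+1} | (\sum_l (q l : nat) == s)%N)
     (\prod_l (x : 'rV[C]_n) 0 l ^+ q l) * Dk Bm E k2 (toN q) f tau r 0 =
  4 ^+ (s %/ 2) * (s %/ 2)`!%:R *
    Dline k2 (line_kappa Bm E (fun l => x 0 l)) (line_coef (d r) al be x) s tau.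
Proof.
move=> hf ht.
have h1 := hsum_sum (index_enum _) (P := fun q : {ffun 'I_n -> 'I_s.+1} => (\sum_l (q l : nat) == s)%N)
  (fun q _ => hsumZ (\prod_l x 0 l ^+ q l) (Dk_TEXP Bm k2 hf (toN q) r ht)).
have h2 := hsumZ (4 ^+ (s %/ 2) * (s %/ 2)`!%:R) (hsum_sum (index_enum _) (P := xpredT)
  (fun (i : 'I_(s %/ 2).+1) _ => hsumZ
     (poch ((k2%:~R / 2 : C) + s%:R - 1 - (s %/ 2)%N%:R) (s %/ 2 - i) * line_kappa Bm E (fun l => x 0 l) ^+ i / i`!%:R)
     (line_coef_hsum (hf r) x (s - 2 * i) i ht).1)).
apply: hsum_unique h1 _; apply: eq_hsum h2 => j.
transitivity (d r j * ee (toC (al j) * tau) *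
   \sum_(q : {ffun 'I_n -> 'I_s.+1} | (\sum_l (q l : nat) == s)%N)
     (\prod_l x 0 l ^+ q l) * Dk_term Bm E k2 (toN q) (al j) (be j)); last first.
  by rewrite mulr_sumr; apply: eq_bigr => q _; move: (Dk_term _ _ _ _ _ _) (ee _) (\prod_l _) => u v w; ring.
rewrite Dk_term_line mulrCA; congr (_ * _); rewrite mulr_sumr; apply: eq_bigr => i _.
by move: (poch _ _) (tpi R * _) (ee _) (line_kappa _ _ _) (\sum_l _) => u v w y z; ring.
Qed.

(** [Dline_cov] holds for every direction [x]. Both sides are homogeneous polynomials of degree
    $s(p)$ in [x], and the claim is the equality of their coefficients at $x^p$. *)
Lemma Dk_slash p tau : inH tau -> Dk Bm E k2 p psi tau =
  (jfac g eps tau ^ (- k2) * (gc R g * tau + gd R g) ^- mi_sum p) *: Dk Bm E k2 p phi (mobius g tau).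
Proof.
move=> ht; apply/colP => r; rewrite [RHS]mxE; set s := mi_sum p.
have hg := mobius_inH detg ht.
pose Cf := jfac g eps tau ^ (- k2) * (gc R g * tau + gd R g) ^- s.
pose d (q : {ffun 'I_n -> 'I_s.+1}) : C := if (\sum_l (q l : nat) == s)%N then
   Dk Bm E k2 (toN q) psi tau r 0 - Cf * Dk Bm E k2 (toN q) phi (mobius g tau) r 0 else 0.
have ple l : (p l <= s)%N by rewrite /s /mi_sum (bigD1 l) //= leq_addr.
pose q0 : {ffun 'I_n -> 'I_s.+1} := [ffun l => inord (p l)].
have q0E : toN q0 = p by apply/ffunP => l; rewrite !ffunE inordK // ltnS.
have : d q0 = 0.
  apply: poly_coef_uniq => x'; pose x : 'rV[C]_n := \row_l x' l.
  have key := Dline_cov detg (fun s' r' t (t0 : inH t) => (line_coef_hsum (hphi r) x s' r' t0).2)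
     (fun s' r' t (t0 : inH t) => (line_coef_hsum (hpsi r) x s' r' t0).2)
     (fun s' t (t0 : inH t) => line_slash r x s' t0) s ht.
  have h1 := sum_Dk r x s hpsi ht; have h2 := sum_Dk r x s hphi hg.
  rewrite key /wslash mulrCA -/Cf -h2 mulr_sumr in h1.
  rewrite -[RHS](subrr (\sum_(q : {ffun 'I_n -> 'I_s.+1} | (\sum_l (q l : nat) == s)%N)
     (\prod_l x 0 l ^+ q l) * Dk Bm E k2 (toN q) psi tau r 0)) {2}h1 -sumrB.
  rewrite [RHS]big_mkcond; apply: eq_bigr => q _; rewrite /d; case: ifP => _; last by rewrite mul0r.
  have -> : \prod_l x' l ^+ q l = \prod_l x 0 l ^+ q l by apply: eq_bigr => l _; rewrite mxE.
  by rewrite mulrBl [X in X - _]mulrC -mulrA [X in Cf * X]mulrC.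
rewrite /d q0E.
have -> : (\sum_l (q0 l : nat) == s)%N.
  by apply/eqP/eq_bigr => l _; rewrite ffunE inordK // ltnS.
by move=> /eqP; rewrite subr_eq0 => /eqP ->.
Qed.

End Slash.

(** * Modularity and the expansions at the cusps *)

Section Modularity.
Variable R : realType.
Local Notation C := R[i].
Variables (n m : nat) (Bm Lb E : 'M[R]_n) (k2 : int).

Definition bcoord (t : 'rV[R]_n) (l : 'I_n) : R := Bre Bm t (row l E).

Lemma slashJ_jfac gam eps phi tau (z : 'rV[C]_n) :
  slashJ (m := m) Bm Lb k2 (MElt gam eps 0 0 false) phi tau z =
  (jfac gam eps tau ^ (- k2) * ee (- gc R gam * QC Bm z / (gc R gam * tau + gd R gam))) *:
    phi (mobius gam tau) ((gc R gam * tau + gd R gam)^-1 *: z).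
Proof.
rewrite /slashJ /=.
have -> : latv Lb 0 = 0 by rewrite /latv map_mx0 mul0mx.
have -> : vC (0 : 'rV[R]_n) = 0 by apply/rowP => l; rewrite !mxE.
have B0 (w : 'rV[C]_n) : BC Bm 0 w = 0 by rewrite /BC !mul0mx mxE.
by rewrite scaler0 !addr0 /QC !B0 !mul0r mulr0 !addr0 mulr1.
Qed.

Lemma slash_id phi tau (z : 'rV[C]_n) :
  slashJ (m := m) Bm Lb k2 (MElt 1%:M false 0 0 false) phi tau z = phi tau z.
Proof.
rewrite slashJ_jfac /jfac /mobius /ga /gb /gc /gd !mxE /=.
rewrite !mul0r !add0r oppr0 !mul0r !mul1r addr0 divr1 invr1 scale1r ee0 mulr1.
have -> : csqrt (1 : C) = 1.
  rewrite /csqrt /= expr1n expr0n addr0 sqrtr1 ltxx subrr mul0r sqrtr0 mulr0.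
  by rewrite divff ?sqrtr1 // pnatr_eq0.
by rewrite exp1rz scale1r.
Qed.

Lemma det1_id : \det (1%:M : 'M[int]_2) = 1.
Proof. exact: det1. Qed.

Lemma toCfrac (al : int) (M : nat) : toC (al%:~R / M%:R : R) = al%:~R / M%:R.
Proof. by rewrite toCM toCV toC_nat toC_int. Qed.

Lemma JForm_JEXP M (c : int -> 'rV[R]_n -> 'cV[C]_m) (psi : C -> 'rV[C]_n -> 'cV[C]_m) :
  (forall tau z, inH tau ->
        HasSum (fun p : int * 'rV[R]_n =>
                  (ee ((p.1%:~R / M%:R) * tau) * ee (BC Bm (vC p.2) z)) *: c p.1 p.2)
               (psi tau z)) ->
  JEXP E (fun r (p : int * 'rV[R]_n) => c p.1 p.2 r 0) (fun p => p.1%:~R / M%:R) (fun p => bcoord p.2) psi.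
Proof.
move=> h r tau x ht; have /HasSum_mx /(_ r) := h tau (x *m EC E) ht.
apply: eq_hsum => -[al t] /=; rewrite mxE EC_row -eeD toCfrac.
by rewrite [LHS]mulrC.
Qed.

Lemma Dk_linear (I : eqType) (c : 'I_m -> I -> C) a b (A : 'M[C]_m) p phi psi tau :
  JEXP E c a b phi -> (forall t x, inH t -> psi t x = A *m phi t x) -> inH tau ->
  Dk Bm E k2 p psi tau = A *m Dk Bm E k2 p phi tau.
Proof.
move=> h e ht; apply/colP => r; rewrite [RHS]mxE.
have h' : JEXP E (fun r i => \sum_j A r j * c j i) a b psi.
  move=> r' t x t0; rewrite e // mxE.
  apply: eq_hsum (hsum_sum (index_enum _) (P := xpredT) (fun j _ => hsumZ (A r' j) (h j t x t0))) => i.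
  by rewrite mulr_suml; apply: eq_bigr => j _; rewrite mulrA.
apply: hsum_unique (Dk_TEXP Bm k2 h' p r ht) _.
apply: eq_hsum (hsum_sum (index_enum _) (P := xpredT)
  (fun j _ => hsumZ (A r j) (Dk_TEXP Bm k2 h p j ht))) => i.
by rewrite !mulr_suml; apply: eq_bigr => j _; rewrite !mulrA.
Qed.

Lemma slashM_weight gam eps s (h : C -> 'cV[C]_m) tau : \det gam = 1 -> inH tau ->
  slashM (k2 + 2 * s%:Z) gam eps h tau =
  (jfac gam eps tau ^ (- k2) * (gc R gam * tau + gd R gam) ^- s) *: h (mobius gam tau).
Proof.
move=> dg ht; rewrite /slashM opprD expfzDr ?jfac_neq0 //; congr (_ * _ *: _).
by rewrite -PoszM -exprnN exprM jfac_sqr.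
Qed.

Variables (G : 'M[int]_2 -> Prop) (rho : melt n -> 'M[C]_m).

(** All kinds of growth are handled at once: the last hypothesis traces each nonzero $q$-coefficient
    to a pair $(n,t)$ in the support of the slashed form on which $D_{k,p}$ does not vanish. The
    nonvanishing is what yields cusp forms. *)
Lemma Dk_MForm kd kd' phi p :
  JForm kd G Bm Lb rho k2 phi ->
  (forall M (c : int -> 'rV[R]_n -> 'cV[C]_m) (c' : int -> 'cV[C]_m), (0 < M)%N ->
     jsupport Bm kd M c ->
     (forall al, c' al != 0 -> exists t, c al t != 0 /\
        Dk_term Bm E k2 p (al%:~R / M%:R) (bcoord t) != 0) -> msupport kd' c') ->
  MForm kd' G rho (k2 + 2 * Posz (mi_sum p)) (Dk Bm E k2 p phi).
Proof.
move=> [_ [inv fou]] supp.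
have [M0 [M00 [c0 [_ [_ h0]]]]] := fou (MElt 1%:M false 0 0 false) det1_id.
have hphi := JForm_JEXP (fun tau z t0 => eq_rect _ (HasSum _) (h0 tau z t0) _ (slash_id phi tau z)).
have sl gam eps (dg : \det gam = 1) tau (ht : inH tau) :
    slashM (k2 + 2 * (mi_sum p)%:Z) gam eps (Dk Bm E k2 p phi) tau =
    Dk Bm E k2 p (slashJ Bm Lb k2 (MElt gam eps 0 0 false) phi) tau.
  have [M [M1 [c [_ [_ h]]]]] := fou (MElt gam eps 0 0 false) dg.
  rewrite slashM_weight //; symmetry; apply: (Dk_slash dg hphi (JForm_JEXP h)) => //.
  by move=> t z t0; exact: slashJ_jfac.
split; first exact: Dk_holoM hphi _.
split=> [gam eps dg Gg tau ht|gam eps dg].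
  rewrite sl //; apply: (Dk_linear _ hphi) => // t x t0.
  by apply: inv => //; split.
have [M [M1 [c [_ [sc h]]]]] := fou (MElt gam eps 0 0 false) dg.
exists M; split=> //.
pose D (q : int * 'rV[R]_n) := Dk_term Bm E k2 p (q.1%:~R / M%:R) (bcoord q.2).
have hh r tau (ht : inH tau) := Dk_TEXP Bm k2 (JForm_JEXP h) p r ht.
pose c' (al : int) : 'cV[C]_m := \col_r tsum (fun t => c al t r 0 * D (al, t)).
have c'P r al : hsum (fun t => c al t r 0 * D (al, t)) (c' al r 0).
  rewrite mxE; apply: tsumP.
  (* For fixed [al] the factor $e(n\tau)$ is common to all terms, so dividing it out at the single
     point $\tau=i$ proves convergence of the sum over [t]. *)
  have iH : inH (iC R) by rewrite /inH /=.
  have := abssum_inj (h := fun t : 'rV[R]_n => (al, t)) _ (hsum_abssum (hh r (iC R) iH)).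
  move=> /(_ (fun i j e => congr1 snd e)).
  move=> /(abssumZ (ee (- (toC (al%:~R / M%:R) * iC R)))); apply: eq_abssum => t /=.
  by rewrite mulrCA eeN mulr1.
exists c'; split.
  apply: supp sc _ => // al; case: (pselect (exists t, c al t != 0 /\ D (al, t) != 0)) => // no.
  move=> /eqP []; apply/colP => r; rewrite [RHS]mxE.
  apply: hsum_unique (c'P r al) _; apply: (@eq_hsum _ _ (fun=> 0)) => [t|]; last exact: hsum0.
  case: (eqVneq (c al t) 0) => [->|ct]; first by rewrite mxE mul0r.
  case: (eqVneq (D (al, t)) 0) => [->|Dt]; first by rewrite mulr0.
  by case: no; exists t.
move=> tau ht; rewrite sl //; apply/HasSum_mx => r.
apply: (hsum_fst (hh r tau ht)) => al /=; rewrite mxE -/(D (al, _)).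
apply: eq_hsum (hsumZ (ee (al%:~R / M%:R * tau)) (c'P r al)) => t.
by rewrite toCfrac [LHS]mulrC.
Qed.

End Modularity.

(** * Fractional q-series *)

Section QSeries.
Variable R : realType.
Local Notation C := R[i].

Lemma hsum_sumtype (I J : eqType) (f : I -> C) (g : J -> C) s t :
  hsum f s -> hsum g t ->
  hsum (fun q : I + J => match q with inl i => f i | inr j => g j end) (s + t).
Proof.
move=> hf hg.
have h1 : hsum (fun q : I + J => if q is inl i then f i else 0) s.
  apply: (@hsum_reindex _ _ _ (@inl I J)) => [i j []//|[i|j] /=|//]; first by exists i.
  by rewrite eqxx.
have h2 : hsum (fun q : I + J => if q is inr j then g j else 0) t.
  apply: (@hsum_reindex _ _ _ (@inr I J)) => [i j []//|[i|j] /=|//]; last by exists j.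
  by rewrite eqxx.
by apply: eq_hsum (hsumD h1 h2) => -[i|j]; rewrite ?addr0 ?add0r.
Qed.

Definition qseries (f : C -> C) : Prop :=
  exists (M : nat) (N0 : int) (c : int -> C), [/\ (0 < M)%N, (forall al, c al != 0 -> N0 <= al) &
    TEXP c (fun al => al%:~R / M%:R) f].

(** Terms with equal exponents are collected here once and for all. Closure under sums and products
    then only requires disjoint unions and products of index types. *)
Lemma qseries_family (I : eqType) (c : I -> C) (a : I -> R) (f : C -> C) (M : nat) (N0 : int) :
  (0 < M)%N ->
  (forall i, c i != 0 -> exists2 z : int, a i = z%:~R / M%:R & N0 <= z) ->
  TEXP c a f -> qseries f.
Proof.
move=> M0 ha hf.
have Mn0 : (M%:R : R) != 0 by rewrite pnatr_eq0 -lt0n.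
(* [M * a i] is an integer wherever [c i] is nonzero; the floor makes this a total function, and its
   other values only meet zero coefficients. *)
pose p i := Num.floor (M%:R * a i).
have pP i : c i != 0 -> a i = (p i)%:~R / M%:R /\ N0 <= p i.
  move=> /ha [z az zN]; have -> : p i = z by rewrite /p az mulrC divfK // intrKfloor.
  by [].
pose fib al i := if p i == al then c i else 0.
have iH : inH (iC R) by rewrite /inH /=.
have aw al : abssum (fib al).
  have := abssumZ (ee (- (toC (al%:~R / M%:R) * iC R)))
    (abssum_fiber (fun i => p i == al) (hsum_abssum (hf _ iH))).
  apply: eq_abssum => i; rewrite /fib; case: eqP => [e|_]; last by rewrite mulr0.
  have [->|ci] := eqVneq (c i) 0; first by rewrite mul0r mulr0.
  by have [-> _] := pP i ci; rewrite e mulrCA eeN mulr1.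
exists M, N0, (fun al => tsum (fib al)); split=> // [al|tau ht].
  move=> h; case: (pselect (exists2 i, p i = al & c i != 0)) => [[i <- ci]|no].
    by have [] := pP i ci.
  case/eqP: h; apply: hsum_unique (tsumP (aw al)) _.
  apply: (@eq_hsum _ _ (fun=> 0)) => [i|]; last exact: hsum0.
  rewrite /fib; case: eqP => // e; symmetry; apply/eqP/negPn/negP => ci.
  by case: no; exists i.
apply: (hsum_group (p := p) (hf tau ht)) => al; rewrite mulrC.
apply: eq_hsum (hsumZ (ee (toC (al%:~R / M%:R) * tau)) (tsumP (aw al))) => i.
rewrite /fib; case: eqP => [e|_]; last by rewrite mulr0.
have [->|ci] := eqVneq (c i) 0; first by rewrite mul0r mulr0.
by have [-> _] := pP i ci; rewrite e mulrC.
Qed.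

Lemma qseries_ext (f g : C -> C) : (forall tau, inH tau -> f tau = g tau) -> qseries f -> qseries g.
Proof.
move=> e [M [N0 [c [M0 cN hf]]]]; exists M, N0, c; split=> // tau ht.
by rewrite -e //; exact: hf.
Qed.

Lemma qseries_cst z : qseries (fun=> z).
Proof.
apply: (@qseries_family unit (fun=> z) (fun=> 0) _ 1 0) => // [_ _|tau _].
  by exists 0; rewrite ?mul0r.
have -> : z = \sum_(u : unit) z by rewrite big_const card_unit /= addr0.
by apply: eq_hsum (hsum_fin _) => u; rewrite big_const card_unit /= addr0 mul0r ee0 mulr1.
Qed.

Lemma qseries_add f g : qseries f -> qseries g -> qseries (fun tau => f tau + g tau).
Proof.
move=> [M [N [c [M0 cN hf]]]] [M' [N' [c' [M0' cN' hg]]]].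
have n0 : (M%:R : R) != 0 by rewrite pnatr_eq0 -lt0n.
have n0' : (M'%:R : R) != 0 by rewrite pnatr_eq0 -lt0n.
apply: (@qseries_family (int + int)%type (fun q => match q with inl i => c i | inr j => c' j end)
  (fun q => match q with inl i => i%:~R / M%:R | inr j => j%:~R / M'%:R end) _
  (M * M') (Num.min (N * M'%:Z) (N' * M%:Z))).
- by rewrite muln_gt0 M0.
- move=> [i /cN iN|j /cN' jN].
    exists (i * M'%:Z); first by rewrite intrM natrM; field; rewrite n0 n0'.
    by rewrite ge_min ler_wpM2r.
  exists (j * M%:Z); first by rewrite intrM natrM; field; rewrite n0 n0'.
  by rewrite ge_min orbC ler_wpM2r.
- by move=> tau ht; apply: eq_hsum (hsum_sumtype (hf tau ht) (hg tau ht)) => -[].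
Qed.

Lemma qseries_mul f g : qseries f -> qseries g -> qseries (fun tau => f tau * g tau).
Proof.
move=> [M [N [c [M0 cN hf]]]] [M' [N' [c' [M0' cN' hg]]]].
have n0 : (M%:R : R) != 0 by rewrite pnatr_eq0 -lt0n.
have n0' : (M'%:R : R) != 0 by rewrite pnatr_eq0 -lt0n.
apply: (@qseries_family (int * int)%type (fun q => c q.1 * c' q.2)
  (fun q => q.1%:~R / M%:R + q.2%:~R / M'%:R) _
  (M * M') (N * M'%:Z + N' * M%:Z)).
- by rewrite muln_gt0 M0.
- move=> [i j] /=; rewrite mulf_eq0 negb_or => /andP[/cN iN /cN' jN].
  exists (i * M'%:Z + j * M%:Z); first by rewrite intrD !intrM natrM; field; rewrite n0 n0'.
  by rewrite lerD ?ler_wpM2r.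
- move=> tau ht; apply: eq_hsum (hsum_prod (hf tau ht) (hg tau ht)) => -[i j] /=.
  by rewrite toCD mulrDl eeD mulrACA.
Qed.

Lemma qseries_sum (J : Type) (r : seq J) (P : pred J) (f : J -> C -> C) :
  (forall j, qseries (f j)) -> qseries (fun tau => \sum_(j <- r | P j) f j tau).
Proof.
move=> h; elim: r => [|j r IH].
  by apply: qseries_ext (qseries_cst 0) => tau _; rewrite big_nil.
case Pj: (P j); last by apply: qseries_ext IH => tau _; rewrite big_cons Pj.
by apply: qseries_ext (qseries_add (h j) IH) => tau _; rewrite big_cons Pj.
Qed.

Lemma qseries_prod (J : Type) (r : seq J) (P : pred J) (f : J -> C -> C) :
  (forall j, qseries (f j)) -> qseries (fun tau => \prod_(j <- r | P j) f j tau).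
Proof.
move=> h; elim: r => [|j r IH].
  by apply: qseries_ext (qseries_cst 1) => tau _; rewrite big_nil.
case Pj: (P j); last by apply: qseries_ext IH => tau _; rewrite big_cons Pj.
by apply: qseries_ext (qseries_mul (h j) IH) => tau _; rewrite big_cons Pj.
Qed.

Lemma qseries_det d (A : C -> 'M[C]_d) : (forall i j, qseries (fun tau => A tau i j)) ->
  qseries (fun tau => \det (A tau)).
Proof.
move=> h; rewrite /determinant; apply: qseries_sum => s.
by apply: qseries_mul; [exact: qseries_cst | apply: qseries_prod => i].
Qed.

Lemma int_min (P : int -> Prop) (N : int) : (forall z, P z -> N <= z) -> (exists z, P z) ->
  exists2 z, P z & forall z', P z' -> z <= z'.
Proof.
move=> PN [z0 Pz0].
have ex : exists k : nat, `[< P (N + k%:Z) >].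
  exists (absz (z0 - N)); apply/asboolP; rewrite gez0_abs ?subr_ge0 ?PN //.
  by have -> : N + (z0 - N) = z0 by lia.
have [k /asboolP Pk kmin] := ex_minnP ex.
exists (N + k%:Z) => // z' Pz'; have Nz := PN _ Pz'.
have : (k <= absz (z' - N))%N.
  apply: kmin; apply/asboolP; rewrite gez0_abs ?subr_ge0 //.
  by have -> : N + (z' - N) = z' by lia.
by lia.
Qed.

(** If both factors had nonzero coefficients, the sum of their least exponents would arise from a
    single pair. On the line $\mathrm{Im}\,\tau=1$ [char_uniq] would then make the product of the
    two leading coefficients vanish. *)
Lemma qseries_mul_eq0 f g : qseries f -> qseries g -> (forall tau, inH tau -> f tau * g tau = 0) ->
  (exists tau, inH tau /\ g tau != 0) -> forall tau, inH tau -> f tau = 0.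
Proof.
move=> [M [N [c [M0 cN hf]]]] [M' [N' [c' [M0' cN' hg]]]] fg0 [tau0 [ht0 g0]].
have zero (F : C -> C) (d : int -> C) a tau : TEXP d a F -> inH tau ->
    ~ (exists z, d z != 0) -> F tau = 0.
  move=> hF ht no; apply: hsum_unique (hF tau ht) _.
  apply: (@eq_hsum _ _ (fun=> 0)) => [z|]; last exact: hsum0.
  have -> : d z = 0 by apply/eqP/negPn/negP => dz; apply: no; exists z.
  by rewrite mul0r.
move=> tau ht.
case: (pselect (exists z, c z != 0)) => [exc|no]; last exact: zero hf ht no.
case: (pselect (exists z, c' z != 0)) => [exc'|no]; last first.
  by rewrite (zero _ _ _ _ hg ht0 no) eqxx in g0.
have [a0 ca0 amin] := int_min cN exc.
have [b0 cb0 bmin] := int_min cN' exc'.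
pose al (q : int * int) : R := q.1%:~R / M%:R + q.2%:~R / M'%:R.
have p0 : 0 < (M%:R : R) by rewrite ltr0n.
have p0' : 0 < (M'%:R : R) by rewrite ltr0n.
have : c a0 * c' b0 * ee (toC (al (a0, b0)) * iC R) = 0.
  apply: (@char_uniq R R (int * int)%type (fun th q => ee (toC (al q * th)))
    (fun q => c q.1 * c' q.2 * ee (toC (al q) * iC R)) (a0, b0)).
  - by move=> th q; rewrite normc_ee /= mulr0 oppr0 expR0.
  - by move=> th th' q; rewrite mulrDr toCD eeD.
  - move=> th; have iH : inH (iC R + toC th) by rewrite /inH /= addr0.
    rewrite -(fg0 _ iH); apply: eq_hsum (hsum_prod (hf _ iH) (hg _ iH)) => -[i j] /=.
    rewrite mulrACA -eeD -mulrDl -toCD -/(al (i, j)) mulrDr eeD -toCM mulrA //.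
  - move=> [i j] ne /=; rewrite !mulf_eq0 !negb_or => /andP[/andP[ci cj] _].
    exists (2 * (al (i, j) - al (a0, b0)))^-1; apply: ee_sep.
    have ia := amin _ ci; have jb := bmin _ cj.
    have ai : a0%:~R / M%:R <= i%:~R / M%:R :> R by rewrite ler_pM2r ?invr_gt0 // ler_int.
    have bj : b0%:~R / M'%:R <= j%:~R / M'%:R :> R by rewrite ler_pM2r ?invr_gt0 // ler_int.
    apply: contra ne => /eqP; rewrite /al /= => e.
    have e1 : i%:~R / M%:R = a0%:~R / M%:R :> R by lra.
    have e2 : j%:~R / M'%:R = b0%:~R / M'%:R :> R by lra.
    have inj (k : nat) (x y : int) : 0 < (k%:R : R) -> x%:~R / k%:R = y%:~R / k%:R :> R -> x = y.
      by move=> k0 /(mulIf _) e0; apply: (@intr_inj R); apply: e0; rewrite invr_neq0 ?gt_eqF.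
    by rewrite (inj _ _ _ p0 e1) (inj _ _ _ p0' e2).
by move=> /eqP; rewrite !mulf_eq0 (negbTE ca0) (negbTE cb0) (negbTE (ee_neq0 _)).
Qed.

End QSeries.

(** * Theta series and the theta decomposition *)

Section Theta.
Variable R : realType.
Local Notation C := R[i].

Lemma geom_fin (r : R) (F : seq nat) : 0 <= r -> r < 1 -> uniq F ->
  \sum_(j <- F) r ^+ j <= (1 - r)^-1.
Proof.
move=> r0 r1 uF; have [N hN] := sub_iota F.
apply: le_trans (sum_subset uF (iota_uniq 0 N) hN _) _ => [i|]; first exact: exprn_ge0.
have -> : \sum_(j <- iota 0 N) r ^+ j = (1 - r ^+ N) / (1 - r).
  have r1' : 1 - r != 0 by rewrite subr_eq0 eq_sym lt_eqF.
  apply: (mulIf r1'); rewrite divfK //.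
  elim: N {hN} => [|N IH]; first by rewrite big_nil expr0; ring.
  by rewrite -[N.+1]addn1 iotaD big_cat /= mulrDl IH big_seq1 add0n addn1 exprS; ring.
rewrite -[leRHS]mul1r ler_pM2r ?invr_gt0 ?subr_gt0 // lerBlDr lerDl.
exact: exprn_ge0.
Qed.

Lemma int_geom (r : R) (F : seq int) : 0 <= r -> r < 1 -> uniq F ->
  \sum_(z <- F) r ^+ absz z <= (1 - r)^-1 *+ 2.
Proof.
move=> r0 r1 uF; rewrite (bigID (fun z : int => 0 <= z)) /= mulr2n.
have part (P : pred int) : {in P &, injective absz} ->
    \sum_(z <- F | P z) r ^+ absz z <= (1 - r)^-1.
  move=> inj; rewrite -big_filter -(big_map absz xpredT (fun j => r ^+ j)).
  apply: geom_fin => //; rewrite map_inj_in_uniq ?filter_uniq // => x y.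
  by rewrite !mem_filter => /andP[px _] /andP[py _]; exact: inj.
apply: lerD; apply: part => -[x|x] [y|y]; rewrite !unfold_in //= => _ _.
  by move=> ->.
by move=> [->].
Qed.

(** A finite set of integer vectors lies in a box $[-N,N]^n$, over which the sum of products
    factors. *)
Lemma box_sum n (g : int -> R) (K : R) : (forall z, 0 <= g z) ->
  (forall F, uniq F -> \sum_(z <- F) g z <= K) ->
  forall F : seq 'rV[int]_n, uniq F -> \sum_(a <- F) \prod_l g (a 0 l) <= K ^+ n.
Proof.
move=> g0 gK F uF.
pose N := \max_(a <- F) \max_l absz (a 0%R l).
have aN a l : a \in F -> (absz (a 0%R l) <= N)%N.
  move=> aF; apply: (@leq_trans (\max_l absz (a 0%R l))).
    exact: (leq_bigmax (F := fun l => absz (a 0%R l))).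
  exact: (leq_bigmax_seq (F := fun b : 'rV[int]_n => \max_l absz (b 0%R l))).
pose v (k : 'I_(2 * N).+1) : int := k%:Z - N%:Z.
have vI : injective v by move=> x y; rewrite /v => e; apply: val_inj => /=; lia.
pose rw (f : {ffun 'I_n -> 'I_(2 * N).+1}) : 'rV[int]_n := \row_l v (f l).
pose T := map rw (enum {ffun 'I_n -> 'I_(2 * N).+1}).
have uT : uniq T.
  rewrite map_inj_uniq ?enum_uniq // => f f' /rowP e; apply/ffunP => l.
  by have := e l; rewrite !mxE => /vI.
have sT : {subset F <= T}.
  move=> a aF; apply/mapP.
  exists [ffun l => inord (absz (a 0 l + N%:Z))]; first by rewrite mem_enum.
  apply/rowP => l; rewrite mxE ffunE /v inordK; have := aN a l aF; lia.
apply: le_trans (sum_subset uF uT sT _) _ => [a|]; first exact: prodr_ge0.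
rewrite big_map big_enum /=.
have -> : \sum_(f : {ffun 'I_n -> 'I_(2 * N).+1}) \prod_l g (rw f 0 l) =
    \prod_(l < n) \sum_(k < (2 * N).+1) g (v k).
  rewrite bigA_distr_bigA; apply: eq_bigr => f _; apply: eq_bigr => l _.
  by rewrite mxE.
rewrite prodr_const card_ord lerXn2r ?nnegrE ?sumr_ge0 //.
  by have := gK [::] isT; rewrite big_nil.
rewrite -big_enum /= -(big_map v xpredT g) gK // map_inj_uniq ?enum_uniq //.
Qed.

Variables (n : nat) (Bm Lb : 'M[R]_n).

Lemma BreDl v w x : Bre Bm (v + w) x = Bre Bm v x + Bre Bm w x.
Proof. by rewrite /Bre !mulmxDl mxE. Qed.
Lemma BreDr v w x : Bre Bm x (v + w) = Bre Bm x v + Bre Bm x w.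
Proof. by rewrite /Bre linearD mulmxDr mxE. Qed.
Lemma BreZl k v w : Bre Bm (k *: v) w = k * Bre Bm v w.
Proof. by rewrite /Bre -!scalemxAl mxE. Qed.
Lemma BreZr k v w : Bre Bm w (k *: v) = k * Bre Bm w v.
Proof. by rewrite /Bre linearZ -scalemxAr mxE. Qed.
Lemma BreNl v w : Bre Bm (- v) w = - Bre Bm v w.
Proof. by rewrite -scaleN1r BreZl mulN1r. Qed.

Lemma latvD a b : latv Lb (a + b) = latv Lb a + latv Lb b.
Proof.
by rewrite /latv -mulmxDl; congr (_ *m _); apply/rowP => l; rewrite !mxE intrD.
Qed.
Lemma latvN a : latv Lb (- a) = - latv Lb a.
Proof.
by rewrite /latv -mulNmx; congr (_ *m _); apply/rowP => l; rewrite !mxE mulrNz.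
Qed.

Lemma BC_vC v w : BC Bm (vC v) (vC w) = toC (Bre Bm v w).
Proof. by rewrite /BC /Bre /vC map_trmx -!map_toC_mul mxE. Qed.
Lemma QC_vC v : QC Bm (vC v) = toC (Qre Bm v).
Proof. by rewrite /QC /Qre BC_vC toCM toCV toC_nat. Qed.
Definition imrow (z : 'rV[C]_n) : 'rV[R]_n := \row_l cIm (z 0 l).

Lemma Im_BC v (z : 'rV[C]_n) : cIm (BC Bm (vC v) z) = Bre Bm v (imrow z).
Proof.
rewrite /BC /Bre !mxE cIm_sum; apply: eq_bigr => l _.
by rewrite /vC -map_toC_mul [z^T _ _]mxE [(_ ^T) _ _]mxE !mxE cIm_toCM.
Qed.

Hypothesis pos : posdef_sym Bm.

Lemma BreC v w : Bre Bm v w = Bre Bm w v.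
Proof.
have [sym _] := pos; rewrite /Bre.
have -> : v *m Bm *m w^T = (w *m Bm *m v^T)^T by rewrite !trmx_mul trmxK sym mulmxA.
by rewrite mxE.
Qed.

Lemma Bre_ge0 v : 0 <= Bre Bm v v.
Proof.
have [->|v0] := eqVneq v 0; first by rewrite /Bre !mul0mx mxE.
by apply: ltW; case: pos => _; apply.
Qed.

Lemma Bre_CS v w : Bre Bm w v ^+ 2 <= Bre Bm w w * Bre Bm v v.
Proof.
have [->|w0] := eqVneq w 0; first by rewrite /Bre !mul0mx !mxE expr0n mul0r.
have ww : 0 < Bre Bm w w by case: pos => _; apply.
have := Bre_ge0 (Bre Bm w w *: v + (- Bre Bm w v) *: w).
rewrite !(BreDl, BreDr, BreZl, BreZr) (BreC v w).
move: (Bre Bm w w) (Bre Bm w v) (Bre Bm v v) ww => a b c a0 h.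
have : 0 <= a * (a * c - b ^+ 2) by lra.
by rewrite pmulr_rge0 // subr_ge0.
Qed.

Lemma QreD v w : Qre Bm (v + w) = Qre Bm v + Bre Bm v w + Qre Bm w.
Proof. by rewrite /Qre !(BreDl, BreDr) (BreC w v); field. Qed.

Lemma Bm_unit : Bm \in unitmx.
Proof.
rewrite -row_free_unit; apply: contraT => nf.
have /negP kn : kermx Bm != 0 by rewrite kermx_eq0.
case: (pselect (exists i, row i (kermx Bm) != 0)) => [[i ri]|no].
  have kB : row i (kermx Bm) *m Bm = 0 by rewrite -row_mul mulmx_ker row0.
  have [_ /(_ _ ri)] := pos; by rewrite /Bre kB mul0mx mxE ltxx.
case: kn; apply/eqP/row_matrixP => i; rewrite row0; apply/eqP/negPn/negP => h.
by apply: no; exists i.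
Qed.

Hypothesis lat : is_lattice Lb.

(** The basis dual to the rows of [Lb] with respect to $B$: pairing with it reads off lattice
    coordinates. *)
Definition dualv (l : 'I_n) : 'rV[R]_n := row l (invmx (Bm *m Lb^T)).

Lemma dualvE l a : Bre Bm (dualv l) (latv Lb a) = (a 0 l)%:~R.
Proof.
have u : Bm *m Lb^T \in unitmx by rewrite unitmx_mul Bm_unit unitmx_tr.
rewrite /Bre /latv /dualv trmx_mul !mulmxA -[_ *m Bm *m _]mulmxA.
by rewrite -row_mul mulVmx // -row_mul mul1mx !mxE.
Qed.

(** Cauchy-Schwarz against each dual vector bounds the coordinates by $B(v,v)=2Q(v)$; adding 1 to
    the constant [S] guarantees that it can be inverted. *)
Lemma Qre_lower : exists2 k : R, 0 < k & forall v, k * \sum_l Bre Bm (dualv l) v ^+ 2 <= Qre Bm v.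
Proof.
pose S := \sum_l Bre Bm (dualv l) (dualv l).
have S0 : 0 <= S by apply: sumr_ge0 => l _; exact: Bre_ge0.
exists (2 * (S + 1))^-1; first by rewrite invr_gt0; lra.
move=> v; rewrite mulrC ler_pdivrMr; last by lra.
apply: (@le_trans _ _ (S * Bre Bm v v)).
  by rewrite /S mulr_suml; apply: ler_sum => l _; exact: Bre_CS.
rewrite /Qre; have := Bre_ge0 v; nra.
Qed.

(** With $y=\mathrm{Im}\,\tau$ and $u=\mathrm{Im}\,z$, completing the square gives
    $yQ(v)+B(v,u)=yQ(v+u/y)-Q(u)/y$. The shift goes into [t'] and the last term into [K0]. *)
Lemma theta_abssum (t : 'rV[R]_n) (tau : C) (z : 'rV[C]_n) : inH tau ->
  abssum (fun a : 'rV[int]_n => ee (tau * QC Bm (vC (t + latv Lb a)) + BC Bm (vC (t + latv Lb a)) z)).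
Proof.
move=> ht; pose y := cIm tau; have y0 : 0 < y := ht.
pose u := imrow z; pose t' := t + y^-1 *: u.
have [k k0 hk] := Qre_lower.
have pp := pi_gt0 R.
pose del := 2 * pi * y * k; have del0 : 0 < del by rewrite !mulr_gt0.
pose s l := Bre Bm (dualv l) t'.
pose K0 := 2 * pi * (y^-1 * Qre Bm u) + \sum_l del * (`|s l| + 1).
pose r := expR (- del).
have r0 : 0 <= r := expR_ge0 _.
have r1 : r < 1 by rewrite /r expR_lt1 oppr_lt0.
exists (expR K0 * ((1 - r)^-1 *+ 2) ^+ n) => F uF.
apply: le_trans (ler_wpM2l (expR_ge0 K0) (box_sum (n := n) (g := fun z => r ^+ absz z) _ (fun F => @int_geom r F r0 r1) uF)); last first.
  by move=> w; exact: exprn_ge0.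
rewrite mulr_sumr; apply: ler_sum => a _; rewrite normc_ee.
set v := t + latv Lb a.
have -> : cIm (tau * QC Bm (vC v) + BC Bm (vC v) z) = y * Qre Bm v + Bre Bm v u.
  by rewrite cImD Im_BC QC_vC mulrC cIm_toCM mulrC.
have -> : expR K0 * \prod_l r ^+ absz (a 0 l) = expR (K0 - \sum_l del * `|(a 0 l)%:~R|).
  rewrite (expRD K0); congr (_ * _); rewrite -sumrN (big_morph _ (@expRD R) (expR0 R)).
  apply: eq_bigr => l _; rewrite /r -expRM_natl; congr expR.
  by rewrite mulrN mulrC -intr_norm natr_absz.
rewrite ler_expR.
have -> : y * Qre Bm v + Bre Bm v u = y * Qre Bm (t' + latv Lb a) - y^-1 * Qre Bm u.
  have -> : t' + latv Lb a = v + y^-1 *: u by rewrite /t' /v addrAC.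
  rewrite QreD BreZr.
  have -> : Qre Bm (y^-1 *: u) = y^-1 ^+ 2 * Qre Bm u by rewrite /Qre BreZl BreZr; ring.
  by field; rewrite gt_eqF.
have h1 := hk (t' + latv Lb a).
(* $X^2\ge|X|-1$ weakens the quadratic bound to a linear one in each coordinate; the majorant is
   then a product of geometric series. *)
have h2 : \sum_l (`|(a 0 l)%:~R| - (`|s l| + 1)) <= \sum_l Bre Bm (dualv l) (t' + latv Lb a) ^+ 2.
  apply: ler_sum => l _; rewrite BreDr dualvE -/(s l).
  move: (s l) ((a 0 l)%:~R : R) => p q.
  have := ler_normB (p + q) p; rewrite addrAC subrr add0r.
  have := real_normK (num_real (p + q)); have := sqr_ge0 (`|p + q| - 1).
  by nra.
have h3 : \sum_l del * `|(a 0 l)%:~R| - \sum_l del * (`|s l| + 1) =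
    del * \sum_l (`|(a 0 l)%:~R| - (`|s l| + 1)).
  by rewrite -sumrB mulr_sumr; apply: eq_bigr => l _; rewrite mulrBr.
rewrite /K0.
have h4 : del * \sum_l (`|(a 0 l)%:~R| - (`|s l| + 1)) <= 2 * pi * y * Qre Bm (t' + latv Lb a).
  apply: le_trans (_ : 2 * pi * y * (k * \sum_l Bre Bm (dualv l) (t' + latv Lb a) ^+ 2) <= _).
    by rewrite /del -[leLHS]mulrA ler_wpM2l ?mulr_ge0 ?(ltW pp) ?(ltW y0) // ler_wpM2l // ltW.
  by rewrite ler_wpM2l // !mulr_ge0 ?(ltW pp) ?(ltW y0).
rewrite -h3 in h4; move: h4; move: (\sum_l _) (\sum_l _) (Qre Bm _) (Qre Bm _) => A B Q1 Q2 h4.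
by lra.
Qed.

Lemma thetaL_hsum t tau z : inH tau ->
  hsum (fun a : 'rV[int]_n => ee (tau * QC Bm (vC (t + latv Lb a)) + BC Bm (vC (t + latv Lb a)) z))
    (thetaL Bm Lb t tau z).
Proof.
move=> ht; have [s hs] := abssum_hsum (theta_abssum t z ht).
rewrite /thetaL; case: xgetP => [s' -> h|/(_ s)]; first exact/HasSum_hsum.
by case; exact/HasSum_hsum.
Qed.

End Theta.

Section ThetaDecomposition.
Variable R : realType.
Local Notation C := R[i].
Variables (n : nat) (Bm Lb : 'M[R]_n).
Hypothesis pos : posdef_sym Bm.

(** Real [z] suffice, since there the exponentials are unitary characters. The direction $t-t_0$
    separates $t$ from $t_0$ because $B(t-t_0,t-t_0)>0$. *)
Lemma fourier_uniq (b : 'rV[R]_n -> C) :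
  (forall x : 'rV[R]_n, hsum (fun t => b t * ee (BC Bm (vC t) (vC x))) 0) -> forall t, b t = 0.
Proof.
move=> h t0; apply: (@char_uniq R 'rV[R]_n _ (fun x t => ee (toC (Bre Bm t x))) b t0).
- by move=> x t; rewrite normc_ee /= mulr0 oppr0 expR0.
- by move=> x y t; rewrite BreDr toCD eeD.
- by move=> x; apply: eq_hsum (h x) => t; rewrite BC_vC.
move=> t tt0 _; have D0 : 0 < Bre Bm (t - t0) (t - t0).
  by case: pos => _; apply; rewrite subr_eq0.
exists ((2 * Bre Bm (t - t0) (t - t0))^-1 *: (t - t0)).
rewrite !BreZr; set x := Bre Bm t (t - t0); set y := Bre Bm t0 (t - t0).
have -> : Bre Bm (t - t0) (t - t0) = x - y by rewrite /x /y -BreNl -BreDl.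
rewrite ![(2 * _)^-1 * _]mulrC; apply: ee_sep.
by apply: contraTneq D0 => e; rewrite BreDl BreNl -/x -/y e subrr ltxx.
Qed.

Lemma QC0 : QC Bm (0 : 'rV[C]_n) = 0.
Proof. by rewrite /QC /BC !mul0mx mxE mul0r. Qed.

Lemma BC_addr (u v w : 'rV[C]_n) : BC Bm u (v + w) = BC Bm u v + BC Bm u w.
Proof. by rewrite /BC linearD mulmxDr mxE. Qed.
Lemma BC_scaler k (u v : 'rV[C]_n) : BC Bm u (k *: v) = k * BC Bm u v.
Proof. by rewrite /BC linearZ -scalemxAr mxE. Qed.

Lemma csqrt1 : csqrt (1 : C) = 1.
Proof.
rewrite /csqrt /= expr1n expr0n addr0 sqrtr1 ltxx subrr mul0r sqrtr0 mulr0.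
by rewrite divff ?sqrtr1 // pnatr_eq0.
Qed.

Variables (m : nat) (k2 : int).

Lemma slash_ell (a b : 'rV[int]_n) (phi : C -> 'rV[C]_n -> 'cV[C]_m) tau z :
  slashJ Bm Lb k2 (MElt 1%:M false a b false) phi tau z =
  ee (tau * QC Bm (vC (latv Lb a)) + BC Bm (vC (latv Lb a)) z +
      BC Bm (vC (latv Lb a)) (vC (latv Lb b)) / 2) *:
    phi tau (z + tau *: vC (latv Lb a) + vC (latv Lb b)).
Proof.
rewrite /slashJ /= /jfac /mobius /ga /gb /gc /gd !mxE /=.
rewrite !mul0r !add0r oppr0 !mul0r !mul1r !addr0 divr1 invr1 scale1r mulr1 add0r.
by rewrite csqrt1 exp1rz mul1r.
Qed.

Variables (G : 'M[int]_2 -> Prop) (rho : melt n -> 'M[C]_m).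
Hypothesis G1 : G 1%:M.
Hypothesis rho1 : forall a : 'rV[int]_n, rho (MElt 1%:M false a 0 false) = 1%:M /\
                          rho (MElt 1%:M false 0 a false) = 1%:M.
Hypothesis lat : is_lattice Lb.
Variables (d : nat) (t : 'I_d -> 'rV[R]_n).
Hypothesis reps : dual_reps Bm Lb t.

Lemma vC0 : vC (0 : 'rV[R]_n) = 0.
Proof. by apply/rowP => l; rewrite !mxE. Qed.
Lemma latv0 : latv Lb 0 = 0.
Proof. by rewrite /latv map_mx0 mul0mx. Qed.

Lemma latv_inj : injective (latv Lb).
Proof.
move=> a b e; have : latv Lb (a - b) = 0 by rewrite latvD latvN e subrr.
move=> /(congr1 (mulmx^~ (invmx Lb))); rewrite /latv mulmxK // mul0mx => /rowP h.
apply/rowP => l; have := h l; rewrite !mxE => /eqP.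
by rewrite intr_eq0 subr_eq0 => /eqP.
Qed.

Lemma rep_inj : injective (fun q : 'I_d * 'rV[int]_n => t q.1 + latv Lb q.2).
Proof.
move=> [j a] [j' a'] /= e; have [tL hr] := reps.
have sL : inLsharp Bm Lb (t j + latv Lb a - latv Lb a) by rewrite addrK.
have [j0 [_ u]] := hr (t j) (tL j).
have e1 : j = j0 by apply: u; exists 0; rewrite subrr latv0.
have e2 : j' = j0.
  apply: u; exists (a' - a); rewrite latvD latvN.
  have -> : t j = t j' + latv Lb a' - latv Lb a by rewrite -e addrK.
  by rewrite addrAC [t j' + _]addrC addrK.
have jj : j = j' by rewrite e1 e2.
by rewrite jj in e *; congr (_, _); apply: latv_inj; apply: addrI e.
Qed.

Lemma rep_surj v : inLsharp Bm Lb v -> exists q : 'I_d * 'rV[int]_n, t q.1 + latv Lb q.2 = v.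
Proof.
move=> hv; have [_ hr] := reps; have [j [[a ha] _]] := hr v hv.
by exists (j, a); rewrite /= -ha addrC subrK.
Qed.

(** For fixed $\tau$, [bt r tau v] is the coefficient of $e(B(v,z))$. The elements $([0,w],1)$ force
    its support into $L^\sharp$, and the elements $([a,0],1)$ determine it on each coset of $L$ from
    one value. Adding $\tau Q(t_j)$ to $\tau(Q(a)+B(t_j,a))$ gives $\tau Q(t_j+a)$, whence the
    factor $e(-Q(t_j)\tau)$ in [H]. *)
Lemma theta_decomp (phi : C -> 'rV[C]_n -> 'cV[C]_m) :
  JForm JWeakHol G Bm Lb rho k2 phi ->
  exists H : 'I_d -> 'I_m -> C -> C,
    (forall j r, qseries (fun tau => H j r tau * ee (toC (Qre Bm (t j)) * tau))) /\
    forall r tau z, inH tau ->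
      hsum (fun q : 'I_d * 'rV[int]_n => H q.1 r tau *
         ee (tau * QC Bm (vC (t q.1 + latv Lb q.2)) + BC Bm (vC (t q.1 + latv Lb q.2)) z))
        (phi tau z r 0).
Proof.
move=> [_ [inv fou]].
have [M [M0 [c [_ [sc hs0]]]]] := fou (MElt 1%:M false 0 0 false) (det1_id).
have hs r tau z (ht : inH tau) : hsum (fun p : int * 'rV[R]_n => c p.1 p.2 r 0 *
   (ee (toC (p.1%:~R / M%:R) * tau) * ee (BC Bm (vC p.2) z))) (phi tau z r 0).
  have /HasSum_mx /(_ r) := hs0 tau z ht; rewrite slash_id; apply: eq_hsum => q /=.
  by rewrite mxE mulrC toCfrac.
pose bt r tau v := tsum (fun al : int => c al v r 0 * ee (toC (al%:~R / M%:R) * tau)).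
have btP r tau v (ht : inH tau) : hsum (fun al : int => c al v r 0 * ee (toC (al%:~R / M%:R) * tau)) (bt r tau v).
  apply: tsumP; have := abssum_inj (h := fun al : int => (al, v)) _ (hsum_abssum (hs r tau 0 ht)).
  move=> /(_ (fun i j e => congr1 fst e)); apply: eq_abssum => al /=.
  by rewrite /BC trmx0 mulmx0 mxE ee0 mulr1.
have hb r tau z (ht : inH tau) : hsum (fun v => bt r tau v * ee (BC Bm (vC v) z)) (phi tau z r 0).
  apply: (hsum_snd (hs r tau z ht)) => v /=; rewrite mulrC.
  by apply: eq_hsum (hsumZ (ee (BC Bm (vC v) z)) (btP r tau v ht)) => al; ring.
have val a b : valid G (MElt (n := n) 1%:M false a b false) by split; [exact: det1|].
have per r tau v w (ht : inH tau) : bt r tau v * (ee (toC (Bre Bm v (latv Lb w))) - 1) = 0.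
  apply: (fourier_uniq (b := fun v => bt r tau v * (ee (toC (Bre Bm v (latv Lb w))) - 1))) => x.
  have i1 := inv _ (val 0 w) tau (vC x) ht.
  rewrite slash_ell (rho1 w).2 mul1mx latv0 vC0 QC0 mulr0 scaler0 addr0 in i1.
  have B0 u : BC Bm (0 : 'rV[C]_n) u = 0 by rewrite /BC !mul0mx mxE.
  rewrite !B0 mul0r !addr0 ee0 scale1r in i1.
  have := hsumB (hb r tau (vC x + vC (latv Lb w)) ht) (hb r tau (vC x) ht).
  rewrite i1 subrr; apply: eq_hsum => u.
  by rewrite BC_addr eeD !BC_vC; ring.
have ell r tau v a (ht : inH tau) : bt r tau (v + latv Lb a) =
    bt r tau v * ee (tau * toC (Qre Bm (latv Lb a) + Bre Bm v (latv Lb a))).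
  apply/eqP; rewrite -subr_eq0; apply/eqP; set w := latv Lb a.
  pose b' u := bt r tau u - bt r tau (u - w) * ee (tau * toC (Qre Bm w + Bre Bm (u - w) w)).
  suff : b' (v + w) = 0 by rewrite /b' addrK.
  apply: fourier_uniq => x.
  have i1 := inv _ (val a 0) tau (vC x) ht.
  rewrite slash_ell (rho1 a).1 mul1mx latv0 vC0 !addr0 -/w in i1.
  have B0 u : BC Bm u (0 : 'rV[C]_n) = 0 by rewrite /BC trmx0 mulmx0 mxE.
  rewrite B0 mul0r addr0 in i1.
  have h1 := hsumZ (ee (tau * QC Bm (vC w) + BC Bm (vC w) (vC x))) (hb r tau (vC x + tau *: vC w) ht).
  have e : ee (tau * QC Bm (vC w) + BC Bm (vC w) (vC x)) * phi tau (vC x + tau *: vC w) r 0 = phi tau (vC x) r 0.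
    by rewrite -i1 mxE.
  rewrite e in h1.
  have h2 : hsum (fun u => bt r tau (u - w) * ee (tau * toC (Qre Bm w + Bre Bm (u - w) w)) *
      ee (BC Bm (vC u) (vC x))) (phi tau (vC x) r 0).
    apply: (@hsum_reindex _ _ _ (fun u => u + w)) => [u u' /addIr //|u _|]; first by exists (u - w); rewrite subrK.
    apply: eq_hsum h1 => u /=; rewrite addrK mulrCA -mulrA -!eeD; congr (_ * ee _).
    by rewrite BC_addr BC_scaler QC_vC !BC_vC BreDl !toCD; ring.
  have := hsumB (hb r tau (vC x) ht) h2; rewrite subrr; apply: eq_hsum => u.
  by rewrite /b' mulrBl.
exists (fun j r tau => bt r tau (t j) * ee (- (toC (Qre Bm (t j)) * tau))); split=> [j r|r tau z ht].
  apply: (@qseries_ext _ (fun tau => bt r tau (t j))) => [tau ht|]; first by rewrite -mulrA eeN mulr1.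
  have [N0 hN] := sc.
  exists M, (Num.floor (N0 * M%:R)), (fun al => c al (t j) r 0); split=> // [al ca|tau ht]; last exact: btP.
  have cn : c al (t j) != 0 by apply: contraNneq ca => ->; rewrite mxE.
  rewrite -(ler_int R); apply: le_trans (Num.Theory.floor_le _) _.
  by rewrite -ler_pdivlMr ?ltr0n //; exact: hN cn.
have hj := hb r tau z ht.
apply: eq_hsum (hsum_reindex_inv rep_inj _ hj) => [[j a]|v bv] /=.
  rewrite (ell r tau (t j) a ht) -!mulrA -!eeD; congr (_ * ee _).
  by rewrite QC_vC (QreD pos) !toCD; ring.
apply: rep_surj => _ [w ->].
apply: (@ee_toC_eq1 R); apply/eqP; rewrite -subr_eq0.
have /eqP := per r tau v w ht; rewrite mulf_eq0 => /orP[/eqP b0|//].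
by rewrite b0 mul0r eqxx in bv.
Qed.

End ThetaDecomposition.

(** * Injectivity *)

Section Triangular.
Variable R : realType.
Local Notation C := R[i].
Variables (n m : nat) (Bm E : 'M[R]_n) (k2 : int).

Lemma tauD_ext s (f g : C -> 'cV[C]_m) : (forall tau, inH tau -> f tau = g tau) ->
  forall tau, inH tau -> tauD s f tau = tauD s g tau.
Proof.
move=> e; elim: s => [|s IH] tau ht; first exact: e.
rewrite /tauD /=; apply: near_eq_derive.
have := near_inH ht; apply: filterS => t; exact: IH.
Qed.

(** Each factor is $k+N$ with an integer $N\ge 0$, so a zero would make $k$ a nonpositive integer,
    that is, $k_2$ even and at most 0. *)
Lemma poch_neq0 s : ~ (k2 <= 0 /\ (2 %| k2)%Z) ->
  poch ((k2%:~R / 2 : C) + s%:R - 1 - (s %/ 2)%N%:R) (s %/ 2) != 0.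
Proof.
move=> hk; apply/prodf_neq0 => i _; apply/negP => /eqP h; apply: hk.
have il := ltn_ord i.
pose N := (s - 1 - s %/ 2 + i)%N.
have hN : (N%:R : C) = s%:R - 1 - (s %/ 2)%N%:R + i%:R.
  by rewrite /N natrD !natrB //; lia.
have : (k2%:~R : C) = (- (2 * N)%N%:Z)%:~R.
  apply/eqP; rewrite -subr_eq0; apply/eqP.
  transitivity (2 * ((k2%:~R / 2 : C) + s%:R - 1 - (s %/ 2)%N%:R + i%:R)); last by rewrite h mulr0.
  have -> : (k2%:~R / 2 : C) + s%:R - 1 - (s %/ 2)%N%:R + i%:R = k2%:~R / 2 + N%:R by rewrite hN; ring.
  by rewrite mulrNz opprK -[(2 * N)%N%:Z%:~R]/((2 * N)%:R) natrM; field.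
by move=> /intr_inj ->; split; lia.
Qed.

Lemma mi_sum_shift lam (L : {ffun 'I_n * 'I_n -> 'I_lam.+1}) (p : {ffun 'I_n -> nat}) :
  (forall i, (piL L i <= p i)%N) ->
  (mi_sum [ffun i => (p i - piL L i)%N] + 2 * sumL L = mi_sum p)%N.
Proof.
move=> h; rewrite -sum_piL /mi_sum -big_split /=; apply: eq_bigr => i _.
by rewrite ffunE subnK.
Qed.

Variables (d : nat) (P0 : 'I_d -> {ffun 'I_n -> nat}).

(** Subtracting $\pi(\Lambda)$ lowers the total degree by the even number $2s(\Lambda)$, so the
    parity condition of the order is respected and all coefficients occurring in $D_{k,p}$ stay
    within the hat. *)
Lemma in_hat_shift lam (L : {ffun 'I_n * 'I_n -> 'I_lam.+1}) (p : {ffun 'I_n -> nat}) :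
  (forall i, (piL L i <= p i)%N) -> in_hat P0 p -> in_hat P0 [ffun i => (p i - piL L i)%N].
Proof.
move=> h [j /andP[/forallP le od]]; exists j; apply/andP; split.
  by apply/forallP => i; rewrite ffunE (leq_trans (leq_subr _ _)).
rewrite -(eqP od) -(mi_sum_shift h) oddD oddM /=.
by rewrite addbF.
Qed.

Lemma hcoef_determined (phi1 phi2 : C -> 'rV[C]_n -> 'cV[C]_m) :
  ~ (k2 <= 0 /\ (2 %| k2)%Z) ->
  (forall p, in_hat P0 p -> forall tau, inH tau ->
     Dk Bm E k2 p phi1 tau = Dk Bm E k2 p phi2 tau) ->
  forall p, in_hat P0 p -> forall tau, inH tau -> hcoef E phi1 p tau = hcoef E phi2 p tau.
Proof.
move=> hk hD p; have [s] := ubnP (mi_sum p); elim: s p => // s IH p ps hp tau ht.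
have := hD p hp tau ht; rewrite /Dk /=; set lam := (mi_sum p %/ 2)%N.
have A0 : (4 : C) ^+ lam * lam`!%:R != 0.
  by rewrite mulf_neq0 ?natC_fact_neq0 // expf_neq0 // pnatr_eq0.
move=> /(scalerI A0).
pose L0 : {ffun 'I_n * 'I_n -> 'I_lam.+1} := [ffun=> ord0].
have s0 : sumL L0 = 0%N by apply: big1 => ij _; rewrite ffunE.
have p0 i : piL L0 i = 0%N.
  by rewrite /piL !big1 // => j _; rewrite ffunE.
have L0P : (sumL L0 <= lam)%N by rewrite s0.
rewrite (bigD1 L0 L0P) [X in _ = X](bigD1 L0 L0P).
(* The induction gives equality on the whole upper half plane, not only at [tau]; the
   $\tau$-derivatives in these terms require it. *)
have rest : forall L : {ffun 'I_n * 'I_n -> 'I_lam.+1}, (sumL L <= lam)%N && (L != L0) ->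
    tauD (sumL L) (hshift E phi1 p L) tau = tauD (sumL L) (hshift E phi2 p L) tau.
  move=> L /andP[Ll LL0]; apply: tauD_ext => // t t0.
  rewrite /hshift; case: ifP => [/forallP le|_]; last by [].
  apply: IH; [|exact: in_hat_shift|exact: t0].
  have := mi_sum_shift le; suff : (0 < sumL L)%N by lia.
  rewrite lt0n; apply: contra LL0; rewrite sum_nat_eq0 => /forallP z.
  by apply/eqP/ffunP => ij; rewrite ffunE; apply/val_inj/eqP; exact: z ij.
under [X in _ + X = _]eq_bigr => L hL do rewrite rest //.
move=> /addIr.
have hs phi : hshift E phi p L0 = hcoef E phi p.
  rewrite /hshift; case: ifP => [_|/negP []]; last by apply/forallP => i; rewrite p0.
  by congr hcoef; apply/ffunP => i; rewrite ffunE p0 subn0.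
rewrite !s0 /tauD /= !hs; apply: scalerI.
rewrite big1 => [|ij _]; last by rewrite ffunE expr0 fact0 divr1.
by rewrite mul1r prodk_poch // subn0 poch_neq0.
Qed.

(** A term with $\Lambda\ne 0$ contains a positive power of the zero exponent $n$; the term
    $\Lambda=0$ contains a Taylor coefficient of positive degree of a constant. *)
Lemma Dk_term_zero p : p != [ffun=> 0%N] -> Dk_term Bm E k2 p 0 (fun _ : 'I_n => (0 : R)) = 0.
Proof.
move=> p0; rewrite /Dk_term big1 ?mulr0 // => L _; apply/eqP; rewrite mulf_eq0; apply/orP; right.
have [s0|s0] := eqVneq (sumL L) 0%N; last by rewrite expr0n (negbTE s0) mul0r.
rewrite s0 expr0 mul1r; case: ifP => // _.
have [l pl] : exists l, p l != 0%N.
  apply/existsP; apply: contraR p0; rewrite negb_exists => /forallP h.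
  by apply/eqP/ffunP => l; rewrite ffunE; apply/eqP; have := h l; rewrite negbK.
have pi0 : piL L l = 0%N.
  have := sum_piL L; rewrite s0 muln0 => /eqP; rewrite sum_nat_eq0 => /forallP /(_ l) /eqP.
  by [].
rewrite /exp_moment (bigD1 l) //= ffunE pi0 subn0 mulr0 expr0n (negbTE pl) !mul0r //.
Qed.

(** Derivatives are linear on differentiable functions only. Placing both expansions on the disjoint
    union of their index types makes the combination itself an expansion, and linearity becomes that
    of sums. *)
Lemma Dk_comb (I1 I2 : eqType) (c1 : 'I_m -> I1 -> C) a1 b1 (c2 : 'I_m -> I2 -> C) a2 b2 phi1 phi2 z p tau :
  JEXP E c1 a1 b1 phi1 -> JEXP E c2 a2 b2 phi2 -> inH tau ->
  Dk Bm E k2 p (fun tau' x => z *: phi1 tau' x + phi2 tau' x) tau =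
  z *: Dk Bm E k2 p phi1 tau + Dk Bm E k2 p phi2 tau.
Proof.
move=> h1 h2 ht.
pose c r (q : I1 + I2) := match q with inl i => z * c1 r i | inr i => c2 r i end.
pose a (q : I1 + I2) := match q with inl i => a1 i | inr i => a2 i end.
pose b (q : I1 + I2) := match q with inl i => b1 i | inr i => b2 i end.
have h : JEXP E c a b (fun tau' x => z *: phi1 tau' x + phi2 tau' x).
  move=> r t x t0; rewrite !mxE.
  by apply: eq_hsum (hsum_sumtype (hsumZ z (h1 r t x t0)) (h2 r t x t0)) => -[i|i] /=; rewrite ?mulrA.
apply/colP => r; rewrite [RHS]mxE [X in X + _]mxE.
apply: hsum_unique (Dk_TEXP Bm k2 h p r ht) _.
apply: eq_hsum (hsum_sumtype (hsumZ z (Dk_TEXP Bm k2 h1 p r ht)) (Dk_TEXP Bm k2 h2 p r ht)).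
by move=> [i|i] /=; rewrite ?mulrA.
Qed.

End Triangular.

(** * Recovering a form from finitely many Taylor coefficients *)

Section Injectivity.
Variable R : realType.
Local Notation C := R[i].
Variables (n m : nat) (Bm Lb E : 'M[R]_n) (d : nat) (t : 'I_d -> 'rV[R]_n).
Hypothesis pos : posdef_sym Bm.
Hypothesis lat : is_lattice Lb.
Hypothesis intg : integral_lattice Bm Lb.
Hypothesis reps : dual_reps Bm Lb t.

Definition thetaD (p : {ffun 'I_n -> nat}) (j : 'I_d) (tau : C) : C :=
  partialn (W := C^o) p (fun x => (thetaL Bm Lb (t j) tau (x *m EC E) : C^o)) 0.

Lemma thetaD_TEXP (p : {ffun 'I_n -> nat}) j :
  TEXP (fun a => \prod_l (tpi R * toC (bcoord Bm E (t j + latv Lb a) l)) ^+ p l)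
    (fun a => Qre Bm (t j + latv Lb a)) (thetaD p j).
Proof.
move=> tau ht.
have h : ZEXP (fun a : 'rV[int]_n => ee (toC (Qre Bm (t j + latv Lb a)) * tau))
    (fun a => bcoord Bm E (t j + latv Lb a)) (fun x => thetaL Bm Lb (t j) tau (x *m EC E)).
  move=> x; apply: eq_hsum (thetaL_hsum pos lat (t j) (x *m EC E) ht) => a.
  by rewrite eeD QC_vC EC_row [tau * _]mulrC.
apply: eq_hsum (partialn_C0 p h (0 : 'rV[C]_n)) => a.
have -> : \sum_l toC (bcoord Bm E (t j + latv Lb a) l) * (0 : 'rV[C]_n) 0 l = 0.
  by apply: big1 => l _; rewrite mxE mulr0.
by rewrite ee0 mulr1 mulrC.
Qed.

(** Among the $d+1$ multiples $kt_j$ with $0\le k\le d$, two lie in the same coset of $L$. *)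
Lemma rep_torsion j : exists N : nat, (0 < N)%N /\ inL Lb (N%:R *: t j).
Proof.
have [tL hr] := reps.
have kL (k : 'I_d.+1) : inLsharp Bm Lb ((k : nat)%:R *: t j).
  move=> w wL; have [z hz] := tL j w wL; exists ((k : nat)%:Z * z).
  by rewrite BreZl hz intrM.
pose f k := sval (cid (hr _ (kL k))).
have fP (k : 'I_d.+1) : inL Lb ((k : nat)%:R *: t j - t (f k)) by rewrite /f; case: cid => ? [].
have : ~~ injectiveb f.
  apply/negP => /injectiveP /leq_card; by rewrite !card_ord ltnn.
move=> /injectivePn [x [y xy fxy]].
wlog lt : x y xy fxy / (x < y)%N.
  move=> W; case: (ltngtP x y) => [h|h|h]; first exact: (W x y).
    by apply: (W y x); rewrite // eq_sym.
  by case/negP: xy; apply/eqP/val_inj.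
exists (y - x)%N; split; first by rewrite subn_gt0.
have [a ha] := fP x; have [b hb] := fP y.
exists (b - a); rewrite latvD latvN -ha -hb fxy natrB ?(ltnW lt) // scalerBl.
by rewrite opprB addrA subrK.
Qed.

Lemma thetaD_qseries p j : qseries (thetaD p j).
Proof.
have [N [N0 [w hw]]] := rep_torsion j; have [tL _] := reps.
apply: (@qseries_family R _ _ _ _ (2 * N) 0 _ _ (thetaD_TEXP p j)); first by rewrite muln_gt0.
move=> a _; set v := latv Lb a.
have vL : inL Lb v by exists a.
have [z1 h1] := tL j _ (ex_intro _ w hw).
have [z2 h2] := tL j v vL.
have [z3 h3] := intg a a.
have NN : ((2 * N)%:R : R) != 0 by rewrite pnatr_eq0 muln_eq0 /= -lt0n.
(* $Q(t_j+v)=Q(t_j)+B(t_j,v)+Q(v)$ with denominators $2N$, 1 and 2; the first because $B(t_j,Nt_j)$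
   is an integer. *)
have e : Qre Bm (t j + v) = (z1 + (2 * N)%:Z * z2 + N%:Z * z3)%:~R / (2 * N)%:R.
  apply: (mulIf NN); rewrite divfK // (QreD pos) /Qre h2 h3 !intrD !intrM -h1 BreZr.
  by rewrite natrM -[N%:Z%:~R]/(N%:R) -[(2 * N)%:Z%:~R]/((2 * N)%:R) natrM; field.
exists (z1 + (2 * N)%:Z * z2 + N%:Z * z3) => //.
have : 0 <= Qre Bm (t j + v) by rewrite /Qre divr_ge0 ?Bre_ge0.
by rewrite e pmulr_lge0 ?invr_gt0 ?ltr0n ?muln_gt0 // ler0z.
Qed.

Lemma hcoef_theta (H : 'I_d -> 'I_m -> C -> C) (phi : C -> 'rV[C]_n -> 'cV[C]_m) tau p r :
  (forall r tau z, inH tau ->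
      hsum (fun q : 'I_d * 'rV[int]_n => H q.1 r tau *
         ee (tau * QC Bm (vC (t q.1 + latv Lb q.2)) + BC Bm (vC (t q.1 + latv Lb q.2)) z))
        (phi tau z r 0)) -> inH tau ->
  hcoef E phi p tau r 0 = (\prod_i ((p i)`!)%:R)^-1 * \sum_j H j r tau * thetaD p j tau.
Proof.
move=> hH ht; rewrite /hcoef mxE; congr (_ * _).
have h r' : ZEXP (fun q : 'I_d * 'rV[int]_n => H q.1 r' tau * ee (toC (Qre Bm (t q.1 + latv Lb q.2)) * tau))
    (fun q => bcoord Bm E (t q.1 + latv Lb q.2)) (fun x => phi tau (x *m EC E) r' 0).
  move=> x; apply: eq_hsum (hH r' tau (x *m EC E) ht) => q.
  by rewrite eeD QC_vC EC_row -mulrA [tau * _]mulrC.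
have h1 := partialn_vec p h r (0 : 'rV[C]_n).
apply: hsum_unique (hsum_fin (fun j => H j r tau * thetaD p j tau)).
apply: (hsum_fst h1) => j /=.
apply: eq_hsum (hsumZ (H j r tau) (thetaD_TEXP p j ht)) => a.
have -> : \sum_l toC (bcoord Bm E (t j + latv Lb a) l) * (0 : 'rV[C]_n) 0 l = 0.
  by apply: big1 => l _; rewrite mxE mulr0.
by rewrite ee0 mulr1 -!mulrA [_ * ee _]mulrC.
Qed.

Variables (P0 : 'I_d -> {ffun 'I_n -> nat}).

Lemma FdetE tau : Fdet Bm Lb E P0 t tau =
  \det (\matrix_(i < d, j < d) (tpi R ^- mi_sum (P0 i) * thetaD (P0 i) j tau)).
Proof. by []. Qed.

Lemma Fdet_qseries : qseries (Fdet Bm Lb E P0 t).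
Proof.
apply: (qseries_det (A := fun tau => \matrix_(i < d, j < d) (tpi R ^- mi_sum (P0 i) * thetaD (P0 i) j tau))).
move=> i j; apply: (@qseries_ext _ (fun tau => tpi R ^- mi_sum (P0 i) * thetaD (P0 i) j tau)) => [tau _|].
  by rewrite mxE.
by apply: qseries_mul; [exact: qseries_cst | exact: thetaD_qseries].
Qed.

(** The determinant may vanish at some points, so the system for the differences of the $H_j$ cannot
    be inverted pointwise. The adjugate only shows that each difference times $F$ is zero; the
    absence of zero divisors among $q$-series then gives equality at every $\tau$. *)
Lemma theta_injective (H1 H2 : 'I_d -> 'I_m -> C -> C) (phi1 phi2 : C -> 'rV[C]_n -> 'cV[C]_m) :
  (exists tau : C, inH tau /\ Fdet Bm Lb E P0 t tau != 0) ->
  (forall j r, qseries (fun tau => H1 j r tau * ee (toC (Qre Bm (t j)) * tau))) ->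
  (forall j r, qseries (fun tau => H2 j r tau * ee (toC (Qre Bm (t j)) * tau))) ->
  (forall r tau z, inH tau ->
      hsum (fun q : 'I_d * 'rV[int]_n => H1 q.1 r tau *
         ee (tau * QC Bm (vC (t q.1 + latv Lb q.2)) + BC Bm (vC (t q.1 + latv Lb q.2)) z))
        (phi1 tau z r 0)) ->
  (forall r tau z, inH tau ->
      hsum (fun q : 'I_d * 'rV[int]_n => H2 q.1 r tau *
         ee (tau * QC Bm (vC (t q.1 + latv Lb q.2)) + BC Bm (vC (t q.1 + latv Lb q.2)) z))
        (phi2 tau z r 0)) ->
  (forall i tau, inH tau -> hcoef E phi1 (P0 i) tau = hcoef E phi2 (P0 i) tau) ->
  forall tau z, inH tau -> phi1 tau z = phi2 tau z.
Proof.
move=> exF q1 q2 d1 d2 hh.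
have key j r tau : inH tau -> (H1 j r tau - H2 j r tau) * Fdet Bm Lb E P0 t tau = 0.
  move=> ht; rewrite FdetE; set A := \matrix_(i < d, j < d) _.
  pose u : 'cV[C]_d := \col_j (H1 j r tau - H2 j r tau).
  have Au : A *m u = 0.
    apply/colP => i; rewrite !mxE.
    have := congr1 (fun v : 'cV[C]_m => v r 0) (hh i tau ht).
    rewrite /= (hcoef_theta (P0 i) r d1 ht) (hcoef_theta (P0 i) r d2 ht).
    have fn : (\prod_i0 ((P0 i i0)`!)%:R : C)^-1 != 0.
      by rewrite invr_neq0 //; apply/prodf_neq0 => l _; exact: natC_fact_neq0.
    move=> /(mulfI fn) e.
    transitivity (tpi R ^- mi_sum (P0 i) * (\sum_j H1 j r tau * thetaD (P0 i) j tau -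
       \sum_j H2 j r tau * thetaD (P0 i) j tau)); last by rewrite e subrr mulr0.
    rewrite -sumrB mulr_sumr; apply: eq_bigr => k _; rewrite !mxE -mulrBl; ring.
  have := congr1 (mulmx (\adj A)) Au; rewrite mulmxA mul_adj_mx mulmx0.
  move=> /colP /(_ j); rewrite mul_scalar_mx !mxE => e.
  by rewrite mulrC.
have H12 j r tau : inH tau -> H1 j r tau = H2 j r tau.
  move=> ht; have b j' r' := qseries_add (q1 j' r') (qseries_mul (qseries_cst (-1 : C)) (q2 j' r')).
  (* The hypotheses provide $q$-series only for $H_j\,e(Q(t_j)\tau)$, so this nowhere vanishing
     factor is carried along and cancelled at the end. *)
  have z0 : forall tau, inH tau -> (H1 j r tau * ee (toC (Qre Bm (t j)) * tau) +
      -1 * (H2 j r tau * ee (toC (Qre Bm (t j)) * tau))) * Fdet Bm Lb E P0 t tau = 0.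
    move=> s hs; transitivity (ee (toC (Qre Bm (t j)) * s) * ((H1 j r s - H2 j r s) * Fdet Bm Lb E P0 t s)).
      by move: (Fdet _ _ _ _ _ _) (ee _) => F e; ring.
    by rewrite key // mulr0.
  have := qseries_mul_eq0 (b j r) Fdet_qseries z0 exF ht.
  rewrite mulN1r -mulrBl => /eqP; rewrite mulf_eq0 (negbTE (ee_neq0 _)) orbF subr_eq0.
  by move=> /eqP.
move=> tau z ht; apply/colP => r.
apply: hsum_unique (d1 r tau z ht) _; apply: eq_hsum (d2 r tau z ht) => q.
by rewrite H12.
Qed.

End Injectivity.

(** * Growth at the cusps *)

Section Supports.
Variable R : realType.
Local Notation C := R[i].
Variables (n m : nat) (Bm Lb E : 'M[R]_n) (k2 : int).
Variables (G : 'M[int]_2 -> Prop) (rho : melt n -> 'M[C]_m).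
Variables (phi : C -> 'rV[C]_n -> 'cV[C]_m) (p : {ffun 'I_n -> nat}).
Hypothesis pos : posdef_sym Bm.

Lemma ge0_num_frac (al : int) (M : nat) : (0 < M)%N -> 0 <= (al%:~R / M%:R : R) -> 0 <= al.
Proof. by move=> M0; rewrite pmulr_lge0 ?invr_gt0 ?ltr0n // ler0z. Qed.

Lemma Dk_weakhol : JForm JWeakHol G Bm Lb rho k2 phi ->
  MForm MWeakHol G rho (k2 + 2 * Posz (mi_sum p)) (Dk Bm E k2 p phi).
Proof.
move=> h; apply: (Dk_MForm h) => M c c' M0 [N0 hN] hc.
exists (Num.floor (N0 * M%:R)) => al /hc [v [cv _]].
rewrite -(ler_int R); apply: le_trans (Num.Theory.floor_le _) _.
by rewrite -ler_pdivlMr ?ltr0n //; exact: hN cv.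
Qed.

Lemma Dk_weak : JForm JWeak G Bm Lb rho k2 phi ->
  MForm MHol G rho (k2 + 2 * Posz (mi_sum p)) (Dk Bm E k2 p phi).
Proof.
move=> h; apply: (Dk_MForm h) => M c c' M0 hN hc al /hc [v [cv _]].
by apply: (ge0_num_frac M0); exact: hN cv.
Qed.

Lemma Dk_hol : JForm JHol G Bm Lb rho k2 phi ->
  MForm MHol G rho (k2 + 2 * Posz (mi_sum p)) (Dk Bm E k2 p phi).
Proof.
move=> h; apply: (Dk_MForm h) => M c c' M0 hN hc al /hc [v [cv _]].
apply: (ge0_num_frac M0); apply: le_trans (hN _ _ cv).
by rewrite /Qre divr_ge0 ?Bre_ge0.
Qed.

(** A constant term would come from some $t$ with $Q(t)\le 0$, hence $t=0$ by definiteness, and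
    there $D_{k,p}$ vanishes because $p\ne 0$. *)
Lemma Dk_cusp : p != [ffun=> 0%N] -> JForm JHol G Bm Lb rho k2 phi ->
  MForm MCusp G rho (k2 + 2 * Posz (mi_sum p)) (Dk Bm E k2 p phi).
Proof.
move=> p0 h; apply: (Dk_MForm h) => M c c' M0 hN hc al /hc [v [cv Dv]].
have Qv := hN _ _ cv.
have Q0 : 0 <= Qre Bm v by rewrite /Qre divr_ge0 ?Bre_ge0.
rewrite lt_def (ge0_num_frac M0 (le_trans Q0 Qv)) andbT.
apply: contra_neqN Dv => /eqP al0; rewrite al0 mul0r in Qv *.
have v0 : v = 0.
  apply/eqP; apply: contraT => vn; have [_ /(_ v vn)] := pos.
  by move: Qv; rewrite /Qre; lra.
have -> : bcoord Bm E v = fun=> 0 by apply/funext => l; rewrite /bcoord v0 /Bre !mul0mx mxE.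
exact: Dk_term_zero.
Qed.

End Supports.

Theorem theorem6p2 (R : realType) (n m : nat)
  (Bm Lb : 'M[R]_n) (G : 'M[int]_2 -> Prop) (rho : melt n -> 'M[R[i]]_m)
  (k2 : int) (E : 'M[R]_n) (d : nat)
  (P0 : 'I_d -> {ffun 'I_n -> nat}) (t : 'I_d -> 'rV[R]_n) :
  (0 < n)%N ->
  posdef_sym Bm ->
  is_lattice Lb -> integral_lattice Bm Lb ->
  fin_index_subgroup G ->
  is_rep G Bm Lb rho ->
  rho (MElt 1%:M false 0 0 true) = - 1%:M ->
  (forall a : 'rV[int]_n, rho (MElt 1%:M false a 0 false) = 1%:M /\
                          rho (MElt 1%:M false 0 a false) = 1%:M) ->
  (* k = k2/2 is not in {0, -1, -2, ...} *)
  ~ (k2 <= 0 /\ (2 %| k2)%Z) ->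
  E \in unitmx ->
  injective P0 ->
  dual_reps Bm Lb t ->
  (exists tau : R[i], inH tau /\ Fdet Bm Lb E P0 t tau != 0) ->
  (* J^! embeds into prod_{p in hat P0} M^!_{k+s(p)} *)
  (forall phi, JForm JWeakHol G Bm Lb rho k2 phi ->
     forall p, in_hat P0 p -> MForm MWeakHol G rho (k2 + 2 * Posz (mi_sum p)) (Dk Bm E k2 p phi))
  /\ (forall phi1 phi2 (c : R[i]),
        JForm JWeakHol G Bm Lb rho k2 phi1 -> JForm JWeakHol G Bm Lb rho k2 phi2 ->
        forall p, in_hat P0 p -> forall tau, inH tau ->
          Dk Bm E k2 p (fun tau' z => c *: phi1 tau' z + phi2 tau' z) tau
          = c *: Dk Bm E k2 p phi1 tau + Dk Bm E k2 p phi2 tau)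
  /\ (forall phi1 phi2,
        JForm JWeakHol G Bm Lb rho k2 phi1 -> JForm JWeakHol G Bm Lb rho k2 phi2 ->
        (forall p, in_hat P0 p -> forall tau, inH tau ->
           Dk Bm E k2 p phi1 tau = Dk Bm E k2 p phi2 tau) ->
        forall tau z, inH tau -> phi1 tau z = phi2 tau z)
  (* J^weak embeds into prod M_{k+s(p)} *)
  /\ (forall phi, JForm JWeak G Bm Lb rho k2 phi ->
        forall p, in_hat P0 p -> MForm MHol G rho (k2 + 2 * Posz (mi_sum p)) (Dk Bm E k2 p phi))
  (* if 0 in hat P0: J embeds into M_k x prod_{p <> 0} S_{k+s(p)} *)
  /\ (in_hat P0 [ffun => 0%N] ->
      forall phi, JForm JHol G Bm Lb rho k2 phi ->
        MForm MHol G rho k2 (Dk Bm E k2 [ffun => 0%N] phi) /\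
        forall p, in_hat P0 p -> p != [ffun => 0%N] ->
          MForm MCusp G rho (k2 + 2 * Posz (mi_sum p)) (Dk Bm E k2 p phi)).
Proof.
move=> _ pos lat intg [_ [G1 _]] _ _ rho1 hk _ _ reps exF.
have jexp phi : JForm JWeakHol G Bm Lb rho k2 phi ->
    exists (M : nat) (c : int -> 'rV[R]_n -> 'cV[R[i]]_m),
    JEXP E (fun r (q : int * 'rV[R]_n) => c q.1 q.2 r 0) (fun q => q.1%:~R / M%:R)
      (fun q => bcoord Bm E q.2) phi.
  move=> [_ [_ fou]]; have [M [_ [c [_ [_ h]]]]] := fou (MElt 1%:M false 0 0 false) det1_id.
  exists M, c; apply: JForm_JEXP => tau z ht.
  by have := h tau z ht; rewrite slash_id.
split; first by move=> phi h p _; exact (Dk_weakhol E p h).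
split.
  move=> phi1 phi2 c h1 h2 p _ tau ht.
  have [M1 [c1 e1]] := jexp _ h1; have [M2 [c2 e2]] := jexp _ h2.
  exact (Dk_comb Bm k2 c p e1 e2 ht).
split.
  move=> phi1 phi2 h1 h2 hD.
  have [H1 [q1 d1]] := theta_decomp pos G1 rho1 lat reps h1.
  have [H2 [q2 d2]] := theta_decomp pos G1 rho1 lat reps h2.
  apply: (theta_injective pos lat intg reps exF q1 q2 d1 d2) => i tau ht.
  apply: (hcoef_determined hk hD) ht.
  by exists i; apply/andP; split=> //; apply/forallP.
split; first by move=> phi h p _; exact (Dk_weak E p h).
move=> _ phi h; split=> [|p _ p0]; last exact (Dk_cusp E pos p0 h).
have := Dk_hol E [ffun=> 0%N] pos h.
have -> : mi_sum ([ffun=> 0%N] : {ffun 'I_n -> nat}) = 0%N by apply: big1 => i _; rewrite ffunE.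
by rewrite mulr0 addr0.
Qed.
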